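(* Let $n,\ell$ be nonnegative integers and put $R^\ell_n = P_n\mathcal{C}_\mu(\mathcal{A}^2_\ell)$ and $\widetilde R^\ell_n = P_n\mathcal{C}_\mu(\widetilde{\mathcal{A}}^2_\ell)$. The following assertions hold. (i) The space $R^\ell_n$ is an infinite-dimensional vector space spanned (in the Hilbert space sense) by the functions $H_{n+j-\ell-1,n}$, $j\ge \max(0,\ell+1-n)$; that is, these functions belong to $R^\ell_n$ and their linear span is dense in $R^\ell_n$ for the norm of $L^2_\mu$. (ii) The space $\widetilde R^0_0$ is trivial: $\widetilde R^0_0=\{0\}$. (iii) If $\ell+n>0$, then $\widetilde R^\ell_n$ is a finite-dimensional vector space of dimension $n+\ell$, and an orthogonal basis of $\widetilde R^\ell_n$ is given by the functions $H_{k,n}(z,\bar z)$, $k=0,1,\dots,n+\ell-1$.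
   Context: Let $d\mu = e^{-|z|^2}\,dx\,dy$ on $\mathbb{C}$ and let $L^2_\mu = L^2(\mathbb{C},d\mu)$ be the Hilbert space with scalar product $\langle f,g\rangle = \int_{\mathbb{C}} f\,\overline{g}\,d\mu$. The weighted Cauchy transform is the bounded operator on $L^2_\mu$ given by $$\mathcal{C}_\mu f(z) = \frac1\pi\int_{\mathbb{C}} \frac{f(\xi)}{z-\xi}\,d\mu(\xi).$$ For nonnegative integers $m,n$, the Itô–Hermite polynomials are $$H_{m,n}(z,\bar z) = \frac{(-1)^m n!}{(n-m)!}\,\bar z^{\,n-m}\,{}_1F_1(-m;\,n-m+1;\,|z|^2)\quad (m\le n),$$ $$H_{m,n}(z,\bar z) = \frac{(-1)^n m!}{(m-n)!}\, z^{m-n}\,{}_1F_1(-n;\,m-n+1;\,|z|^2)\quad (m\ge n),$$ where ${}_1F_1$ is Kummer's confluent hypergeometric function; they form an orthogonal basis of $L^2_\mu$. For $n\ge 0$, $\mathcal{A}_n^2$ is the closed subspace of $L^2_\mu$ of all convergent series $\sum_{j\ge0}\alpha_j H_{j,n}$ with $\sum_{j\ge 0} j!\,|\alpha_j|^2<\infty$ (the closed linear span of $\{H_{j,n}: j=0,1,2,\dots\}$), called the true poly-Bargmann space, and $P_n$ is the orthogonal projection of $L^2_\mu$ onto $\mathcal{A}_n^2$. For $\ell\ge 0$, $\widetilde{\mathcal{A}}^2_\ell$ is the closure in $L^2_\mu$ of the linear span of $\{H_{\ell,k}: k=0,1,2,\dots\}$. *)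

(* Defs.v *)
From HB Require Import structures.
From mathcomp Require Import all_boot all_order all_algebra.
From mathcomp Require Import all_classical all_reals all_analysis.
From mathcomp Require Import measurable_realfun complex.

Set Implicit Arguments.
Unset Strict Implicit.
Unset Printing Implicit Defensive.

Import Order.TTheory GRing.Theory Num.Theory.
Import numFieldNormedType.Exports.

Local Open Scope classical_set_scope.
Local Open Scope ring_scope.
Local Open Scope complex_scope.

(* The complex plane as a measurable space: (x, y) stands for x + iy. *)
Definition plane (R : realType) := (measurableTypeR R * measurableTypeR R)%type.

Definition toC (R : realType) (z : plane R) : R[i] := z.1 +i* z.2.

Definition sqabs (R : realType) (w : R[i]) : R :=
  complex.Re w ^+ 2 + complex.Im w ^+ 2.

Definition gauss_weight (R : realType) (z : plane R) : R :=
  expR (- sqabs (toC z)).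

(* d mu = exp(-|z|^2) dx dy *)
Definition gauss_mu (R : realType) (A : set (plane R)) : \bar R :=
  (\int[lebesgue_measure \x lebesgue_measure]_(z in A) (gauss_weight z)%:E)%E.

Section mu_measure.
Variable R : realType.

Lemma measurable_gauss_weight :
  measurable_fun [set: plane R] (@gauss_weight R).
Proof.
apply: measurableT_comp => //; apply: measurableT_comp => //.
by apply: measurable_funD; apply: measurable_funX;
  [exact: measurable_fst|exact: measurable_snd].
Qed.

Let mu0 : @gauss_mu R set0 = 0%E.
Proof. by rewrite /gauss_mu integral_set0. Qed.

Let mu_ge0 (A : set (plane R)) : (0 <= gauss_mu A)%E.
Proof. by apply: integral_ge0 => z _; rewrite lee_fin expR_ge0. Qed.

Let mu_sigma_additive : semi_sigma_additive (@gauss_mu R).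
Proof.
move=> F mF tF mUF; rewrite /gauss_mu ge0_integral_bigcup//=.
- apply: is_cvg_ereal_nneg_natsum_cond => k _ _; exact: mu_ge0.
- by apply/measurable_EFinP/measurable_funTS; exact: measurable_gauss_weight.
- by move=> z _; rewrite lee_fin expR_ge0.
Qed.

HB.instance Definition _ := isMeasure.Build _ _ _
  (@gauss_mu R) mu0 mu_ge0 mu_sigma_additive.

End mu_measure.
Arguments gauss_mu {R}.

Definition Cintegral (R : realType) (f : plane R -> R[i]) : R[i] :=
  (\int[gauss_mu]_z complex.Re (f z)) +i* (\int[gauss_mu]_z complex.Im (f z)).

(* The elements of L^2_mu are represented by square-integrable functions, two  *)
(* of them being identified when they are equal mu-almost everywhere. Subsets  *)
(* of L^2_mu are represented by sets of functions that are saturated for this  *)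
(* identification.                                                             *)
Definition L2 (R : realType) : set (plane R -> R[i]) :=
  [set f : plane R -> R[i] |
    @complex.Re R \o f \in Lfun gauss_mu 2%:E /\
    @complex.Im R \o f \in Lfun gauss_mu 2%:E].

Definition dotL2 (R : realType) (f g : plane R -> R[i]) : R[i] :=
  Cintegral (fun z => f z * (g z)^*).

Definition normL2 (R : realType) (f : plane R -> R[i]) : R :=
  Num.sqrt (complex.Re (dotL2 f f)).

Definition distL2 (R : realType) (f g : plane R -> R[i]) : R :=
  normL2 (fun z => f z - g z).

Definition lincomb (R : realType) (N : nat) (c : 'I_N -> R[i])
    (e : 'I_N -> plane R -> R[i]) : plane R -> R[i] :=
  fun z => \sum_(k < N) c k * e k z.

Definition subspaceL2 (R : realType) (V : set (plane R -> R[i])) : Prop :=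
  [/\ V `<=` @L2 R,
      forall f g, V f -> L2 g -> f = g %[ae gauss_mu] -> V g,
      V (fun=> 0) &
      forall (a : R[i]) f g, V f -> V g -> V (fun z => a * f z + g z)].

Definition zeroL2 (R : realType) : set (plane R -> R[i]) :=
  [set f | L2 f /\ f = (fun=> 0) %[ae gauss_mu]].

Definition spanL2 (R : realType) (S : set (plane R -> R[i])) :
    set (plane R -> R[i]) :=
  [set f | L2 f /\ exists (N : nat) (c : 'I_N -> R[i])
             (e : 'I_N -> plane R -> R[i]),
             (forall k, S (e k)) /\ f = lincomb c e %[ae gauss_mu]].

Definition closureL2 (R : realType) (S : set (plane R -> R[i])) :
    set (plane R -> R[i]) :=
  [set f | L2 f /\ forall eps : R, 0 < eps -> exists2 g, S g & distL2 f g < eps].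

Definition basisL2 (R : realType) (V : set (plane R -> R[i])) (d : nat)
    (e : 'I_d -> plane R -> R[i]) : Prop :=
  [/\ forall k, V (e k),
      forall c : 'I_d -> R[i],
        lincomb c e = (fun=> 0) %[ae gauss_mu] -> forall k, c k = 0 &
      forall f, V f -> exists c : 'I_d -> R[i], f = lincomb c e %[ae gauss_mu]].

Definition has_dim (R : realType) (V : set (plane R -> R[i])) (d : nat) : Prop :=
  exists e : 'I_d -> plane R -> R[i], basisL2 V e.

Definition infinite_dim (R : realType) (V : set (plane R -> R[i])) : Prop :=
  forall d, ~ has_dim V d.

Definition orthogonal_family (R : realType) (d : nat)
    (e : 'I_d -> plane R -> R[i]) : Prop :=
  forall j k, j != k -> dotL2 (e j) (e k) = 0.

(* g is (a representative of) the orthogonal projection of f onto V. *)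
Definition is_orthoproj (R : realType) (V : set (plane R -> R[i]))
    (f g : plane R -> R[i]) : Prop :=
  [/\ L2 f, V g & forall h, V h -> dotL2 (fun z => f z - g z) h = 0].

(* For f in L^2_mu the integral converges absolutely for almost every z only; *)
(* the values at the remaining points are irrelevant.                         *)
Definition cauchy_mu (R : realType) (f : plane R -> R[i]) : plane R -> R[i] :=
  fun z => (pi^-1)%:C * Cintegral (fun xi => f xi / (toC z - toC xi)).

Definition rising (R : realType) (a : R) (k : nat) : R :=
  \prod_(i < k) (a + i%:R).

Definition kummer1F1 (R : realType) (a c x : R) : R :=
  limn (series (fun k => rising a k / rising c k * x ^+ k / k`!%:R)).

Definition itoH (R : realType) (m n : nat) : plane R -> R[i] := fun z =>
  if (m <= n)%N then
    (-1) ^+ m * (n`!%:R / (n - m)`!%:R) * (toC z)^* ^+ (n - m) *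
    (kummer1F1 (- m%:R) (n - m + 1)%:R (sqabs (toC z)))%:C
  else
    (-1) ^+ n * (m`!%:R / (m - n)`!%:R) * toC z ^+ (m - n) *
    (kummer1F1 (- n%:R) (m - n + 1)%:R (sqabs (toC z)))%:C.

Definition true_poly_bargmann (R : realType) (n : nat) : set (plane R -> R[i]) :=
  [set f | L2 f /\ exists alpha : nat -> R[i],
     cvgn (series (fun j => j`!%:R * sqabs (alpha j))) /\
     distL2 f (fun z => \sum_(j < N) alpha j * itoH j n z) @[N --> \oo] --> (0 : R)].

Definition bargmann_tilde (R : realType) (l : nat) : set (plane R -> R[i]) :=
  closureL2 (spanL2 [set itoH l k | k in [set: nat]]).

(* P_n C_mu (V) *)
Definition proj_cauchy (R : realType) (n : nat) (V : set (plane R -> R[i])) :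
    set (plane R -> R[i]) :=
  [set g | exists2 f, V f & is_orthoproj (true_poly_bargmann n) (cauchy_mu f) g].

Definition Rspace (R : realType) (n l : nat) : set (plane R -> R[i]) :=
  proj_cauchy n (true_poly_bargmann l).

Definition Rspace_tilde (R : realType) (n l : nat) : set (plane R -> R[i]) :=
  proj_cauchy n (bargmann_tilde l).

Arguments L2 {R}.
Arguments zeroL2 R : clear implicits.
Arguments itoH {R} m n _.
Arguments Rspace R n l : clear implicits.
Arguments Rspace_tilde R n l : clear implicits.

(* Main.v *)
(* The whole proof rests on the bilinear pairing <f, h> = int (C_mu f) h dmu.
   Substituting xi = z + w in the kernel and integrating by parts in z moves the
   creation operators z - d/dzbar and zbar - d/dz from f to h up to a sign, so
   that <H_{p,q}, H_{a,b}> = +- S(a + p, b + q) with S(N, M) = <1, H_{N,M}>.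
   The identity z C_mu 1 = mu(C) / pi + C_mu(xi) gives
     2 S(N+1, M) = mu(C) / pi * int H_{N,M} dmu - M S(N, M-1),
   and rotation invariance gives S(0, M) = 0; hence S(N, M) <> 0 iff N = M + 1.
   Since H_{i,n} is conjugate to H_{n,i}, the transform of H_{p,q} has a single
   nonzero coefficient against the H_{i,n}, the one with n + p = i + q + 1, and
   P_n C_mu H_{p,q} is a nonzero multiple of H_{i,n} for this i, or zero if there
   is none.  By Fubini, <f, h> = - <h, f>, and C_mu h is bounded for polynomial
   h, so vanishing coefficients pass from the H_{p,q} to the closed spaces they
   span. *)

(* The obstacle is the singular kernel, which cannot be differentiated under the integral sign.
   After the substitution the singularity is the factor [1 / w], free of z; for each fixed w the
   integrand in z is smooth with Gaussian decay, so the integration by parts takes place before w is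
   integrated. Exchanging the two integrations rests on [cauchy_kernel_bound], an estimate uniform
   in z, which also bounds C_mu h for polynomial h. All dominations split the weight in two: half of
   its exponent absorbs polynomial growth, the other half keeps the product integrable. The 2 in the
   recurrence arises because multiplying C_mu 1 by z brings in the transform of H_{1,0}, whose
   pairing with H_{N,M} is -S(N+1, M), the unknown itself with the opposite sign. Members of a range
   are exhibited only as images of scaled Hermite polynomials. For a general f in the source space
   only vanishing coefficients are established; its C_mu f is in L^2 because [is_orthoproj] says so,
   whereas for Hermite polynomials this follows from boundedness. *)
From HB Require Import structures.
Require Import Defs.
From mathcomp Require Import all_boot all_order all_algebra.
From mathcomp Require Import all_classical all_reals all_analysis.
From mathcomp Require Import complex measurable_realfun zify ring lra.
Set Implicit Arguments.
Unset Strict Implicit.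
Unset Printing Implicit Defensive.
Import Order.TTheory GRing.Theory Num.Theory.
Import numFieldNormedType.Exports.
Local Open Scope classical_set_scope.
Local Open Scope ring_scope.
Local Open Scope complex_scope.

(** * Complex-valued measurable and integrable functions *)

Section complex_valued.
Context {R : realType}.
Implicit Types w : R[i].

Notation normc := (@ComplexField.Normc.normc R).

Lemma normcE_sqabs w : normc w = Num.sqrt (sqabs w).
Proof. by case: w. Qed.

Lemma sqabs_ge0 w : 0 <= sqabs w.
Proof. by rewrite /sqabs addr_ge0 ?sqr_ge0. Qed.

Lemma normc_ge0 w : 0 <= normc w.
Proof. by rewrite normcE_sqabs sqrtr_ge0. Qed.

Lemma sqr_normcE w : normc w ^+ 2 = sqabs w.
Proof. by rewrite normcE_sqabs sqr_sqrtr ?sqabs_ge0. Qed.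

Lemma normcM w1 w2 : normc (w1 * w2) = normc w1 * normc w2.
Proof. exact: ComplexField.Normc.normcM. Qed.

Lemma normcD w1 w2 : normc (w1 + w2) <= normc w1 + normc w2.
Proof. exact: (@le_normcD R w1 w2). Qed.

Lemma normcN w : normc (- w) = normc w.
Proof. by rewrite !normcE_sqabs; case: w => a b; rewrite /sqabs /= !sqrrN. Qed.

Lemma normc_conj w : normc w^*%C = normc w.
Proof. by rewrite !normcE_sqabs; case: w => a b; rewrite /sqabs /= !sqrrN. Qed.

Lemma sqabsM w1 w2 : sqabs (w1 * w2) = sqabs w1 * sqabs w2.
Proof. by rewrite -!sqr_normcE normcM exprMn. Qed.

Lemma normr_Re_le w : `|complex.Re w| <= normc w.
Proof.
by rewrite normcE_sqabs -sqrtr_sqr ler_wsqrtr// /sqabs lerDl sqr_ge0.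
Qed.

Lemma normr_Im_le w : `|complex.Im w| <= normc w.
Proof.
by rewrite normcE_sqabs -sqrtr_sqr ler_wsqrtr// /sqabs lerDr sqr_ge0.
Qed.

Lemma normc_le w : normc w <= `|complex.Re w| + `|complex.Im w|.
Proof.
rewrite normcE_sqabs -[leRHS]ger0_norm ?addr_ge0// -sqrtr_sqr ler_wsqrtr//.
rewrite /sqabs sqrrD !real_normK ?num_real// lerD2r lerDl.
by rewrite mulrn_wge0// mulr_ge0.
Qed.

Lemma complexP w1 w2 : complex.Re w1 = complex.Re w2 ->
  complex.Im w1 = complex.Im w2 -> w1 = w2.
Proof. by case: w1 w2 => a b [c d] /= -> ->. Qed.

Lemma ReD w1 w2 : complex.Re (w1 + w2) = complex.Re w1 + complex.Re w2.
Proof. by case: w1 w2 => ? ? []. Qed.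
Lemma ImD w1 w2 : complex.Im (w1 + w2) = complex.Im w1 + complex.Im w2.
Proof. by case: w1 w2 => ? ? []. Qed.
Lemma ReN w : complex.Re (- w) = - complex.Re w. Proof. by case: w. Qed.
Lemma ImN w : complex.Im (- w) = - complex.Im w. Proof. by case: w. Qed.
Lemma ReM w1 w2 : complex.Re (w1 * w2) =
  complex.Re w1 * complex.Re w2 - complex.Im w1 * complex.Im w2.
Proof. by case: w1 w2 => ? ? []. Qed.
Lemma ImM w1 w2 : complex.Im (w1 * w2) =
  complex.Re w1 * complex.Im w2 + complex.Im w1 * complex.Re w2.
Proof. by case: w1 w2 => ? ? [] ? ?. Qed.
Lemma ReV w : complex.Re w^-1 = complex.Re w * (sqabs w)^-1.
Proof. by case: w. Qed.
Lemma ImV w : complex.Im w^-1 = - complex.Im w * (sqabs w)^-1.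
Proof. by case: w => a b /=; rewrite mulNr. Qed.
Lemma Re_conj w : complex.Re w^*%C = complex.Re w. Proof. by case: w. Qed.
Lemma Im_conj w : complex.Im w^*%C = - complex.Im w. Proof. by case: w. Qed.

Lemma mulcJ w : w * w^*%C = (sqabs w)%:C.
Proof. by case: w => a b; apply: complexP; rewrite /sqabs/=; ring. Qed.

Lemma sqabs_eq0 w : sqabs w = 0 -> w = 0.
Proof.
by move=> w0; apply: ComplexField.Normc.eq0_normc; rewrite normcE_sqabs w0 sqrtr0.
Qed.

Section meas.
Context d (T : measurableType d).
Implicit Types f g : T -> R[i].

Definition cmeas f := measurable_fun [set: T] (@complex.Re R \o f) /\
  measurable_fun [set: T] (@complex.Im R \o f).

Lemma cmeas_cst w : cmeas (fun=> w).
Proof. by split; exact: measurable_cst. Qed.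

Lemma cmeas_real (r : T -> R) : measurable_fun setT r -> cmeas (fun x => (r x)%:C).
Proof. by move=> mr; split => //=; exact: measurable_cst. Qed.

Lemma cmeasD f g : cmeas f -> cmeas g -> cmeas (fun x => f x + g x).
Proof.
move=> [rf jf] [rg jg]; split.
  by rewrite (_ : _ \o _ = (@complex.Re R \o f) \+ (@complex.Re R \o g));
    [exact: measurable_funD|apply/funext => x /=; exact: ReD].
by rewrite (_ : _ \o _ = (@complex.Im R \o f) \+ (@complex.Im R \o g));
    [exact: measurable_funD|apply/funext => x /=; exact: ImD].
Qed.

Lemma cmeasM f g : cmeas f -> cmeas g -> cmeas (fun x => f x * g x).
Proof.
move=> [rf jf] [rg jg]; split.
  rewrite (_ : _ \o _ = (fun x => (@complex.Re R \o f) x * (@complex.Re R \o g) x -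
    (@complex.Im R \o f) x * (@complex.Im R \o g) x)).
    by apply: measurable_funB; exact: measurable_funM.
  by apply/funext => x /=; exact: ReM.
rewrite (_ : _ \o _ = (fun x => (@complex.Re R \o f) x * (@complex.Im R \o g) x +
  (@complex.Im R \o f) x * (@complex.Re R \o g) x)).
  by apply: measurable_funD; exact: measurable_funM.
by apply/funext => x /=; exact: ImM.
Qed.

Lemma cmeas_conj f : cmeas f -> cmeas (fun x => (f x)^*%C).
Proof.
move=> [rf jf]; split.
  rewrite (_ : _ \o _ = @complex.Re R \o f)//.
  by apply/funext => x /=; exact: Re_conj.
rewrite (_ : _ \o _ = \- (@complex.Im R \o f)).
  exact: measurableT_comp.
by apply/funext => x /=; exact: Im_conj.
Qed.

Lemma cmeasZ w f : cmeas f -> cmeas (fun x => w * f x).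
Proof. by move=> mf; apply: cmeasM => //; exact: cmeas_cst. Qed.

Lemma cmeasN f : cmeas f -> cmeas (fun x => - f x).
Proof.
by move=> /(cmeasZ (-1)) /=; congr cmeas; apply/funext => x; rewrite mulN1r.
Qed.

Lemma cmeasB f g : cmeas f -> cmeas g -> cmeas (fun x => f x - g x).
Proof. by move=> mf mg; apply: cmeasD => //; exact: cmeasN. Qed.

Lemma measurable_sqabs f : cmeas f -> measurable_fun setT (fun x => sqabs (f x)).
Proof. by move=> [rf jf]; apply: measurable_funD; exact: measurable_funX. Qed.

Lemma measurable_normc f : cmeas f -> measurable_fun setT (fun x => normc (f x)).
Proof.
move=> mf; rewrite (_ : (fun _ => _) = (@powR R ^~ 2^-1) \o (fun x => sqabs (f x))).
  by apply: measurableT_comp; [exact: measurable_powR|exact: measurable_sqabs].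
by apply/funext => x /=; rewrite normcE_sqabs powR12_sqrt ?sqabs_ge0.
Qed.

Lemma cmeasV f : cmeas f -> cmeas (fun x => (f x)^-1).
Proof.
move=> mf.
(* The real power with exponent -1 is measurable everywhere and agrees with the inverse also at 0,
   so zeros of [f] need no separate case. *)
have mV : measurable_fun setT (fun x => (sqabs (f x))^-1).
  rewrite (_ : (fun _ => _) = (@powR R ^~ (-1)) \o (fun x => sqabs (f x))).
    by apply: measurableT_comp; [exact: measurable_powR|exact: measurable_sqabs].
  by apply/funext => x /=; rewrite powR_inv1// sqabs_ge0.
have [rf jf] := mf; split.
  rewrite (_ : _ \o _ = (fun x => (@complex.Re R \o f) x * (sqabs (f x))^-1)).
    exact: measurable_funM.
  by apply/funext => x /=; exact: ReV.
rewrite (_ : _ \o _ = (fun x => - (@complex.Im R \o f) x * (sqabs (f x))^-1)).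
  by apply: measurable_funM => //; exact: measurableT_comp.
by apply/funext => x /=; exact: ImV.
Qed.

End meas.

Lemma cmeas_comp d1 d2 (T1 : measurableType d1) (T2 : measurableType d2)
    (f : T2 -> R[i]) (phi : T1 -> T2) :
  cmeas f -> measurable_fun setT phi -> cmeas (fun x => f (phi x)).
Proof. by move=> [rf jf] mphi; split;
  [exact: (measurableT_comp rf mphi)|exact: (measurableT_comp jf mphi)]. Qed.

Lemma cmeas_toC : cmeas (@toC R).
Proof. by split; [exact: measurable_fst|exact: measurable_snd]. Qed.

Section integ.
Context d (T : measurableType d) (m : {measure set T -> \bar R}).
Implicit Types f g : T -> R[i].

Definition cintegrable f :=
  m.-integrable setT (EFin \o (@complex.Re R \o f)) /\
  m.-integrable setT (EFin \o (@complex.Im R \o f)).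

(** Convertible to [Cintegral] at [gauss_mu], but available for the Lebesgue and product measures as
    well. *)
Definition cint f : R[i] :=
  (\int[m]_z complex.Re (f z)) +i* (\int[m]_z complex.Im (f z)).

Lemma cintegrable_meas f : cintegrable f -> cmeas f.
Proof.
by move=> [/integrableP[rf _] /integrableP[jf _]]; split; exact/measurable_EFinP.
Qed.

Lemma le_cintegrable f (g : T -> R) : cmeas f ->
  m.-integrable setT (EFin \o g) -> (forall x, normc (f x) <= g x) ->
  cintegrable f.
Proof.
move=> [rf jf] ig fg; split; apply: le_integrable ig => //.
- exact/measurable_EFinP.
- move=> x _; rewrite lee_fin (le_trans (normr_Re_le _))// (le_trans (fg x))//.
  exact: ler_norm.
- exact/measurable_EFinP.
- move=> x _; rewrite lee_fin (le_trans (normr_Im_le _))// (le_trans (fg x))//.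
  exact: ler_norm.
Qed.

Lemma integrable_normc f : cintegrable f ->
  m.-integrable setT (EFin \o (fun x => normc (f x))).
Proof.
move=> fi; have mf := cintegrable_meas fi; have [rf jf] := fi.
have := integrableD measurableT (integrable_abse rf) (integrable_abse jf).
apply: le_integrable => //.
  by apply/measurable_EFinP; exact: measurable_normc.
move=> x _ /=; rewrite lee_fin ger0_norm ?normc_ge0// [leRHS]ger0_norm ?addr_ge0//.
exact: normc_le.
Qed.

Lemma cintegrableP f : cmeas f ->
  cintegrable f <-> (\int[m]_x (normc (f x))%:E < +oo)%E.
Proof.
move=> mf; split=> [/integrable_normc/integrableP[_]|fi].
  by under eq_integral => x _ do rewrite /= ger0_norm ?normc_ge0//.
apply: (le_cintegrable mf (g := fun x => normc (f x))) => //.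
apply/integrableP; split.
  by apply/measurable_EFinP; exact: measurable_normc.
by under eq_integral => x _ do rewrite /= ger0_norm ?normc_ge0//.
Qed.

Lemma cintegrableD f g : cintegrable f -> cintegrable g ->
  cintegrable (fun x => f x + g x).
Proof.
move=> fi gi.
apply: (le_cintegrable (g := fun x => normc (f x) + normc (g x))).
- by apply: cmeasD; exact: cintegrable_meas.
- exact: (integrableD measurableT (integrable_normc fi) (integrable_normc gi)).
- by move=> x; exact: normcD.
Qed.

Lemma cintegrableZ w f : cintegrable f -> cintegrable (fun x => w * f x).
Proof.
move=> fi; apply: (le_cintegrable (g := fun x => normc w * normc (f x))).
- by apply: cmeasZ; exact: cintegrable_meas.
- exact: (integrableZl measurableT (normc w) (integrable_normc fi)).
- by move=> x; rewrite normcM.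
Qed.

Lemma cintegrableN f : cintegrable f -> cintegrable (fun x => - f x).
Proof.
by move=> /(cintegrableZ (-1)) /=; congr cintegrable; apply/funext => x; rewrite mulN1r.
Qed.

Lemma cintegrableB f g : cintegrable f -> cintegrable g ->
  cintegrable (fun x => f x - g x).
Proof. by move=> fi gi; apply: cintegrableD => //; exact: cintegrableN. Qed.

Lemma cintD f g : cintegrable f -> cintegrable g ->
  cint (fun x => f x + g x) = cint f + cint g.
Proof.
move=> [rf jf] [rg jg]; apply: complexP => /=.
  under eq_Rintegral do rewrite ReD.
  by rewrite RintegralD.
under eq_Rintegral do rewrite ImD.
by rewrite RintegralD.
Qed.

Lemma integrable_EFinZ c (h : T -> R) : m.-integrable setT (EFin \o h) ->
  m.-integrable setT (EFin \o (fun x => c * h x)).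
Proof. exact: integrableZl. Qed.

Lemma cintZ w f : cintegrable f -> cint (fun x => w * f x) = w * cint f.
Proof.
move=> [rf jf]; case: w => a b; apply: complexP => /=.
  under eq_Rintegral do rewrite ReM /=.
  by rewrite RintegralB// ?RintegralZl//; exact: integrable_EFinZ.
under eq_Rintegral do rewrite ImM /=.
by rewrite RintegralD// ?RintegralZl//; exact: integrable_EFinZ.
Qed.

Lemma cintN f : cintegrable f -> cint (fun x => - f x) = - cint f.
Proof.
move=> fi; rewrite -mulN1r -cintZ//; congr cint.
by apply/funext => x; rewrite mulN1r.
Qed.

Lemma cintB f g : cintegrable f -> cintegrable g ->
  cint (fun x => f x - g x) = cint f - cint g.
Proof. by move=> fi gi; rewrite cintD ?cintN//; exact: cintegrableN. Qed.

Lemma cint0 : cint (fun=> 0) = 0.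
Proof. by apply: complexP => /=; rewrite Rintegral_cst//= mul0r. Qed.

Lemma cintegrable0 : cintegrable (fun=> 0).
Proof. by split; exact: integrable0. Qed.

Lemma cintegrable_sum n (f : 'I_n -> T -> R[i]) :
  (forall i, cintegrable (f i)) -> cintegrable (fun x => \sum_(i < n) f i x).
Proof.
elim: n f => [f _|n ih f mf].
  by rewrite (_ : (fun _ => _) = (fun=> 0));
    [exact: cintegrable0|apply/funext => x; rewrite big_ord0].
rewrite (_ : (fun _ => _) =
  (fun x => (\sum_(i < n) f (widen_ord (leqnSn n) i) x) + f ord_max x)).
  by apply: cintegrableD => //; apply: ih.
by apply/funext => x; rewrite big_ord_recr.
Qed.

Lemma cint_sum n (f : 'I_n -> T -> R[i]) : (forall i, cintegrable (f i)) ->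
  cint (fun x => \sum_(i < n) f i x) = \sum_(i < n) cint (f i).
Proof.
elim: n f => [f _|n ih f mf].
  rewrite (_ : (fun _ => _) = (fun=> 0)) ?cint0 ?big_ord0//.
  by apply/funext => x; rewrite big_ord0.
rewrite (_ : (fun _ => _) =
  (fun x => (\sum_(i < n) f (widen_ord (leqnSn n) i) x) + f ord_max x)).
  by rewrite cintD ?ih ?big_ord_recr//; exact: cintegrable_sum.
by apply/funext => x; rewrite big_ord_recr.
Qed.

Lemma cint_conj f : cintegrable f -> cint (fun x => (f x)^*%C) = (cint f)^*%C.
Proof.
move=> [rf jf]; apply: complexP => /=.
  by apply: eq_Rintegral => x _; rewrite Re_conj.
under eq_Rintegral do rewrite Im_conj.
rewrite /Rintegral.
under eq_integral do rewrite EFinN.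
by rewrite integralN ?fineN//; exact: integrable_add_def.
Qed.

End integ.
End complex_valued.

(** * Null sets, measure-preserving maps and Fubini for complex integrals *)

Section complex_integral.
Context {R : realType}.
Notation normc := (@ComplexField.Normc.normc R).

Section ae.
Context d (T : measurableType d) (m : {measure set T -> \bar R}).
Implicit Types f g : T -> R[i].

Lemma ae_cint f g : cmeas f -> cmeas g -> f = g %[ae m] -> cint m f = cint m g.
Proof.
move=> [rf jf] [rg jg] fg; congr (_ +i* _); congr fine.
  apply: ae_eq_integral => //; [exact/measurable_EFinP|exact/measurable_EFinP|].
  by apply: filterS fg => x /[apply] ->.
apply: ae_eq_integral => //; [exact/measurable_EFinP|exact/measurable_EFinP|].
by apply: filterS fg => x /[apply] ->.
Qed.

(** Real and imaginary parts are bounded separately, whence the factor 2. *)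
Lemma normc_cint_le f : cintegrable m f ->
  normc (cint m f) <= 2 * \int[m]_x normc (f x).
Proof.
move=> fi; have [rf jf] := fi; apply: (le_trans (normc_le _)) => /=.
have ni := integrable_normc fi.
rewrite mulr_natl mulr2n lerD//.
  apply: (le_trans (le_normr_Rintegral measurableT rf)).
  apply: le_Rintegral => //; first exact: (integrable_abse rf).
  by move=> x _; exact: normr_Re_le.
apply: (le_trans (le_normr_Rintegral measurableT jf)).
apply: le_Rintegral => //; first exact: (integrable_abse jf).
by move=> x _; exact: normr_Im_le.
Qed.

End ae.

Lemma preserving_ge0_integral d (T : measurableType d)
    (m : {measure set T -> \bar R}) (phi : T -> T) (f : T -> \bar R) :
  measurable_fun setT phi ->
  (forall A, measurable A -> m (phi @^-1` A) = m A) ->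
  measurable_fun setT f -> (forall x, 0 <= f x)%E ->
  (\int[m]_x f (phi x) = \int[m]_x f x)%E.
Proof.
move=> mphi pm mf f0.
rewrite -[RHS](@eq_measure_integral _ _ _ setT m (pushforward m phi)); last first.
  by move=> A mA _; rewrite -pm.
by rewrite [RHS]ge0_integral_pushforward.
Qed.

(** Positive and negative parts are transported separately, so the equality holds even for an
    integral that does not converge. *)
Lemma preserving_integral d (T : measurableType d)
    (m : {measure set T -> \bar R}) (phi : T -> T) (f : T -> \bar R) :
  measurable_fun setT phi ->
  (forall A, measurable A -> m (phi @^-1` A) = m A) ->
  measurable_fun setT f ->
  (\int[m]_x f (phi x) = \int[m]_x f x)%E.
Proof.
move=> mphi pm mf; rewrite integralE [RHS]integralE; congr (_ - _)%E.
  rewrite -[RHS](preserving_ge0_integral mphi pm)//; last first.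
    exact: measurable_funepos.
  by apply: eq_integral => x _; rewrite !funeposE.
rewrite -[RHS](preserving_ge0_integral mphi pm)//; last first.
  exact: measurable_funeneg.
by apply: eq_integral => x _; rewrite !funenegE.
Qed.

Lemma preserving_cint d (T : measurableType d)
    (m : {measure set T -> \bar R}) (phi : T -> T) (f : T -> R[i]) :
  measurable_fun setT phi ->
  (forall A, measurable A -> m (phi @^-1` A) = m A) ->
  cmeas f -> cint m (fun x => f (phi x)) = cint m f.
Proof.
move=> mphi pm [rf jf]; congr (_ +i* _); congr fine.
  move/measurable_EFinP : rf => rf.
  exact: (preserving_integral mphi pm rf).
move/measurable_EFinP : jf => jf.
exact: (preserving_integral mphi pm jf).
Qed.

Section fubini.
Context d1 d2 (T1 : measurableType d1) (T2 : measurableType d2).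
Variable m1 : {sigma_finite_measure set T1 -> \bar R}.
Variable m2 : {sigma_finite_measure set T2 -> \bar R}.

(** The integral is [fine] of a difference of two Tonelli integrals, hence measurable without
    integrability. This makes [cauchy_mu f] measurable although its defining integral may diverge on
    a null set. *)
Lemma measurable_integral_param (f : T1 * T2 -> R) : measurable_fun setT f ->
  measurable_fun setT (fun x => \int[m2]_y f (x, y)).
Proof.
move=> /measurable_EFinP mf; apply: measurableT_comp => //.
under eq_fun do rewrite integralE.
apply: emeasurable_funB.
  rewrite (_ : (fun _ => _) = fubini_F m2 (EFin \o f)^\+%E); last first.
    by apply/funext => x; apply: eq_integral => y _; rewrite !funeposE.
  apply: measurable_fun_fubini_tonelli_F => //.
  exact: measurable_funepos.
rewrite (_ : (fun _ => _) = fubini_F m2 (EFin \o f)^\-%E); last first.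
  by apply/funext => x; apply: eq_integral => y _; rewrite !funenegE.
apply: measurable_fun_fubini_tonelli_F => //.
exact: measurable_funeneg.
Qed.

Lemma measurable_integral_param2 (f : T1 * T2 -> R) : measurable_fun setT f ->
  measurable_fun setT (fun y => \int[m1]_x f (x, y)).
Proof.
move=> /measurable_EFinP mf; apply: measurableT_comp => //.
under eq_fun do rewrite integralE.
apply: emeasurable_funB.
  rewrite (_ : (fun _ => _) = fubini_G m1 (EFin \o f)^\+%E); last first.
    by apply/funext => x; apply: eq_integral => y _; rewrite !funeposE.
  apply: measurable_fun_fubini_tonelli_G => //.
  exact: measurable_funepos.
rewrite (_ : (fun _ => _) = fubini_G m1 (EFin \o f)^\-%E); last first.
  by apply/funext => x; apply: eq_integral => y _; rewrite !funenegE.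
apply: measurable_fun_fubini_tonelli_G => //.
exact: measurable_funeneg.
Qed.

Lemma cmeas_cint (k : T1 * T2 -> R[i]) : cmeas k ->
  cmeas (fun x => cint m2 (fun y => k (x, y))).
Proof.
move=> [rk jk]; split.
  exact: (measurable_integral_param rk).
exact: (measurable_integral_param jk).
Qed.

Lemma Rintegral_Fubini (f : T1 * T2 -> R) :
  (m1 \x m2)%E.-integrable setT (EFin \o f) ->
  \int[m1]_x \int[m2]_y f (x, y) = \int[m2]_y \int[m1]_x f (x, y).
Proof.
move=> fi; have mf : measurable_fun setT f.
  by apply/measurable_EFinP; exact: measurable_int fi.
(* The inner real integral is [fine] of an extended one, and the two agree only where the section is
   integrable, that is almost everywhere. *)
congr fine; transitivity (\int[m1]_x \int[m2]_y (f (x, y))%:E)%E.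
  apply: ae_eq_integral => //.
  - by apply/measurable_EFinP; exact: measurable_integral_param.
  - exact: (measurable_int _ (integrable_fubini_F fi)).
  - apply: filterS (ae_integrable1 fi) => x xi _.
    by rewrite /Rintegral fineK//; exact: integrable_fin_num.
rewrite (Fubini fi); apply: ae_eq_integral => //.
- exact: (measurable_fubini_G fi).
- by apply/measurable_EFinP; exact: measurable_integral_param2.
- apply: filterS (ae_integrable2 fi) => x xi _.
  by rewrite /Rintegral fineK//; exact: integrable_fin_num.
Qed.

Lemma cintegrable_prod (k : T1 * T2 -> R[i]) : cmeas k ->
  (\int[m1]_x \int[m2]_y (normc (k (x, y)))%:E < +oo)%E ->
  cintegrable (m1 \x m2)%E k.
Proof.
move=> mk kfin; apply: (le_cintegrable mk (g := fun x => normc (k x))) => //.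
apply/integrable12ltyP.
  by apply/measurable_EFinP; exact: measurable_normc.
apply: le_lt_trans kfin; rewrite le_eqVlt; apply/orP; left; apply/eqP.
apply: eq_integral => x _; apply: eq_integral => y _ /=.
by rewrite ger0_norm// normc_ge0.
Qed.

Lemma cint_Fubini (k : T1 * T2 -> R[i]) : cintegrable (m1 \x m2)%E k ->
  cint m1 (fun x => cint m2 (fun y => k (x, y))) =
  cint m2 (fun y => cint m1 (fun x => k (x, y))).
Proof.
by move=> [rk jk]; congr (_ +i* _);
  [exact: (Rintegral_Fubini rk)|exact: (Rintegral_Fubini jk)].
Qed.

Lemma ae_cintegrable2 (k : T1 * T2 -> R[i]) : cintegrable (m1 \x m2)%E k ->
  \forall y \ae m2, cintegrable m1 (fun x => k (x, y)).
Proof.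
move=> [/ae_integrable2 rk /ae_integrable2 jk].
by apply: filterS2 rk jk => y; split.
Qed.

End fubini.
End complex_integral.

(** * Translations and rotations of the plane *)

Section plane_invariance.
Context {R : realType}.
Local Notation leb := (@lebesgue_measure R).
Local Notation leb2 := (leb \x leb)%E.

(** The pushforward by a translation gives each half-open interval its length, which characterizes
    Lebesgue measure. *)
Lemma lebesgue_measure_shift (a : R) (A : set (measurableTypeR R)) :
  measurable A -> leb ((fun x => x + a) @^-1` A) = leb A.
Proof.
move=> mA; have mshift : measurable_fun setT (fun x : measurableTypeR R => x + a).
  by apply: measurable_funD => //; exact: measurable_cst.
rewrite (@lebesgue_measure_unique R
  (@pushforward _ _ (measurableTypeR R) (measurableTypeR R) R leb
    (fun x : R => x + a)) _ A)// => X [[b c] _ <-].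
transitivity (leb `]b - a, c - a]%classic).
  rewrite !lebesgue_measure_itv/= !lte_fin ltrD2r; case: ifPn => // _.
  by rewrite -!EFinB; congr EFin; ring.
by congr leb; apply/seteqP; split => x /=; rewrite !in_itv/= ltrBlDr lerBrDr.
Qed.

Definition yshear (g : R -> R) (z : plane R) : plane R := (z.1, z.2 + g z.1).
Definition xshear (g : R -> R) (z : plane R) : plane R := (z.1 + g z.2, z.2).

Lemma measurable_yshear (g : R -> R) : measurable_fun setT g ->
  measurable_fun setT (yshear g).
Proof.
move=> mg; apply: measurable_fun_pair; first exact: measurable_fst.
apply: measurable_funD; first exact: measurable_snd.
by apply: measurableT_comp => //; exact: measurable_fst.
Qed.

Lemma measurable_xshear (g : R -> R) : measurable_fun setT g ->
  measurable_fun setT (xshear g).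
Proof.
move=> mg; apply: measurable_fun_pair; last exact: measurable_snd.
apply: measurable_funD; first exact: measurable_fst.
by apply: measurableT_comp => //; exact: measurable_snd.
Qed.

(** On each vertical line the shear is a translation, so every slice keeps its length. *)
Lemma yshear_preserving (g : R -> R) (A : set (plane R)) :
  measurable_fun setT g -> measurable A -> leb2 (yshear g @^-1` A) = leb2 A.
Proof.
move=> mg mA; apply: eq_integral => x _ /=.
by rewrite -[RHS](lebesgue_measure_shift (g x))//; exact: measurable_xsection.
Qed.

(** The product measure is defined by vertical slices, while [xshear] moves points along horizontal
    lines; uniqueness of the product measure lets one slice the other way. *)
Lemma leb2E2 (A : set (plane R)) : measurable A ->
  leb2 A = (\int[leb]_y leb (ysection A y))%E.
Proof.
move=> mA; rewrite (@product_measure_unique _ _ _ _ _ leb leb (leb \x^ leb)%E)//.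
by move=> B C mB mC; exact: product_measure2E.
Qed.

Lemma xshear_preserving (g : R -> R) (A : set (plane R)) :
  measurable_fun setT g -> measurable A -> leb2 (xshear g @^-1` A) = leb2 A.
Proof.
move=> mg mA; rewrite !leb2E2//; last first.
  by rewrite -[_ @^-1` _]setTI; exact: measurable_xshear.
apply: eq_integral => y _ /=.
by rewrite -[RHS](lebesgue_measure_shift (g y))//; exact: measurable_ysection.
Qed.

Definition translate (w z : plane R) : plane R := (z.1 + w.1, z.2 + w.2).

Lemma translateE w : translate w = xshear (fun=> w.1) \o yshear (fun=> w.2).
Proof. by apply/funext => z. Qed.

Lemma measurable_translate w : measurable_fun setT (translate w).
Proof.
by rewrite translateE; apply: measurableT_comp;
  [apply: measurable_xshear|apply: measurable_yshear].
Qed.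

Lemma translate_preserving w (A : set (plane R)) : measurable A ->
  leb2 (translate w @^-1` A) = leb2 A.
Proof.
move=> mA; rewrite translateE comp_preimage yshear_preserving//.
  exact: xshear_preserving.
by rewrite -[_ @^-1` _]setTI; exact: measurable_xshear.
Qed.

Definition rotate (t : R) (z : plane R) : plane R :=
  (cos t * z.1 - sin t * z.2, sin t * z.1 + cos t * z.2).

Section rotation.
Variable t : R.
Hypothesis t0 : sin t != 0.
(** This is tan (t / 2), the slope of the two outer shears in the factorization of a rotation. *)
Let u := (1 - cos t) / sin t.

(* Writing a rotation as a product of three shears gives its invariance from
   that of the one-dimensional Lebesgue measure under translations. *)
Lemma rotateE : rotate t = xshear (fun y => - u * y) \o
  (yshear (fun x => sin t * x) \o xshear (fun y => - u * y)).
Proof.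
have us : u * sin t = 1 - cos t by rewrite /u mulrVK// unitfE.
have uc : u * (1 + cos t) = sin t.
  apply: (mulfI t0); rewrite mulrA (mulrC (sin t)) us.
  have := cos2Dsin2 t; move: (cos t) (sin t) => c s cs.
  by transitivity (c ^+ 2 + s ^+ 2 - c ^+ 2); [rewrite cs|]; ring.
apply/funext => -[x y]; rewrite /rotate /xshear /yshear/=.
move: (cos t) (sin t) us uc => c s us uc; congr (_, _).
  transitivity ((1 - u * s) * x - (u + u * (1 - u * s)) * y); last ring.
  by rewrite us -uc; ring.
transitivity (s * x + (1 - u * s) * y); last ring.
by rewrite us; ring.
Qed.

Let mlin (c : R) : measurable_fun setT (fun y : R => c * y).
Proof. by apply: measurable_funM => //; exact: measurable_cst. Qed.

Lemma measurable_rotate : measurable_fun setT (rotate t).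
Proof.
rewrite rotateE; apply: measurableT_comp; first exact: measurable_xshear.
by apply: measurableT_comp; [exact: measurable_yshear|exact: measurable_xshear].
Qed.

Lemma rotate_preserving (A : set (plane R)) : measurable A ->
  leb2 (rotate t @^-1` A) = leb2 A.
Proof.
have mx : measurable_fun setT (xshear (fun y => - u * y)) by exact: measurable_xshear.
have my : measurable_fun setT (yshear (fun y => sin t * y)) by exact: measurable_yshear.
move=> mA; rewrite rotateE !comp_preimage xshear_preserving//.
  rewrite yshear_preserving//; last by rewrite -[_ @^-1` _]setTI; exact: mx.
  exact: xshear_preserving.
rewrite -[_ @^-1` _]setTI; apply: my => //.
by rewrite -[_ @^-1` _]setTI; exact: mx.
Qed.

Lemma sqabs_rotate z : sqabs (toC (rotate t z)) = sqabs (toC z).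
Proof.
rewrite /sqabs/=; have := cos2Dsin2 t.
move: (cos t) (sin t) z => c s [x y] /= cs.
transitivity ((c ^+ 2 + s ^+ 2) * (x ^+ 2 + y ^+ 2)); first ring.
by rewrite cs mul1r.
Qed.

Lemma gauss_rotate_preserving (A : set (plane R)) : measurable A ->
  gauss_mu (rotate t @^-1` A) = gauss_mu A.
Proof.
move=> mA; rewrite /gauss_mu integral_mkcond [RHS]integral_mkcond.
rewrite -[RHS](preserving_ge0_integral measurable_rotate rotate_preserving).
- apply: eq_integral => z _; rewrite /patch/= /gauss_weight sqabs_rotate.
  by congr (if _ then _ else _); apply/idP/idP; rewrite !inE.
- apply/(measurable_restrictT _ mA); apply/measurable_EFinP/measurable_funTS.
  exact: measurable_gauss_weight.
- by move=> z; rewrite /patch; case: ifPn => // _; rewrite lee_fin expR_ge0.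
Qed.

Lemma cint_rotate (f : plane R -> R[i]) : cmeas f ->
  cint gauss_mu (fun z => f (rotate t z)) = cint gauss_mu f.
Proof.
by move=> mf; apply: preserving_cint => //;
  [exact: measurable_rotate|exact: gauss_rotate_preserving].
Qed.

End rotation.

Lemma cint_translate w (f : plane R -> R[i]) : cmeas f ->
  cint leb2 (fun z => f (translate w z)) = cint leb2 f.
Proof.
by move=> mf; apply: preserving_cint => //;
  [exact: measurable_translate|exact: translate_preserving].
Qed.

End plane_invariance.

(** * The Gaussian measure *)

Section gaussian_measure.
Context {R : realType}.
Local Notation leb := (@lebesgue_measure R).
Local Notation leb2 := (leb \x leb)%E.
Notation normc := (@ComplexField.Normc.normc R).

(** Half of the exponent of the weight in one variable: the part kept for integrability once the
    other half has absorbed the growth of the integrand. *)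
Definition half_gauss (x : R) : R := expR (- (x ^+ 2 / 2)).

Lemma half_gauss_ge0 x : 0 <= half_gauss x. Proof. exact: expR_ge0. Qed.

Lemma half_gauss_le1 x : half_gauss x <= 1.
Proof. by rewrite -[leRHS]expR0 ler_expR oppr_le0 divr_ge0// sqr_ge0. Qed.

Lemma measurable_half_gauss : measurable_fun setT half_gauss.
Proof.
apply: measurableT_comp => //; apply: measurableT_comp => //.
by apply: measurable_funM => //; exact: measurable_funX.
Qed.

Lemma integrable_half_gauss : leb.-integrable setT (EFin \o half_gauss).
Proof.
have p0 : (normal_peak 1 : R) != 0 by rewrite gt_eqF// normal_peak_gt0// oner_eq0.
(* [half_gauss] is the standard normal density without its normalizing factor. *)
have := integrableZl measurableT (normal_peak 1)^-1 (@integrable_normal_pdf R 0 1).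
apply: eq_integrable => //= x _; rewrite normal_pdfE ?oner_eq0// -EFinM mulKf//.
by rewrite /half_gauss /normal_fun subr0 expr1n; congr (expR _)%:E; lra.
Qed.

Definition plane_gauss (z : plane R) : R := half_gauss z.1 * half_gauss z.2.

Lemma plane_gaussE z : plane_gauss z = expR (- (sqabs (toC z) / 2)).
Proof. by rewrite /plane_gauss /half_gauss -expRD /sqabs/=; congr expR; lra. Qed.

Lemma plane_gauss_ge0 z : 0 <= plane_gauss z.
Proof. by rewrite mulr_ge0// half_gauss_ge0. Qed.

Lemma plane_gauss_le1 z : plane_gauss z <= 1.
Proof. by rewrite mulr_ile1 ?half_gauss_ge0 ?half_gauss_le1. Qed.

Lemma measurable_plane_gauss : measurable_fun setT plane_gauss.
Proof.
apply: measurable_funM; apply: (measurableT_comp measurable_half_gauss).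
  exact: measurable_fst.
exact: measurable_snd.
Qed.

Lemma integrable_plane_gauss : leb2.-integrable setT (EFin \o plane_gauss).
Proof.
apply/integrable12ltyP.
  by apply/measurable_EFinP; exact: measurable_plane_gauss.
have /integrableP[mg gfin] := integrable_half_gauss.
have i0 : (0 <= \int[leb]_y `|(EFin \o half_gauss) y|)%E by exact: integral_ge0.
rewrite [X in (X < _)%E](_ : _ =
    \int[leb]_x ((half_gauss x)%:E * \int[leb]_y `|(EFin \o half_gauss) y|))%E.
  rewrite ge0_integralZr//.
  - rewrite lte_mul_pinfty//.
    + by apply: integral_ge0 => x _; rewrite lee_fin half_gauss_ge0.
    + rewrite ge0_fin_numE; last by apply: integral_ge0 => x _; rewrite lee_fin half_gauss_ge0.
      apply: le_lt_trans gfin; apply: ge0_le_integral => //.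
      * by move=> x _; rewrite lee_fin half_gauss_ge0.
      * exact: measurableT_comp.
      * by move=> x _; rewrite lee_fin ler_norm.
  - by move=> x _; rewrite lee_fin half_gauss_ge0.
apply: eq_integral => x _; rewrite -ge0_integralZl//.
- apply: eq_integral => y _ /=; rewrite -EFinM; congr EFin.
  by rewrite !ger0_norm ?plane_gauss_ge0 ?half_gauss_ge0.
- exact: measurableT_comp.
- by rewrite lee_fin half_gauss_ge0.
Qed.

Lemma gauss_weight_ge0 (z : plane R) : 0 <= gauss_weight z.
Proof. exact: expR_ge0. Qed.

Lemma gauss_weight_le z : gauss_weight z <= plane_gauss z.
Proof.
by rewrite plane_gaussE ler_expR; have := sqabs_ge0 (toC z); lra.
Qed.

Lemma gauss_mu_fin : fin_num_fun (@gauss_mu R).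
Proof.
apply: lty_fin_num_fun; rewrite /gauss_mu.
have /integrableP[_] := integrable_plane_gauss; apply: le_lt_trans.
apply: ge0_le_integral => //.
- by move=> z _; rewrite lee_fin gauss_weight_ge0.
- by apply/measurable_EFinP; exact: measurable_gauss_weight.
- by apply: measurableT_comp => //; apply/measurable_EFinP; exact: measurable_plane_gauss.
- move=> z _; rewrite lee_fin ger0_norm ?plane_gauss_ge0//.
  exact: gauss_weight_le.
Qed.

HB.instance Definition _ := Measure_isFinite.Build _ _ _ (@gauss_mu R) gauss_mu_fin.

Import HBNNSimple.

Lemma gauss_muE (A : set (plane R)) : measurable A ->
  gauss_mu A = (\int[leb2]_z ((\1_A z)%:E * (gauss_weight z)%:E))%E.
Proof.
move=> mA; rewrite /gauss_mu integral_mkcond; apply: eq_integral => z _.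
by rewrite patchE indicE; case: ifPn => _; rewrite ?mul1e ?mul0e.
Qed.

(** For indicators this is the definition of [gauss_mu]; it passes to simple functions by linearity
    and to [f] by monotone convergence. *)
Lemma ge0_integral_gauss_mu (f : plane R -> \bar R) : measurable_fun setT f ->
  (forall z, 0 <= f z)%E ->
  (\int[gauss_mu]_z f z = \int[leb2]_z (f z * (gauss_weight z)%:E))%E.
Proof.
move=> mf f0; pose h := nnsfun_approx measurableT mf.
have mw : measurable_fun setT (fun z : plane R => (gauss_weight z)%:E).
  by apply/measurable_EFinP; exact: measurable_gauss_weight.
have hf z : EFin \o h^~ z @ \oo --> f z.
  by apply: cvg_nnsfun_approx => // y _; exact: f0.
transitivity (limn (fun n => \int[gauss_mu]_z (h n z)%:E))%E.
  rewrite -monotone_convergence//.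
  - by apply: eq_integral => z _; apply/esym/cvg_lim => //; exact: hf.
  - by move=> n; exact/measurable_EFinP/measurable_funP.
  - by move=> n z _; rewrite lee_fin.
  - by move=> z _ m n mn; rewrite lee_fin; exact/lefP/nd_nnsfun_approx.
transitivity (limn (fun n => \int[leb2]_z ((h n z)%:E * (gauss_weight z)%:E)))%E;
  last first.
  rewrite -monotone_convergence//.
  - apply: eq_integral => z _; apply/cvg_lim => //.
    by apply: cvgeZr => //; exact: hf.
  - move=> n; apply: emeasurable_funM => //.
    exact/measurable_EFinP/measurable_funP.
  - by move=> n z _; rewrite mule_ge0// lee_fin ?gauss_weight_ge0.
  - move=> z _ m n mn; rewrite lee_wpmul2r ?lee_fin ?gauss_weight_ge0//.
    exact/lefP/nd_nnsfun_approx.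
congr (lim (_ @ \oo)); apply/funext => n.
transitivity (\sum_(r \in range (h n))
    \int[leb2]_z ((r * \1_(h n @^-1` [set r]) z)%:E * (gauss_weight z)%:E))%E.
  under eq_integral do rewrite fimfunE -fsumEFin//.
  rewrite ge0_integral_fsum//; last 2 first.
  - by move=> y; exact/measurable_EFinP/measurable_funM.
  - by move=> y x _; rewrite nnfun_muleindic_ge0.
  apply: eq_fsbigr => r _; rewrite integralZl_indic_nnsfun// integral_indic//=.
  rewrite setIT gauss_muE//.
  (* A scalar leaves the integral of a nonnegative function only if it is nonnegative; for negative
     [r] the level set is empty and both sides vanish. *)
  have [r0|r0] := ltP r 0.
    rewrite preimage_nnfun0//.
    under eq_integral do rewrite indic0 mul0e.
    under [RHS]eq_integral do rewrite indic0 mulr0 mul0e.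
    by rewrite integral0 mule0.
  rewrite -ge0_integralZl//.
  - by apply: eq_integral => z _; rewrite muleA.
  - by apply: emeasurable_funM => //; exact/measurable_EFinP.
  - by move=> z _; rewrite mule_ge0// lee_fin gauss_weight_ge0.
rewrite -ge0_integral_fsum//.
- apply: eq_integral => z _.
  rewrite [in RHS]fimfunE -fsumEFin// ge0_mule_fsuml//.
  by move=> r; rewrite nnfun_muleindic_ge0.
- move=> r; apply: emeasurable_funM => //; exact/measurable_EFinP/measurable_funM.
- move=> r z _; rewrite mule_ge0 ?nnfun_muleindic_ge0// lee_fin.
  exact: gauss_weight_ge0.
Qed.

Lemma integral_gauss_mu (f : plane R -> \bar R) : measurable_fun setT f ->
  (\int[gauss_mu]_z f z = \int[leb2]_z (f z * (gauss_weight z)%:E))%E.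
Proof.
move=> mf; rewrite integralE [RHS]integralE; congr (_ - _)%E.
  rewrite ge0_integral_gauss_mu//; last exact: measurable_funepos.
  by apply: eq_integral => z _; rewrite !funeposE maxeMl ?mul0e ?lee_fin ?gauss_weight_ge0.
rewrite ge0_integral_gauss_mu//; last exact: measurable_funeneg.
by apply: eq_integral => z _; rewrite !funenegE maxeMl ?mul0e ?lee_fin ?gauss_weight_ge0// mulNe.
Qed.

Lemma cint_gauss_mu (f : plane R -> R[i]) : cmeas f ->
  cint gauss_mu f = cint leb2 (fun z => (gauss_weight z)%:C * f z).
Proof.
move=> [rf jf]; apply: complexP => /=; congr fine.
  rewrite (integral_gauss_mu (f := EFin \o (@complex.Re R \o f))).
    by apply: eq_integral => z _; rewrite ReM/= mul0r subr0 mulrC EFinM.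
  exact/measurable_EFinP.
rewrite (integral_gauss_mu (f := EFin \o (@complex.Im R \o f))).
  by apply: eq_integral => z _; rewrite ImM/= mul0r addr0 mulrC EFinM.
exact/measurable_EFinP.
Qed.

End gaussian_measure.

(** * Integrability of the Cauchy kernel *)

Section kernel.
Context {R : realType}.
Local Notation leb := (@lebesgue_measure R).
Local Notation leb2 := (leb \x leb)%E.
Notation normc := (@ComplexField.Normc.normc R).

Let square (z : plane R) k : set (plane R) :=
  `[z.1 - 2^-k, z.1 + 2^-k]%classic `*` `[z.2 - 2^-k, z.2 + 2^-k]%classic.

(* Dyadic decomposition of the singularity: 1/|z - xi| <= 2^(k+1) on the shell
   2^-(k+1) < |z - xi| <= 2^-k, which lies in a square of area 4 * 4^-k. *)
Let bump z k (xi : plane R) : R := 2 ^+ k.+1 * \1_(square z k) xi.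

Let bump_ge0 z k xi : 0 <= bump z k xi.
Proof. by rewrite mulr_ge0 ?exprn_ge0. Qed.

Lemma dyadic_bracket (r : R) : 0 < r -> r < 1 ->
  exists k : nat, (2 ^- k.+1 < r) /\ (r <= 2 ^- k).
Proof.
move=> r0 r1.
have exn : exists n, 2 ^- n < r.
  have [n _ /(_ n (leqnn n))] : \forall n \near \oo, 2 ^- n < r.
    have := @cvg_expr R 2^-1; rewrite ger0_norm// invf_lt1//.
    move=> /(_ ltac:(by rewrite ltr1n)) /cvgr_lt /(_ _ r0).
    by apply: filterS => n; rewrite exprVn.
  by exists n.
(* The least exponent n with 2^-n < r is positive because r < 1; the shell index is its
   predecessor. *)
case: (ex_minnP exn) => -[|k] kr kmin; first by move: kr; rewrite expr0 invr1; lra.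
exists k; split => //; rewrite leNgt; apply/negP => /kmin.
by rewrite ltnn.
Qed.

Lemma measurable_square z k : measurable (square z k).
Proof. by apply: measurableX; exact: measurable_itv. Qed.

Lemma leb2_square z k : leb2 (square z k) = (4 * 4 ^- k)%:E.
Proof.
have k0 : 0 < 2 ^- k :> R by rewrite invr_gt0 exprn_gt0.
have leb_itv (a : R) :
    leb `[a - 2 ^- k, a + 2 ^- k]%classic = (2 * 2 ^- k)%:E.
  rewrite lebesgue_measure_itv/= lte_fin ifT; last by lra.
  by rewrite -EFinB; congr EFin; lra.
rewrite product_measure1E; [|exact: measurable_itv|exact: measurable_itv].
transitivity ((2 * 2 ^- k)%:E * (2 * 2 ^- k)%:E : \bar R)%E.
  by congr (_ * _)%E; exact: leb_itv.
rewrite -EFinM; congr EFin.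
have -> : (4 : R) ^- k = 2 ^- k * 2 ^- k by rewrite -invfM -exprMn; congr (_ ^- _); ring.
by ring.
Qed.

(** At distance at least 1 the kernel is at most 1 and the first term suffices; nearer, the single
    bump of the dyadic shell containing [xi] already dominates. *)
Lemma kernel_pointwise (z xi : plane R) :
  ((plane_gauss xi * (normc (toC z - toC xi))^-1)%:E <=
  (plane_gauss xi)%:E + \sum_(k <oo) (bump z k xi)%:E)%E.
Proof.
set r := normc _.
have s0 : (0%:E <= \sum_(k <oo) (bump z k xi)%:E)%E.
  by apply: nneseries_ge0 => n _ _; rewrite lee_fin bump_ge0.
have [r1|r1] := leP 1 r.
  rewrite -[leLHS]adde0 leeD// lee_fin ler_piMr ?plane_gauss_ge0//.
  by rewrite invf_le1// (lt_le_trans _ r1).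
(* At [xi = z] the inverse of 0 is 0, so the left side vanishes. *)
have := normc_ge0 (toC z - toC xi); rewrite -/r le_eqVlt => /predU1P[<-|r0].
  by rewrite invr0 mulr0 adde_ge0// lee_fin plane_gauss_ge0.
have [k [kr rk]] := dyadic_bracket r0 r1.
have xik : xi \in square z k.
  rewrite inE; split => /=; rewrite in_itv/= -ler_distlC (le_trans _ rk)//.
    have := normr_Re_le (toC z - toC xi).
    by rewrite ReD ReN/= -/r => /(le_trans _); apply; rewrite distrC.
  have := normr_Im_le (toC z - toC xi).
  by rewrite ImD ImN/= -/r => /(le_trans _); apply; rewrite distrC.
rewrite -[leLHS]add0e leeD//; first by rewrite lee_fin plane_gauss_ge0.
apply: (@le_trans _ _ (2 ^+ k.+1)%:E).
  rewrite lee_fin -[leRHS]mul1r ler_pM ?plane_gauss_ge0 ?plane_gauss_le1//.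
    by rewrite invr_ge0 ltW.
  by rewrite -[leRHS]invrK lef_pV2 ?posrE// ?ltW// invr_gt0 exprn_gt0.
(* The partial sum with [k.+1] terms is the shortest one that contains bump number [k]. *)
apply: le_trans (nneseries_lim_ge k.+1 _); last first.
  by move=> n _ _; rewrite lee_fin bump_ge0.
rewrite big_nat_recr//= {2}/bump indicE xik mulr1 leeDr// sume_ge0// => n _.
by rewrite lee_fin bump_ge0.
Qed.

(** Independence of [K] from [z] is the point: it yields bounded transforms and lets Fubini be
    applied against any integrable function. *)
Lemma cauchy_kernel_bound : exists2 K : R, 0 <= K & forall z,
  (\int[leb2]_xi (plane_gauss xi * (normc (toC z - toC xi))^-1)%:E <= K%:E)%E.
Proof.
have /integrableP[_ gfin] := @integrable_plane_gauss R.
pose I := fine (\int[leb2]_z (plane_gauss z)%:E)%E.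
have g0 : (0 <= \int[leb2]_z (plane_gauss z)%:E)%E.
  by apply: integral_ge0 => z _; rewrite lee_fin plane_gauss_ge0.
have IE : (\int[leb2]_z (plane_gauss z)%:E = I%:E)%E.
  rewrite fineK// ge0_fin_numE//; apply: le_lt_trans gfin.
  rewrite le_eqVlt; apply/orP; left; apply/eqP; apply: eq_integral => z _ /=.
  by rewrite ger0_norm ?plane_gauss_ge0.
(* Bump [k] has integral 2^(k+1) times the area 4 / 4^k of its square, that is 16 / 2^(k+1); these
   sum to 16. *)
exists (I + 16); first by rewrite addr_ge0// fine_ge0.
move=> z.
have mpg : measurable_fun setT (EFin \o @plane_gauss R).
  by apply/measurable_EFinP; exact: measurable_plane_gauss.
have mS k : measurable_fun setT (fun xi => (bump z k xi)%:E).
  apply/measurable_EFinP; apply: measurable_funM => //.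
  by apply: measurable_indic; exact: measurable_square.
have S0 k xi : (0%:E <= (bump z k xi)%:E)%E.
  by rewrite lee_fin bump_ge0.
apply: (@le_trans _ _ (\int[leb2]_xi ((plane_gauss xi)%:E +
    \sum_(k <oo) (bump z k xi)%:E))%E).
  apply: ge0_le_integral => //.
  - by move=> xi _; rewrite lee_fin mulr_ge0 ?plane_gauss_ge0 ?invr_ge0 ?normc_ge0.
  - apply/measurable_EFinP; apply: measurable_funM; first exact: measurable_plane_gauss.
    rewrite (_ : (fun _ => _) = (fun xi => normc (toC z - toC xi)^-1)).
      apply: measurable_normc; apply: cmeasV; apply: cmeasB; first exact: cmeas_cst.
      exact: cmeas_toC.
    by apply/funext => xi; rewrite -ComplexField.Normc.normcV.
  - apply: emeasurable_funD => //.
    by apply: ge0_emeasurable_sum.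
  - by move=> xi _; exact: kernel_pointwise.
rewrite ge0_integralD//; last 3 first.
- by move=> xi _; rewrite lee_fin plane_gauss_ge0.
- by move=> xi _; exact: nneseries_ge0.
- by apply: ge0_emeasurable_sum.
rewrite IE EFinD leeD// integral_nneseries//.
apply: le_trans (epsilon_trick0 xpredT _); last by [].
apply: lee_nneseries => [k _ _|k _]; first exact: integral_ge0.
rewrite /bump; under eq_integral do rewrite EFinM.
rewrite ge0_integralZl//; last first.
  by apply/measurable_EFinP; apply: measurable_indic; exact: measurable_square.
rewrite integral_indic//; last exact: measurable_square.
rewrite setIT (_ : _ (square z k) = (4 * 4 ^- k)%:E); last exact: leb2_square.
rewrite -EFinM lee_fin.
have -> : (4 : R) ^- k = 2 ^- k * 2 ^- k by rewrite -invfM -exprMn; congr (_ ^- _); ring.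
have k0 : (2 ^+ k : R) != 0 by rewrite expf_neq0.
rewrite natrX !exprS le_eqVlt; apply/orP; left; apply/eqP.
by field.
Qed.

End kernel.

(** * Integration by parts *)

Section real_line.
Context {R : realType}.
Local Notation leb := (@lebesgue_measure R).

Lemma is_derive_continuous (h h' : R -> R) :
  (forall x, is_derive (x : R) 1 h (h' x)) -> continuous h.
Proof.
move=> dh x; apply: differentiable_continuous; apply/derivable1_diffP.
by have [] := dh x.
Qed.

Lemma cvg_half_gauss : half_gauss n.+1%:R @[n --> \oo] --> (0 : R).
Proof.
have h2 : (2 * harmonic n : R) @[n --> \oo] --> (0 : R).
  by rewrite -[X in _ --> X](mulr0 2); apply: cvgMr; exact: cvg_harmonic.
apply: (squeeze_cvgr _ (cvg_cst 0) h2); near=> n.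
rewrite half_gauss_ge0/= /half_gauss expRN /harmonic/=.
rewrite ler_pdivlMr ?ltr0n// mulrC ler_pdivrMr ?expR_gt0//.
apply: (@le_trans _ _ (2 * (1 + n.+1%:R ^+ 2 / 2))); last first.
  by rewrite ler_pM2l// expR_ge1Dx.
rewrite -natr1.
have n0 : 0 <= n%:R :> R by [].
by move: (n%:R : R) n0 => r r0; nra.
Unshelve. all: end_near. Qed.

Lemma half_gaussN (x : R) : half_gauss (- x) = half_gauss x.
Proof. by rewrite /half_gauss sqrrN. Qed.

(** By the fundamental theorem the integral over a symmetric interval is a difference of boundary
    values, which tends to 0; the bound on [h'] gives dominated convergence. *)
Lemma integral_derivative_eq0 (h h' : R -> R) (K : R) :
  (forall x, is_derive (x : R) 1 h (h' x)) -> continuous h' ->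
  (forall x, `|h x| <= K * half_gauss x) ->
  (forall x, `|h' x| <= K * half_gauss x) ->
  (\int[leb]_x (h' x)%:E = 0)%E.
Proof.
move=> dh ch' hK h'K; have ch := is_derive_continuous dh.
have mh' : measurable_fun setT h' by exact: continuous_measurable_fun.
(* The endpoint [n.+1] keeps every interval nondegenerate, as the fundamental theorem requires. *)
pose I n : set (measurableTypeR R) := `[- n.+1%:R, n.+1%:R]%classic.
pose f_ n : measurableTypeR R -> \bar R := (EFin \o h') \_ (I n).
have iK : leb.-integrable setT (EFin \o (fun x => K * half_gauss x)).
  exact: (integrableZl measurableT K integrable_half_gauss).
have mI n : measurable (I n) by exact: measurable_itv.
have mf_ n : measurable_fun setT (f_ n).
  by apply/(measurable_restrictT _ (mI n)); apply/measurable_funTS/measurable_EFinP.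
have fx x : f_ n x @[n --> \oo] --> (h' x)%:E.
  apply: cvg_near_cst.
  have [N _ Nx] : \forall n \near \oo, `|x| < n%:R by exact: nbhs_infty_gtr.
  exists N => // n /= Nn; rewrite /f_ patchE ifT// inE /I/= in_itv/= -ler_norml.
  have := Nx n Nn; rewrite -natr1 => /ltW/le_trans; apply.
  by rewrite lerDl.
have fK n x : (`|f_ n x| <= (K * half_gauss x)%:E)%E.
  rewrite /f_ patchE; case: ifPn => _; first by rewrite /= lee_fin.
  by rewrite abse0 lee_fin (le_trans _ (h'K x)).
have [_ _ cv] : [/\ leb.-integrable setT (EFin \o h'),
    [sequence (\int[leb]_x `|f_ n x - (EFin \o h') x|)%E]_n @ \oo --> 0%E &
    [sequence (\int[leb]_x f_ n x)%E]_n @ \oo --> (\int[leb]_x (EFin \o h') x)%E].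
  apply: (@dominated_convergence _ _ _ leb setT measurableT f_ _ _ mf_ _ _ iK).
  - exact/measurable_EFinP.
  - by apply: aeW => x _; exact: fx.
  - by apply: aeW => x n _; exact: fK.
have E n : (\int[leb]_x f_ n x = (h n.+1%:R - h (- n.+1%:R))%:E)%E.
  rewrite -integral_mkcond EFinB.
  apply: continuous_FTC2.
  - by rewrite -subr_gt0 opprK addr_gt0.
  - exact: continuous_subspaceT.
  - split => [x _||].
    + by have [] := dh x.
    + exact: cvg_at_right_filter (ch _).
    + exact: cvg_at_left_filter (ch _).
  - by move=> x _; rewrite derive1E; have [_ ->] := dh x.
apply: (cvg_unique (@ereal_hausdorff R) cv).
rewrite (_ : [sequence _]_n = EFin \o (fun n => h n.+1%:R - h (- n.+1%:R))).
  apply: cvg_EFin; first exact: nearW.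
  have g2 : (2 * K * half_gauss n.+1%:R) @[n --> \oo] --> (0 : R).
    by rewrite -[X in _ --> X](mulr0 (2 * K)); apply: cvgMr; exact: cvg_half_gauss.
  have g2N : (- (2 * K * half_gauss n.+1%:R)) @[n --> \oo] --> (0 : R).
    by rewrite -[X in _ --> X]oppr0; exact: cvgN.
  apply: (squeeze_cvgr _ g2N g2); near=> n.
  rewrite -ler_norml (le_trans (ler_normB _ _))// -mulrA mulr_natl mulr2n.
  by rewrite lerD// -half_gaussN.
by apply/funext => n /=; exact: E.
Unshelve. all: end_near. Qed.

End real_line.

(** * Wirtinger derivatives and functions dominated by a Gaussian *)

Section wirtinger.
Context {R : realType}.
Local Notation leb := (@lebesgue_measure R).
Local Notation leb2 := (leb \x leb)%E.
Local Notation normc := (@ComplexField.Normc.normc R).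
Local Notation plane := (plane R).
Implicit Types (f g F G : plane -> R[i]) (z w : plane).

(** On a horizontal line the bound factors as the constant [K * half_gauss y] times [half_gauss x],
    so the one-dimensional statement applies line by line. *)
Lemma integral_dx_eq0 (F Fx : plane -> R) (K : R) :
  (forall x y, is_derive (x : R) 1 (fun t => F (t, y)) (Fx (x, y))) ->
  (forall y, continuous (fun x : R => Fx (x, y))) -> measurable_fun setT Fx ->
  (forall z, `|F z| <= K * plane_gauss z) ->
  (forall z, `|Fx z| <= K * plane_gauss z) ->
  \int[leb2]_z Fx z = 0.
Proof.
move=> dF cF mF FK FxK.
have iF : leb2.-integrable setT (EFin \o Fx).
  have := integrableZl measurableT K (@integrable_plane_gauss R).
  apply: le_integrable => //; first exact/measurable_EFinP.
  by move=> z _; rewrite lee_fin (le_trans (FxK z))// ler_norm.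
rewrite /Rintegral -(integral21_prod_meas1 iF) /fubini_G.
rewrite integral0_eq// => y _.
apply: (integral_derivative_eq0 (K := K * half_gauss y) (dF ^~ y) (cF y)).
- by move=> x; rewrite mulrAC -mulrA; exact: FK.
- by move=> x; rewrite mulrAC -mulrA; exact: FxK.
Qed.

Lemma integral_dy_eq0 (F Fy : plane -> R) (K : R) :
  (forall x y, is_derive (y : R) 1 (fun t => F (x, t)) (Fy (x, y))) ->
  (forall x, continuous (fun y : R => Fy (x, y))) -> measurable_fun setT Fy ->
  (forall z, `|F z| <= K * plane_gauss z) ->
  (forall z, `|Fy z| <= K * plane_gauss z) ->
  \int[leb2]_z Fy z = 0.
Proof.
move=> dF cF mF FK FyK.
have iF : leb2.-integrable setT (EFin \o Fy).
  have := integrableZl measurableT K (@integrable_plane_gauss R).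
  apply: le_integrable => //; first exact/measurable_EFinP.
  by move=> z _; rewrite lee_fin (le_trans (FyK z))// ler_norm.
rewrite /Rintegral -(integral12_prod_meas1 iF) /fubini_F.
rewrite integral0_eq// => x _.
apply: (integral_derivative_eq0 (K := K * half_gauss x) (dF x) (cF x)).
- by move=> y; rewrite -mulrA; exact: FK.
- by move=> y; rewrite -mulrA; exact: FyK.
Qed.

Definition ccont (g : R -> R[i]) :=
  continuous (@complex.Re R \o g) /\ continuous (@complex.Im R \o g).

Lemma ccont_cst c : ccont (fun=> c).
Proof. by split => x; exact: cvg_cst. Qed.

Lemma ccontD (g h : R -> R[i]) : ccont g -> ccont h -> ccont (fun x => g x + h x).
Proof.
move=> [rg jg] [rh jh]; split.
  rewrite (_ : _ \o _ = (@complex.Re R \o g) \+ (@complex.Re R \o h)).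
    by move=> x; apply: cvgD; [exact: rg|exact: rh].
  by apply/funext => x /=; exact: ReD.
rewrite (_ : _ \o _ = (@complex.Im R \o g) \+ (@complex.Im R \o h)).
  by move=> x; apply: cvgD; [exact: jg|exact: jh].
by apply/funext => x /=; exact: ImD.
Qed.

Lemma ccontM (g h : R -> R[i]) : ccont g -> ccont h -> ccont (fun x => g x * h x).
Proof.
move=> [rg jg] [rh jh]; split.
  rewrite (_ : _ \o _ = (fun x => (@complex.Re R \o g) x * (@complex.Re R \o h) x -
    (@complex.Im R \o g) x * (@complex.Im R \o h) x)).
    by move=> x; apply: cvgB; apply: cvgM;
      [exact: rg|exact: rh|exact: jg|exact: jh].
  by apply/funext => x /=; exact: ReM.
rewrite (_ : _ \o _ = (fun x => (@complex.Re R \o g) x * (@complex.Im R \o h) x +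
    (@complex.Im R \o g) x * (@complex.Re R \o h) x)).
  by move=> x; apply: cvgD; apply: cvgM;
    [exact: rg|exact: jh|exact: jg|exact: rh].
by apply/funext => x /=; exact: ImM.
Qed.

Definition cder (g : R -> R[i]) (x : R) (d : R[i]) :=
  is_derive (x : R) (1 : R) (@complex.Re R \o g) (complex.Re d) /\
  is_derive (x : R) (1 : R) (@complex.Im R \o g) (complex.Im d).

Lemma cder_ccont (g d : R -> R[i]) : (forall x, cder g x (d x)) -> ccont g.
Proof.
move=> dg; split.
  by apply: (@is_derive_continuous _ _ (fun x => complex.Re (d x))) => x;
    have [] := dg x.
by apply: (@is_derive_continuous _ _ (fun x => complex.Im (d x))) => x;
  have [] := dg x.
Qed.

Lemma cder_eq (g : R -> R[i]) x d d' : cder g x d -> d = d' -> cder g x d'.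
Proof. by move=> dg <-. Qed.

Lemma cder_cst c x : cder (fun=> c) x 0.
Proof. by split; exact: is_derive_cst. Qed.

Lemma cderD (g h : R -> R[i]) x dg dh : cder g x dg -> cder h x dh ->
  cder (fun x => g x + h x) x (dg + dh).
Proof.
move=> [rg jg] [rh jh]; split.
  rewrite (_ : _ \o _ = (@complex.Re R \o g) + (@complex.Re R \o h)).
    by rewrite ReD; exact: is_deriveD.
  by apply/funext => y /=; exact: ReD.
rewrite (_ : _ \o _ = (@complex.Im R \o g) + (@complex.Im R \o h)).
  by rewrite ImD; exact: is_deriveD.
by apply/funext => y /=; exact: ImD.
Qed.

Lemma cderM (g h : R -> R[i]) x dg dh : cder g x dg -> cder h x dh ->
  cder (fun x => g x * h x) x (dg * h x + g x * dh).
Proof.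
move=> [rg jg] [rh jh]; split.
  rewrite (_ : _ \o _ = (@complex.Re R \o g) * (@complex.Re R \o h) -
    (@complex.Im R \o g) * (@complex.Im R \o h)).
    apply: (@is_derive_eq _ _ _ _ _ _ _ _
      (is_deriveB (is_deriveM rg rh) (is_deriveM jg jh))).
    by rewrite ReD !ReM /GRing.scale/=; ring.
  by apply/funext => y /=; exact: ReM.
rewrite (_ : _ \o _ = (@complex.Re R \o g) * (@complex.Im R \o h) +
  (@complex.Im R \o g) * (@complex.Re R \o h)).
  apply: (@is_derive_eq _ _ _ _ _ _ _ _
    (is_deriveD (is_deriveM rg jh) (is_deriveM jg rh))).
  by rewrite ImD !ImM /GRing.scale/=; ring.
by apply/funext => y /=; exact: ImM.
Qed.

Lemma cder_comp_shift (g : R -> R[i]) a x d : cder g (x + a) d -> cder (fun t => g (t + a)) x d.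
Proof.
have da : is_derive (x : R) (1 : R) (fun t : R => t + a) 1.
  by rewrite -[X in is_derive _ _ _ X]addr0; exact: is_deriveD.
move=> [rg jg]; split.
  by have := is_derive1_comp (g := fun t => t + a) rg da; rewrite mulr1.
by have := is_derive1_comp (g := fun t => t + a) jg da; rewrite mulr1.
Qed.

(* fz and fw stand for the derivatives of f in z and in its conjugate: the
   partial derivatives of f are fz + fw and i (fz - fw). *)
Definition wder f fz fw := forall x y : R,
  cder (fun t => f (t, y)) x (fz (x, y) + fw (x, y)) /\
  cder (fun t => f (x, t)) y ('i * (fz (x, y) - fw (x, y))).

Lemma wder_cst c : wder (fun=> c) (fun=> 0) (fun=> 0).
Proof.
by move=> x y; rewrite subr0 mulr0 addr0; split; exact: cder_cst.
Qed.

Lemma wderD f fz fw g gz gw : wder f fz fw -> wder g gz gw ->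
  wder (fun z => f z + g z) (fun z => fz z + gz z) (fun z => fw z + gw z).
Proof.
move=> df dg x y; have [fx fy] := df x y; have [gx gy] := dg x y; split.
  by rewrite addrACA; exact: cderD.
by rewrite opprD addrACA mulrDr; exact: cderD.
Qed.

Lemma wderM f fz fw g gz gw : wder f fz fw -> wder g gz gw ->
  wder (fun z => f z * g z) (fun z => fz z * g z + f z * gz z)
                            (fun z => fw z * g z + f z * gw z).
Proof.
move=> df dg x y; have [fx fy] := df x y; have [gx gy] := dg x y; split.
  by apply: (cder_eq (cderM fx gx)); rewrite /=; ring.
by apply: (cder_eq (cderM fy gy)); rewrite /=; ring.
Qed.

Lemma wderZ c f fz fw : wder f fz fw ->
  wder (fun z => c * f z) (fun z => c * fz z) (fun z => c * fw z).
Proof.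
move=> df; have := wderM (wder_cst c) df.
by congr wder; apply/funext => z; rewrite mul0r add0r.
Qed.

Lemma wder_toC : wder (@toC R) (fun=> 1) (fun=> 0).
Proof.
move=> x y; split; split.
- by apply: (@is_derive_eq _ _ _ _ _ _ _ _ (is_derive_id x (1 : R))) => /=; ring.
- by apply: (@is_derive_eq _ _ _ _ _ _ _ _ (is_derive_cst y x (1 : R))) => /=; ring.
- by apply: (@is_derive_eq _ _ _ _ _ _ _ _ (is_derive_cst x y (1 : R))) => /=; ring.
- by apply: (@is_derive_eq _ _ _ _ _ _ _ _ (is_derive_id y (1 : R))) => /=; ring.
Qed.

Lemma wder_conj_toC : wder (fun z => (toC z)^*%C) (fun=> 0) (fun=> 1).
Proof.
move=> x y; split; split.
- by apply: (@is_derive_eq _ _ _ _ _ _ _ _ (is_derive_id x (1 : R))) => /=; ring.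
- by apply: (@is_derive_eq _ _ _ _ _ _ _ _ (is_derive_cst (- y) x (1 : R))) => /=; ring.
- by apply: (@is_derive_eq _ _ _ _ _ _ _ _ (is_derive_cst x y (1 : R))) => /=; ring.
- by apply: (@is_derive_eq _ _ _ _ _ _ _ _ (is_deriveN (is_derive_id y (1 : R)))) => /=; ring.
Qed.

Lemma wder_gauss : wder (fun z => (gauss_weight z)%:C)
  (fun z => - ((toC z)^*%C * (gauss_weight z)%:C))
  (fun z => - (toC z * (gauss_weight z)%:C)).
Proof.
have sq (a b : R) : is_derive (a : R) (1 : R)
    (fun t : R => expR (- (t ^+ 2 + b ^+ 2))) (- 2 * a * expR (- (a ^+ 2 + b ^+ 2))).
  have d1 : is_derive (a : R) (1 : R) (fun t : R => - (t ^+ 2 + b ^+ 2)) (- (2 * a)).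
    have id1 := is_derive_id a (1 : R).
    have sq1 : is_derive (a : R) (1 : R) (fun t : R => t ^+ 2) (2 * a).
      apply: (@is_derive_eq _ _ _ _ _ _ _ _ (is_deriveM id1 id1)).
      by rewrite /GRing.scale/=; ring.
    have := is_deriveN (is_deriveD sq1 (is_derive_cst (b ^+ 2) a (1 : R))).
    by rewrite addr0.
  have := is_derive1_comp (is_derive_expR _) d1.
  by congr is_derive; ring.
have yx (x y : R) : gauss_weight (x, y) = expR (- (y ^+ 2 + x ^+ 2)).
  by rewrite /gauss_weight /sqabs/= addrC.
move=> x y; split; split => /=.
- apply: (@is_derive_eq _ _ _ _ _ _ _ _ (sq x y)).
  by rewrite /gauss_weight/= /sqabs/=; ring.
- apply: (@is_derive_eq _ _ _ _ _ _ _ _ (is_derive_cst (0 : R) x 1)).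
  by ring.
- rewrite (_ : _ \o _ = fun t => expR (- (t ^+ 2 + x ^+ 2))); last first.
    by apply/funext => t /=; rewrite yx.
  apply: (@is_derive_eq _ _ _ _ _ _ _ _ (sq y x)).
  by rewrite yx/=; ring.
- apply: (@is_derive_eq _ _ _ _ _ _ _ _ (is_derive_cst (0 : R) y 1)).
  by ring.
Qed.

Lemma wder_translate a f fz fw : wder f fz fw ->
  wder (fun z => f (translate a z)) (fun z => fz (translate a z))
       (fun z => fw (translate a z)).
Proof.
move=> df x y; have [dx dy] := df (x + a.1) (y + a.2); split.
  exact: (cder_comp_shift dx).
exact: (cder_comp_shift dy).
Qed.

(** Continuity along lines parallel to the axes is what the fundamental theorem asks for, since each
    integration by parts uses one real variable. *)
Definition sepcont f :=
  (forall y, ccont (fun x => f (x, y))) /\ (forall x, ccont (fun y => f (x, y))).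

Lemma sepcont_cst c : sepcont (fun=> c).
Proof. by split=> ?; exact: ccont_cst. Qed.

Lemma sepcontD f g : sepcont f -> sepcont g -> sepcont (fun z => f z + g z).
Proof.
move=> [fx fy] [gx gy]; split=> ?; [exact: ccontD (fx _) (gx _)|].
exact: ccontD (fy _) (gy _).
Qed.

Lemma sepcontM f g : sepcont f -> sepcont g -> sepcont (fun z => f z * g z).
Proof.
move=> [fx fy] [gx gy]; split=> ?; [exact: ccontM (fx _) (gx _)|].
exact: ccontM (fy _) (gy _).
Qed.

Lemma wder_sepcont f fz fw : wder f fz fw -> sepcont f.
Proof.
move=> df; split => [y|x].
  exact: (cder_ccont (fun x => proj1 (df x y))).
exact: (cder_ccont (fun y => proj2 (df x y))).
Qed.

Lemma sepcont_translate a f : sepcont f -> sepcont (fun z => f (translate a z)).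
Proof.
have sh (b : R) : continuous (fun t : R => t + b).
  by move=> t; apply: cvgD; [exact: cvg_id|exact: cvg_cst].
move=> [fx fy]; split=> [y|x].
  have [rx jx] := fx (y + a.2); split => t.
    exact: (continuous_comp (sh a.1 t) (rx _)).
  exact: (continuous_comp (sh a.1 t) (jx _)).
have [ry jy] := fy (x + a.1); split => t.
  exact: (continuous_comp (sh a.2 t) (ry _)).
exact: (continuous_comp (sh a.2 t) (jy _)).
Qed.

(** Slower than every Gaussian blow-up. Quantifying over all [e] makes the class stable under
    products, by giving [e / 2] to each factor, with no degree to track. *)
Definition growth f := forall e : R, 0 < e -> exists2 K : R, 0 <= K &
  forall z, normc (f z) <= K * expR (e * sqabs (toC z)).

Lemma growth_cst c : growth (fun=> c).
Proof.
move=> e e0; exists (normc c); first exact: normc_ge0.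
move=> z; rewrite ler_peMr ?normc_ge0// -[leLHS]expR0 ler_expR.
by rewrite mulr_ge0 ?sqabs_ge0// ltW.
Qed.

Lemma growthD f g : growth f -> growth g -> growth (fun z => f z + g z).
Proof.
move=> gf gg e e0; have [K K0 fK] := gf e e0; have [L L0 gL] := gg e e0.
exists (K + L); first exact: addr_ge0.
by move=> z; rewrite (le_trans (normcD _ _))// mulrDl lerD.
Qed.

Lemma growthM f g : growth f -> growth g -> growth (fun z => f z * g z).
Proof.
move=> gf gg e e0; have e2 : 0 < e / 2 by rewrite divr_gt0.
have [K K0 fK] := gf _ e2; have [L L0 gL] := gg _ e2.
exists (K * L); first exact: mulr_ge0.
move=> z; rewrite normcM.
rewrite (_ : e * _ = e / 2 * sqabs (toC z) + e / 2 * sqabs (toC z)); last by lra.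
by rewrite expRD mulrACA ler_pM// normc_ge0.
Qed.

Lemma growth_toC : growth (@toC R).
Proof.
(* With s = |z|^2 one has |z| <= 1 + s <= (1 + 1/e) (1 + e s), and 1 + e s is at most the
   exponential of e s. *)
move=> e e0; exists (1 + e^-1); first by rewrite addr_ge0// invr_ge0 ltW.
move=> z; set s := sqabs (toC z); have s0 : 0 <= s by exact: sqabs_ge0.
have r0 := normc_ge0 (toC z).
have rs : normc (toC z) <= 1 + s.
  by rewrite /s -sqr_normcE; nra.
apply: (le_trans rs); apply: (@le_trans _ _ ((1 + e^-1) * (1 + e * s))).
  have -> : (1 + e^-1) * (1 + e * s) = 1 + s + (e^-1 + e * s).
    by field; rewrite gt_eqF.
  by rewrite lerDl addr_ge0 ?invr_ge0 ?mulr_ge0// ltW.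
by rewrite ler_wpM2l ?expR_ge1Dx// addr_ge0// invr_ge0 ltW.
Qed.

Definition nice f := [/\ cmeas f, sepcont f & growth f].

Lemma nice_cst c : nice (fun=> c).
Proof. by split; [exact: cmeas_cst|exact: sepcont_cst|exact: growth_cst]. Qed.

Lemma niceD f g : nice f -> nice g -> nice (fun z => f z + g z).
Proof.
by move=> [? ? ?] [? ? ?]; split; [exact: cmeasD|exact: sepcontD|exact: growthD].
Qed.

Lemma niceM f g : nice f -> nice g -> nice (fun z => f z * g z).
Proof.
by move=> [? ? ?] [? ? ?]; split; [exact: cmeasM|exact: sepcontM|exact: growthM].
Qed.

Lemma niceZ c f : nice f -> nice (fun z => c * f z).
Proof. by apply: niceM; exact: nice_cst. Qed.

Lemma niceN f : nice f -> nice (fun z => - f z).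
Proof.
by move=> /(niceZ (-1)); congr nice; apply/funext => z; rewrite mulN1r.
Qed.

Lemma niceB f g : nice f -> nice g -> nice (fun z => f z - g z).
Proof. by move=> nf ng; apply: niceD => //; exact: niceN. Qed.

Lemma nice_toC : nice (@toC R).
Proof.
by split; [exact: cmeas_toC|exact: wder_sepcont wder_toC|exact: growth_toC].
Qed.

Lemma nice_conj_toC : nice (fun z => (toC z)^*%C).
Proof.
split; [exact/cmeas_conj/cmeas_toC|exact: wder_sepcont wder_conj_toC|].
move=> e e0; have [K K0 zK] := growth_toC e0.
by exists K => // z; rewrite normc_conj.
Qed.

(** The class of integrands with respect to Lebesgue measure: a nice function multiplied by the
    weight belongs to it, by [nice_rapid]. *)
Definition rapid F := [/\ cmeas F, sepcont F &
  exists2 K : R, 0 <= K & forall z, normc (F z) <= K * plane_gauss z].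

Lemma nice_rapid f : nice f -> rapid (fun z => (gauss_weight z)%:C * f z).
Proof.
move=> [mf cf gf]; split.
- by apply: cmeasM => //; apply: cmeas_real; exact: measurable_gauss_weight.
- by apply: sepcontM => //; exact: wder_sepcont wder_gauss.
(* Growth with exponent 1/2 consumes exactly the half of the weight that [plane_gauss] does not
   use. *)
have [K K0 fK] := gf (2^-1) ltac:(by rewrite invr_gt0).
exists K => // z; rewrite normcM.
have -> : normc (gauss_weight z)%:C = gauss_weight z.
  by rewrite normcE_sqabs /sqabs/= expr0n/= addr0 sqrtr_sqr ger0_norm// expR_ge0.
rewrite plane_gaussE mulrC; apply: (@le_trans _ _
  (K * expR (2^-1 * sqabs (toC z)) * gauss_weight z)).
  by rewrite ler_wpM2r// expR_ge0.
rewrite -mulrA /gauss_weight -expRD le_eqVlt; apply/orP; left; apply/eqP.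
by congr (_ * expR _); lra.
Qed.

Lemma rapidD F G : rapid F -> rapid G -> rapid (fun z => F z + G z).
Proof.
move=> [mF cF [K K0 FK]] [mG cG [L L0 GL]].
split; [exact: cmeasD|exact: sepcontD|exists (K + L); first exact: addr_ge0].
by move=> z; rewrite (le_trans (normcD _ _))// mulrDl lerD.
Qed.

(** The Gaussian of [F] is kept and that of the translated factor is bounded by 1. *)
Lemma rapid_mul_translate a F G : rapid F -> rapid G ->
  rapid (fun z => F z * G (translate a z)).
Proof.
move=> [mF cF [K K0 FK]] [mG cG [L L0 GL]]; split.
- by apply: cmeasM => //; apply: cmeas_comp => //; exact: measurable_translate.
- by apply: sepcontM => //; exact: sepcont_translate.
exists (K * L); first exact: mulr_ge0.
move=> z; rewrite normcM mulrAC ler_pM ?normc_ge0//.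
by rewrite (le_trans (GL _))// ler_piMr// plane_gauss_le1.
Qed.

Lemma rapid_integrable F : rapid F -> cintegrable leb2 F.
Proof.
move=> [mF _ [K K0 FK]].
exact: (le_cintegrable mF (integrableZl measurableT K (@integrable_plane_gauss R))).
Qed.

(** The two partial derivatives, [Fz + Fw] and ['i * (Fz - Fw)], have integral 0; solving this
    system gives both claims. *)
Lemma cint_wder F Fz Fw : wder F Fz Fw -> rapid F -> rapid Fz -> rapid Fw ->
  cint leb2 Fz = 0 /\ cint leb2 Fw = 0.
Proof.
move=> dF [mF cF [K K0 FK]] rz rw.
have [[mz cz [K1 K10 FzK]] [mw cw [K2 K20 FwK]]] := (rz, rw).
have iz := rapid_integrable rz; have iw := rapid_integrable rw.
(* A common constant for [F] and both partial derivatives, as the one-variable statements expect. *)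
pose L := K + K1 + K2.
have FL z : normc (F z) <= L * plane_gauss z.
  rewrite (le_trans (FK z))// ler_wpM2r ?plane_gauss_ge0// /L; lra.
have i1 : normc ('i : R[i]) = 1.
  by rewrite normcE_sqabs /sqabs/= expr0n expr1n add0r sqrtr1.
have pmL z u : u = Fw z \/ u = - Fw z -> normc (Fz z + u) <= L * plane_gauss z.
  move=> uE; rewrite (le_trans (normcD _ _))//.
  have -> : normc u = normc (Fw z) by case: uE => ->; rewrite ?normcN.
  rewrite (le_trans (lerD (FzK z) (FwK z)))// -mulrDl.
  by rewrite ler_wpM2r ?plane_gauss_ge0// /L; lra.
have cFx : sepcont (fun z => Fz z + Fw z) by exact: sepcontD.
have cFy : sepcont (fun z => 'i * (Fz z - Fw z)).
  apply: sepcontM; first exact: sepcont_cst.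
  apply: sepcontD => //; have := sepcontM (sepcont_cst (-1)) cw.
  by congr sepcont; apply/funext => z; rewrite mulN1r.
have mFx : cmeas (fun z => Fz z + Fw z) by exact: cmeasD.
have mFy : cmeas (fun z => 'i * (Fz z - Fw z)) by apply: cmeasZ; exact: cmeasB.
have FyL z : normc ('i * (Fz z - Fw z)) <= L * plane_gauss z.
  by rewrite normcM i1 mul1r; apply: pmL; right.
have FxL z : normc (Fz z + Fw z) <= L * plane_gauss z by apply: pmL; left.
have X0 : cint leb2 (fun z => Fz z + Fw z) = 0.
  apply: complexP => /=.
    apply: (@integral_dx_eq0 (fun z => complex.Re (F z)) _ L).
    - by move=> x y; have [[]] := dF x y.
    - by move=> y; have [/(_ y)[]] := cFx.
    - by have [] := mFx.
    - by move=> z; exact: le_trans (normr_Re_le _) (FL z).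
    - by move=> z; exact: le_trans (normr_Re_le _) (FxL z).
  apply: (@integral_dx_eq0 (fun z => complex.Im (F z)) _ L).
  - by move=> x y; have [[]] := dF x y.
  - by move=> y; have [/(_ y)[]] := cFx.
  - by have [] := mFx.
  - by move=> z; exact: le_trans (normr_Im_le _) (FL z).
  - by move=> z; exact: le_trans (normr_Im_le _) (FxL z).
have Y0 : cint leb2 (fun z => 'i * (Fz z - Fw z)) = 0.
  apply: complexP.
    apply: (@integral_dy_eq0 (fun z => complex.Re (F z)) _ L).
    - by move=> x y; have [_ []] := dF x y.
    - by move=> x; have [_ /(_ x)[]] := cFy.
    - by have [] := mFy.
    - by move=> z; exact: le_trans (normr_Re_le _) (FL z).
    - by move=> z; exact: le_trans (normr_Re_le _) (FyL z).
  apply: (@integral_dy_eq0 (fun z => complex.Im (F z)) _ L).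
  - by move=> x y; have [_ []] := dF x y.
  - by move=> x; have [_ /(_ x)[]] := cFy.
  - by have [] := mFy.
  - by move=> z; exact: le_trans (normr_Im_le _) (FL z).
  - by move=> z; exact: le_trans (normr_Im_le _) (FyL z).
move: X0 Y0; rewrite cintD// cintZ ?cintB//; last exact: cintegrableB.
have i0 : ('i : R[i]) != 0 by rewrite eq_complex/= oner_eq0 andbF.
move=> X0 /eqP; rewrite mulf_eq0 (negbTE i0)/= subr_eq0 => /eqP zw.
move: X0; rewrite zw -mulr2n -mulr_natl => /eqP; rewrite mulf_eq0 pnatr_eq0/=.
by move=> /eqP ->.
Qed.

End wirtinger.

(** * The Cauchy transform and its pairing *)

Section cauchy_transform.
Context {R : realType}.
Local Notation leb := (@lebesgue_measure R).
Local Notation leb2 := (leb \x leb)%E.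
Local Notation normc := (@ComplexField.Normc.normc R).
Local Notation plane := (plane R).
Local Notation mu := (@gauss_mu R).
Implicit Types (f g P : plane -> R[i]) (z xi : plane).

Lemma cmeas_kernel : cmeas (fun p : plane * plane => (toC p.2 - toC p.1)^-1).
Proof.
apply: cmeasV; apply: cmeasB; apply: (cmeas_comp cmeas_toC).
  exact: measurable_snd.
exact: measurable_fst.
Qed.

Lemma cmeas_kernel1 z : cmeas (fun xi => (toC z - toC xi)^-1).
Proof. by apply: cmeasV; apply: cmeasB; [exact: cmeas_cst|exact: cmeas_toC]. Qed.

Lemma rapid_kernel_bound F : rapid F -> exists2 K : R, 0 <= K & forall z,
  (\int[leb2]_xi (normc (F xi / (toC z - toC xi)))%:E <= K%:E)%E.
Proof.
move=> [mF _ [K K0 FK]]; have [L L0 kL] := @cauchy_kernel_bound R.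
exists (K * L); first exact: mulr_ge0.
have mk z : measurable_fun setT
    (fun xi => (plane_gauss xi * (normc (toC z - toC xi))^-1)%:E).
  apply/measurable_EFinP; apply: measurable_funM.
    exact: measurable_plane_gauss.
  under eq_fun do rewrite -ComplexField.Normc.normcV.
  exact: measurable_normc (cmeas_kernel1 z).
have k0 z xi : 0 <= plane_gauss xi * (normc (toC z - toC xi))^-1.
  by rewrite mulr_ge0 ?plane_gauss_ge0 ?invr_ge0 ?normc_ge0.
move=> z; apply: (@le_trans _ _ (\int[leb2]_xi
  (K%:E * (plane_gauss xi * (normc (toC z - toC xi))^-1)%:E))%E).
  apply: ge0_le_integral => //.
  - by move=> xi _; rewrite lee_fin normc_ge0.
  - apply/measurable_EFinP; apply: measurable_normc; apply: cmeasM => //.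
    exact: cmeas_kernel1.
  - by apply: emeasurable_funM => //; exact: mk.
  - move=> xi _; rewrite -EFinM lee_fin normcM ComplexField.Normc.normcV mulrA.
    by rewrite ler_wpM2r ?invr_ge0 ?normc_ge0.
rewrite ge0_integralZl//; last by move=> xi _; rewrite lee_fin.
by rewrite EFinM lee_wpmul2l ?lee_fin.
Qed.

Lemma integral_normc_gauss_mu f : cmeas f ->
  (\int[mu]_xi (normc (f xi))%:E =
   \int[leb2]_xi (normc ((gauss_weight xi)%:C * f xi))%:E)%E.
Proof.
move=> mf; rewrite ge0_integral_gauss_mu.
- apply: eq_integral => xi _; rewrite normcM muleC -EFinM; congr (_ * _)%:E.
  by rewrite normcE_sqabs /sqabs/= expr0n/= addr0 sqrtr_sqr ger0_norm// expR_ge0.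
- by apply/measurable_EFinP; exact: measurable_normc.
- by move=> z; rewrite lee_fin normc_ge0.
Qed.

Lemma nice_kernel_bound f : nice f -> exists2 K : R, 0 <= K & forall z,
  (\int[mu]_xi (normc (f xi / (toC z - toC xi)))%:E <= K%:E)%E.
Proof.
move=> nf; have [K K0 fK] := rapid_kernel_bound (nice_rapid nf).
exists K => // z; rewrite integral_normc_gauss_mu.
  by under eq_integral do rewrite mulrA; exact: fK.
by apply: cmeasM; [case: nf|exact: cmeas_kernel1].
Qed.

Lemma nice_cintegrable f : nice f -> cintegrable mu f.
Proof.
move=> nf; have [mf _ _] := nf; apply/(cintegrableP mu mf).
rewrite integral_normc_gauss_mu//.
have wi := rapid_integrable (nice_rapid nf).
by apply/(cintegrableP _ (cintegrable_meas wi)).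
Qed.

Lemma nice_kernel_cintegrable f z : nice f ->
  cintegrable mu (fun xi => f xi / (toC z - toC xi)).
Proof.
move=> nf; have [K K0 /(_ z) fK] := nice_kernel_bound nf.
apply/cintegrableP; last exact: le_lt_trans fK (ltry _).
by apply: cmeasM; [case: nf|exact: cmeas_kernel1].
Qed.

Lemma cauchyE f z : cauchy_mu f z =
  (pi^-1)%:C * cint mu (fun xi => f xi / (toC z - toC xi)).
Proof. by []. Qed.

Lemma cmeas_cauchy f : cmeas f -> cmeas (cauchy_mu f).
Proof.
move=> mf; apply: cmeasZ.
apply: (@cmeas_cint _ _ _ _ _ mu (fun p => f p.2 / (toC p.1 - toC p.2))).
apply: cmeasM; first by apply: (cmeas_comp mf); exact: measurable_snd.
apply: cmeasV; apply: cmeasB; apply: (cmeas_comp cmeas_toC).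
  exact: measurable_fst.
exact: measurable_snd.
Qed.

Lemma nice_cauchy_bounded f : nice f -> exists2 K : R, 0 <= K &
  forall z, normc (cauchy_mu f z) <= K.
Proof.
move=> nf; have [K K0 fK] := nice_kernel_bound nf.
exists (normc (pi^-1)%:C * (2 * K)); first by rewrite mulr_ge0 ?normc_ge0 ?mulr_ge0.
move=> z; rewrite cauchyE normcM ler_wpM2l ?normc_ge0//.
have ki := nice_kernel_cintegrable z nf.
rewrite (le_trans (normc_cint_le ki))// ler_wpM2l//.
have := fK z; rewrite -lee_fin; apply: le_trans.
by rewrite /Rintegral fineK//; apply: integrable_fin_num => //; exact: integrable_normc.
Qed.

(** Integrating first in the variable of [P] costs only a constant, so mere integrability of [f]
    suffices. This admits arbitrary elements of the closed spaces. *)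
Lemma cauchy_prod_cintegrable f P : cintegrable mu f -> nice P ->
  cintegrable (mu \x mu)%E
    (fun p : plane * plane => f p.1 * (P p.2 / (toC p.2 - toC p.1))).
Proof.
move=> fi nP; have mf := cintegrable_meas fi; have [mP _ _] := nP.
have [K K0 PK] := nice_kernel_bound nP.
apply: cintegrable_prod.
  apply: cmeasM; first by apply: (cmeas_comp mf); exact: measurable_fst.
  apply: cmeasM; last exact: cmeas_kernel.
  by apply: (cmeas_comp mP); exact: measurable_snd.
have mPk z : cmeas (fun xi => P xi / (toC xi - toC z)).
  apply: cmeasM => //; apply: cmeasV; apply: cmeasB => //.
    exact: cmeas_toC.
  exact: cmeas_cst.
apply: (@le_lt_trans _ _ (\int[mu]_z ((normc (f z))%:E * K%:E))%E).
  apply: ge0_le_integral => //.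
  - by move=> z _; apply: integral_ge0 => xi _; rewrite lee_fin normc_ge0.
  - apply: (@measurable_fun_fubini_tonelli_F _ _ _ _ _ mu
      (fun p => (normc (f p.1 * (P p.2 / (toC p.2 - toC p.1))))%:E)).
      apply/measurable_EFinP; apply: measurable_normc; apply: cmeasM.
        by apply: (cmeas_comp mf); exact: measurable_fst.
      apply: cmeasM; last exact: cmeas_kernel.
      by apply: (cmeas_comp mP); exact: measurable_snd.
    by move=> p; rewrite lee_fin normc_ge0.
  - apply: emeasurable_funM => //.
    by apply/measurable_EFinP; exact: measurable_normc.
  - move=> z _ /=; under eq_integral do rewrite normcM EFinM.
    rewrite ge0_integralZl//.
    + rewrite lee_wpmul2l ?lee_fin ?normc_ge0//.
      apply: le_trans (PK z); rewrite le_eqVlt; apply/orP; left; apply/eqP.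
      apply: eq_integral => xi _; congr EFin.
      by rewrite !normcM !ComplexField.Normc.normcV -(normcN (_ - _)) opprB.
    + by apply/measurable_EFinP; apply: measurable_normc.
    + by move=> xi _; rewrite lee_fin normc_ge0.
    + by rewrite lee_fin normc_ge0.
rewrite ge0_integralZr//; last 2 first.
- by apply/measurable_EFinP; exact: measurable_normc.
- by move=> z _; rewrite lee_fin normc_ge0.
have := proj1 (cintegrableP mu mf) fi => ffin.
by rewrite muleC lte_mul_pinfty// lee_fin.
Qed.

Lemma nice1 : nice (fun=> 1 : R[i]). Proof. exact: nice_cst. Qed.

(** The case [P = 1] of joint integrability, restricted to almost every section. *)
Lemma ae_kernel_cintegrable f : cintegrable mu f ->
  \forall z \ae mu, cintegrable mu (fun xi => f xi / (toC z - toC xi)).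
Proof.
move=> fi; have := ae_cintegrable2 (cauchy_prod_cintegrable fi nice1).
apply: filterS => z; rewrite /=; congr cintegrable.
by apply/funext => xi; rewrite mul1r.
Qed.

Lemma cauchy_lin f g a z :
  cintegrable mu (fun xi => f xi / (toC z - toC xi)) ->
  cintegrable mu (fun xi => g xi / (toC z - toC xi)) ->
  cauchy_mu (fun xi => a * f xi + g xi) z = a * cauchy_mu f z + cauchy_mu g z.
Proof.
move=> fi gi; rewrite !cauchyE mulrCA -mulrDr -(cintZ a fi) -cintD//; last first.
  exact: cintegrableZ.
by congr (_ * cint _ _); apply/funext => xi; rewrite mulrDl mulrA.
Qed.

Lemma cauchyZ f a z : cintegrable mu (fun xi => f xi / (toC z - toC xi)) ->
  cauchy_mu (fun xi => a * f xi) z = a * cauchy_mu f z.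
Proof.
move=> fi; rewrite !cauchyE mulrCA -(cintZ a fi).
by congr (_ * cint _ _); apply/funext => xi; rewrite mulrA.
Qed.

(** The kernel is antisymmetric in its two variables, so exchanging the integrations changes the
    sign. *)
Lemma cauchy_adjoint f P : cintegrable mu f -> nice P ->
  cint mu (fun z => cauchy_mu f z * P z) = - cint mu (fun z => f z * cauchy_mu P z).
Proof.
move=> fi nP; have mf := cintegrable_meas fi; have [mP _ _] := nP.
(* The factor 1 / pi is put into [P], so that the integrand given to Fubini carries it from the
   start. *)
pose c : R[i] := (pi^-1)%:C; have nQ := niceZ c nP.
have fun_eq x : (fun y => f x * (c * P y / (toC y - toC x))) =
    (fun y => (f x * - c) * (P y / (toC x - toC y))).
  apply/funext => y; rewrite -[toC y - toC x]opprB invrN.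
  by rewrite !mulrN !mulNr !mulrA.
have ki := cauchy_prod_cintegrable fi nQ.
have /= := cint_Fubini ki.
rewrite (_ : (fun x => cint mu (fun y => f x * (c * P y / (toC y - toC x)))) =
    (fun x => - (f x * cauchy_mu P x))); last first.
  apply/funext => x; rewrite fun_eq cintZ; last exact: nice_kernel_cintegrable.
  by rewrite cauchyE mulrN mulNr mulrA.
have [K K0 PK] := nice_cauchy_bounded nP.
rewrite cintN; last first.
  apply: (le_cintegrable (g := fun x => K * normc (f x))).
  - by apply: cmeasM => //; exact: cmeas_cauchy.
  - exact: (integrableZl measurableT K (integrable_normc fi)).
  - by move=> z; rewrite normcM mulrC ler_wpM2r ?normc_ge0.
(* Pulling constants out of the transform of [f] is possible only where its integral converges, so
   the two integrands agree almost everywhere. *)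
move=> ->; apply: ae_cint.
- by apply: cmeasM => //; exact: cmeas_cauchy.
- apply: (@cmeas_cint _ _ _ _ _ mu
    (fun p : plane * plane => f p.2 * (c * P p.1 / (toC p.1 - toC p.2)))).
  apply: cmeasM; first by apply: (cmeas_comp mf); exact: measurable_snd.
  apply: cmeasM.
    by apply: cmeasZ; apply: (cmeas_comp mP); exact: measurable_fst.
  apply: cmeasV; apply: cmeasB; apply: (cmeas_comp cmeas_toC).
    exact: measurable_fst.
  exact: measurable_snd.
- apply: filterS (ae_kernel_cintegrable fi) => z fzi _.
  rewrite cauchyE mulrAC -cintZ//; congr cint; apply/funext => x.
  by rewrite -/c; ring.
Qed.

End cauchy_transform.

Section plane_lebesgue.
Context {R : realType}.
Local Notation leb := (@lebesgue_measure R).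

(* [leb \x leb] under a new name: the canonical sigma-finite structure of
   [product_measure1] is shadowed by the one for subprobabilities. *)
Definition plane_leb : set (plane R) -> \bar R := (leb \x leb)%E.

HB.instance Definition _ := Measure.on plane_leb.

Lemma plane_leb_sigma_finite : sigma_finite setT plane_leb.
Proof.
pose I n : set (measurableTypeR R) := `[- n%:R, n%:R]%classic.
exists (fun n => I n `*` I n).
  apply/seteqP; split => // z _.
  have [N _ Nz] : \forall n \near \oo, `|z.1| + `|z.2| < n%:R.
    exact: nbhs_infty_gtr.
  have /= := Nz N (leqnn N).
  have := normr_ge0 z.1; have := normr_ge0 z.2 => y0 x0 zN.
  by exists N => //; split; rewrite /I/= in_itv/= -ler_norml; lra.
move=> n; split; first by apply: measurableX; exact: measurable_itv.
rewrite [X in (X < _)%E]product_measure1E; [|exact: measurable_itv|exact: measurable_itv].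
have In : (leb (I n) < +oo)%E.
  by rewrite /I lebesgue_measure_itv/=; case: ifPn => // _; rewrite -EFinB ltry.
by rewrite lte_mul_pinfty// ge0_fin_numE.
Qed.

HB.instance Definition _ :=
  Measure_isSigmaFinite.Build _ _ _ plane_leb plane_leb_sigma_finite.

End plane_lebesgue.

(** * Integration by parts in the pairing *)

Section pairing.
Context {R : realType}.
Local Notation leb := (@lebesgue_measure R).
Local Notation leb2 := (leb \x leb)%E.
Local Notation normc := (@ComplexField.Normc.normc R).
Local Notation plane := (plane R).
Local Notation mu := (@gauss_mu R).
Local Notation W f := (fun z => (gauss_weight z)%:C * f z).
Implicit Types (f g h : plane -> R[i]) (z w xi : plane).

Lemma translateC z w : translate z w = translate w z.
Proof. by rewrite /translate addrC [X in (_, X)]addrC. Qed.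

Lemma toC_translate z w : toC (translate w z) = toC z + toC w.
Proof. by []. Qed.

Lemma measurable_translate2 :
  measurable_fun setT (fun p : plane * plane => translate p.2 p.1).
Proof.
have m1 : measurable_fun setT (fun p : plane * plane => p.1) by exact: measurable_fst.
have m2 : measurable_fun setT (fun p : plane * plane => p.2) by exact: measurable_snd.
have mf : measurable_fun setT (fun z : plane => z.1) by exact: measurable_fst.
have ms : measurable_fun setT (fun z : plane => z.2) by exact: measurable_snd.
apply: measurable_fun_pair; apply: measurable_funD.
- exact: (measurableT_comp mf m1).
- exact: (measurableT_comp mf m2).
- exact: (measurableT_comp ms m1).
- exact: (measurableT_comp ms m2).
Qed.

Lemma pairing_cintegrable f g : nice f -> cintegrable mu g ->
  cintegrable mu (fun z => cauchy_mu f z * g z).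
Proof.
move=> nf gi; have [K K0 fK] := nice_cauchy_bounded nf; have [mf _ _] := nf.
apply: (le_cintegrable (g := fun x => K * normc (g x))).
- by apply: cmeasM; [exact: cmeas_cauchy|exact: cintegrable_meas gi].
- exact: (integrableZl measurableT K (integrable_normc gi)).
- by move=> z; rewrite normcM ler_wpM2r ?normc_ge0.
Qed.

(** The cross-correlation of [H] and [F] at lag [w]; the singular factor [(toC w)^-1] stays
    outside. *)
Definition autocorr F H w := cint leb2 (fun z => H z * F (translate w z)).

Lemma pairing_autocorr f h : nice f -> nice h ->
  cint mu (fun z => cauchy_mu f z * h z) =
  cint leb2 (fun w => - (pi^-1)%:C * autocorr (W f) (W h) w / toC w).
Proof.
(* The sign comes from z - xi = - w under the substitution. *)
move=> nf nh; set c : R[i] := - (pi^-1)%:C.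
have rF0 := nice_rapid nf; have rF := nice_rapid (niceZ c nf).
have rH := nice_rapid nh; have [mf _ _] := nf; have [mh _ _] := nh.
set F0 := W f in rF0 *; set F := (fun z => _ * (c * f z)) in rF *.
set H := W h in rH *.
have [mF _ _] := rF; have [mH _ [KH KH0 HK]] := rH.
have [K K0 FK] := rapid_kernel_bound rF.
have mFt z : cmeas (fun w => F (translate w z) / toC w).
  apply: cmeasM; last exact: cmeasV cmeas_toC.
  under [X in cmeas X]eq_fun do rewrite translateC.
  by apply: (cmeas_comp mF); exact: measurable_translate.
have FtK z : (\int[leb2]_w (normc (F (translate w z) / toC w))%:E <= K%:E)%E.
  apply: le_trans (FK z); rewrite le_eqVlt; apply/orP; left; apply/eqP.
  rewrite -[RHS](preserving_ge0_integral (measurable_translate z)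
    (translate_preserving z)).
  - apply: eq_integral => w _; rewrite translateC toC_translate; congr EFin.
    rewrite !normcM !ComplexField.Normc.normcV.
    by rewrite (_ : toC z - _ = - toC w) ?normcN//; ring.
  - apply/measurable_EFinP; apply: measurable_normc; apply: cmeasM => //.
    exact: cmeas_kernel1.
  - by move=> xi; rewrite lee_fin normc_ge0.
have Fti z : cintegrable leb2 (fun w => F (translate w z) / toC w).
  by apply/cintegrableP => //; exact: le_lt_trans (FtK z) (ltry _).
have CF z : cauchy_mu f z =
    cint leb2 (fun w => F (translate w z) / toC w).
  rewrite cauchyE -cintZ; last exact: nice_kernel_cintegrable.
  rewrite cint_gauss_mu; last first.
    by apply: cmeasZ; apply: cmeasM => //; exact: cmeas_kernel1.
  rewrite -[LHS](cint_translate z); last first.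
    apply: cmeasM; first by apply: cmeas_real; exact: measurable_gauss_weight.
    by apply: cmeasZ; apply: cmeasM => //; exact: cmeas_kernel1.
  congr cint; apply/funext => w; rewrite translateC toC_translate.
  rewrite (_ : toC z - _ = - toC w); last ring.
  by rewrite /F/= /c invrN; ring.
pose k (p : plane * plane) := H p.1 * (F (translate p.2 p.1) / toC p.2).
have mk : cmeas k.
  apply: cmeasM; first by apply: (cmeas_comp mH); exact: measurable_fst.
  apply: cmeasM; first exact: (cmeas_comp mF measurable_translate2).
  by apply: cmeasV; apply: (cmeas_comp cmeas_toC); exact: measurable_snd.
pose lam : {sigma_finite_measure set plane -> \bar R} := plane_leb.
(* The integral over w is bounded uniformly in z by the kernel bound, and what remains is the
   integrable [H]. *)
have kfin : (\int[lam]_z \int[lam]_w (normc (k (z, w)))%:E < +oo)%E.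
  apply: (@le_lt_trans _ _ (\int[lam]_z ((normc (H z))%:E * K%:E))%E).
    apply: ge0_le_integral => //.
    - by move=> z _; apply: integral_ge0 => xi _; rewrite lee_fin normc_ge0.
    - have mnk : measurable_fun setT (fun p => (normc (k p))%:E).
        by apply/measurable_EFinP; exact: measurable_normc.
      have nk0 p : (0 <= (normc (k p))%:E)%E by rewrite lee_fin normc_ge0.
      exact: (@measurable_fun_fubini_tonelli_F _ _ _ _ _ lam _ mnk nk0).
    - apply: emeasurable_funM => //.
      by apply/measurable_EFinP; exact: measurable_normc.
    - move=> z _ /=; rewrite /k/=; under eq_integral do rewrite normcM EFinM.
      rewrite ge0_integralZl//.
      + by rewrite lee_wpmul2l ?lee_fin ?normc_ge0// FtK.
      + by apply/measurable_EFinP; apply: measurable_normc.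
      + by move=> xi _; rewrite lee_fin normc_ge0.
      + by rewrite lee_fin normc_ge0.
  rewrite ge0_integralZr//; last 2 first.
  - by apply/measurable_EFinP; exact: measurable_normc.
  - by move=> z _; rewrite lee_fin normc_ge0.
  have := proj1 (cintegrableP leb2 mH) (rapid_integrable rH) => Hfin.
  by rewrite muleC lte_mul_pinfty// lee_fin.
have E : cint leb2 (fun z => cint leb2 (fun w => k (z, w))) =
    cint leb2 (fun w => cint leb2 (fun z => k (z, w))).
  exact: (cint_Fubini (cintegrable_prod mk kfin)).
clear kfin lam.
have mCh : cmeas (fun z => cauchy_mu f z * h z).
  apply: cmeasM; last exact: mh.
  exact: cmeas_cauchy mf.
rewrite (cint_gauss_mu mCh).
transitivity (cint leb2 (fun z => cint leb2 (fun w => k (z, w)))).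
  congr cint; apply/funext => z; rewrite CF /k /=.
  by rewrite [RHS](cintZ _ (Fti z)) /H mulrA mulrAC.
rewrite E; congr cint; apply/funext => w.
rewrite /autocorr -cintZ; last exact/rapid_integrable/rapid_mul_translate.
rewrite mulrC -cintZ.
  by congr cint; apply/funext => z; rewrite /k /F /F0 /=; ring.
exact/cintegrableZ/rapid_integrable/rapid_mul_translate.
Qed.

(** Behind the weight a derivative becomes minus a creation operator; hence integration by parts
    shifts Hermite indices. *)
Lemma wder_weight f fz fw : wder f fz fw -> wder (W f)
  (fun z => - ((gauss_weight z)%:C * ((toC z)^*%C * f z - fz z)))
  (fun z => - ((gauss_weight z)%:C * (toC z * f z - fw z))).
Proof.
move=> df; have := wderM wder_gauss df.
by congr wder; apply/funext => z; ring.
Qed.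

Lemma rapidN (F : plane -> R[i]) : rapid F -> rapid (fun z => - F z).
Proof.
move=> [mF cF [K K0 FK]]; split; first exact: cmeasN.
  have := sepcontM (sepcont_cst (-1)) cF.
  by congr sepcont; apply/funext => z; rewrite mulN1r.
by exists K => // z; rewrite normcN.
Qed.

Section leibniz.
Variables (f fz fw h hz hw : plane -> R[i]).
Hypotheses (df : wder f fz fw) (dh : wder h hz hw).
Hypotheses (nf : nice f) (nfz : nice fz) (nfw : nice fw).
Hypotheses (nh : nice h) (nhz : nice hz) (nhw : nice hw).

(** The derivatives of the product of the weighted [h] and the translate of the weighted [f]
    integrate to 0. Translation commutes with differentiation, so the product rule yields one term
    for each function. *)
Lemma autocorr_leibniz w :
  autocorr (W (fun z => (toC z)^*%C * f z - fz z)) (W h) w =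
  - autocorr (W f) (W (fun z => (toC z)^*%C * h z - hz z)) w /\
  autocorr (W (fun z => toC z * f z - fw z)) (W h) w =
  - autocorr (W f) (W (fun z => toC z * h z - hw z)) w.
Proof.
have rf := nice_rapid nf; have rh := nice_rapid nh.
have rfz := nice_rapid (niceB (niceM nice_conj_toC nf) nfz).
have rfw := nice_rapid (niceB (niceM nice_toC nf) nfw).
have rhz := nice_rapid (niceB (niceM nice_conj_toC nh) nhz).
have rhw := nice_rapid (niceB (niceM nice_toC nh) nhw).
have dF := wder_translate w (wder_weight df); have dH := wder_weight dh.
have [] := cint_wder (wderM dH dF) (rapid_mul_translate w rh rf).
- exact: rapidD (rapid_mul_translate w (rapidN rhz) rf) (rapid_mul_translate w rh (rapidN rfz)).
- exact: rapidD (rapid_mul_translate w (rapidN rhw) rf) (rapid_mul_translate w rh (rapidN rfw)).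
rewrite !cintD; first last.
- exact: rapid_integrable (rapid_mul_translate w rh (rapidN rfz)).
- exact: rapid_integrable (rapid_mul_translate w (rapidN rhz) rf).
- exact: rapid_integrable (rapid_mul_translate w rh (rapidN rfw)).
- exact: rapid_integrable (rapid_mul_translate w (rapidN rhw) rf).
have N1 (A B : plane -> R[i]) : rapid A -> rapid B ->
    cint leb2 (fun z => - A z * B (translate w z)) =
    - cint leb2 (fun z => A z * B (translate w z)).
  move=> rA rB; rewrite -cintN; last exact/rapid_integrable/rapid_mul_translate.
  by congr cint; apply/funext => z; rewrite mulNr.
have N2 (A B : plane -> R[i]) : rapid A -> rapid B ->
    cint leb2 (fun z => A z * - B (translate w z)) =
    - cint leb2 (fun z => A z * B (translate w z)).
  move=> rA rB; rewrite -cintN; last exact/rapid_integrable/rapid_mul_translate.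
  by congr cint; apply/funext => z; rewrite mulrN.
rewrite (N1 _ _ rhz rf) (N2 _ _ rh rfz) (N1 _ _ rhw rf) (N2 _ _ rh rfw).
move=> /eqP + /eqP; rewrite !subr_eq0 => /eqP Ez /eqP Ew.
by split; rewrite /autocorr ?Ez ?Ew.
Qed.

(** The previous identity holds for each lag [w] separately, hence survives integration against
    [(toC w)^-1]. *)
Lemma pairing_leibniz :
  cint mu (fun z => cauchy_mu (fun z => (toC z)^*%C * f z - fz z) z * h z) =
  - cint mu (fun z => cauchy_mu f z * ((toC z)^*%C * h z - hz z)) /\
  cint mu (fun z => cauchy_mu (fun z => toC z * f z - fw z) z * h z) =
  - cint mu (fun z => cauchy_mu f z * (toC z * h z - hw z)).
Proof.
have nfz' := niceB (niceM nice_conj_toC nf) nfz.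
have nfw' := niceB (niceM nice_toC nf) nfw.
have nhz' := niceB (niceM nice_conj_toC nh) nhz.
have nhw' := niceB (niceM nice_toC nh) nhw.
have N (A : plane -> R[i]) : nice A ->
    - cint mu (fun z => cauchy_mu f z * A z) =
    cint leb2 (fun w => - (pi^-1)%:C * - autocorr (W f) (W A) w / toC w).
  move=> nA; rewrite -cintN; last exact: pairing_cintegrable (nice_cintegrable _).
  under [fun z => - _]eq_fun do rewrite -mulrN.
  rewrite (pairing_autocorr nf (niceN nA)); congr cint; apply/funext => w.
  congr (_ * _ / _); rewrite /autocorr -cintN.
    by congr cint; apply/funext => z; rewrite mulrN mulNr.
  exact: rapid_integrable (rapid_mul_translate w (nice_rapid nA) (nice_rapid nf)).
rewrite !N// (pairing_autocorr nfz' nh) (pairing_autocorr nfw' nh).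
split; congr cint; apply/funext => w; have [Ez Ew] := autocorr_leibniz w.
  by rewrite Ez.
by rewrite Ew.
Qed.

(** The counterpart without a Cauchy kernel; applied to a product of Hermite polynomials it yields
    their orthogonality. *)
Lemma cint_gauss_wder : cint mu (fun z => (toC z)^*%C * f z - fz z) = 0 /\
  cint mu (fun z => toC z * f z - fw z) = 0.
Proof.
have rfz := nice_rapid (niceB (niceM nice_conj_toC nf) nfz).
have rfw := nice_rapid (niceB (niceM nice_toC nf) nfw).
have [] := cint_wder (wder_weight df) (nice_rapid nf) (rapidN rfz) (rapidN rfw).
have [mz _ _] := niceB (niceM nice_conj_toC nf) nfz.
have [mw _ _] := niceB (niceM nice_toC nf) nfw.
rewrite !cintN ?cint_gauss_mu//; try exact: rapid_integrable.
by move=> /eqP; rewrite oppr_eq0 => /eqP -> /eqP; rewrite oppr_eq0 => /eqP ->.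
Qed.

End leibniz.

End pairing.

(** * The transform of the constant function 1 *)

Section cauchy_one.
Context {R : realType}.
Local Notation leb := (@lebesgue_measure R).
Local Notation leb2 := (leb \x leb)%E.
Local Notation plane := (plane R).
Local Notation mu := (@gauss_mu R).
Local Notation one := (fun=> 1 : R[i]).

Lemma ae_neq_gauss_mu (z : plane) : \forall xi \ae mu, xi <> z.
Proof.
exists ([set z.1] `*` [set z.2]); split.
- by apply: measurableX; exact: measurable_set1.
- apply: null_set_integral => //.
  + by apply: measurableX; exact: measurable_set1.
  + by apply/measurable_EFinP/measurable_funTS; exact: measurable_gauss_weight.
  + rewrite [LHS]product_measure1E; [|exact: measurable_set1|exact: measurable_set1].
    transitivity (0 * leb [set z.2])%E; last exact: mul0e.
    by congr (_ * _)%E; exact: lebesgue_measure_set1.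
- by move=> xi /= /contrapT ->.
Qed.

Lemma toC_inj (z w : plane) : toC z = toC w -> z = w.
Proof. by case: z w => [a b] [c d] [-> ->]. Qed.

Lemma toC_mul_cauchy_one (z : plane) : toC z * cauchy_mu one z =
  (pi^-1)%:C * cint mu one + cauchy_mu (@toC R) z.
Proof.
have oi := nice_kernel_cintegrable z nice1.
have ti := nice_kernel_cintegrable z nice_toC.
rewrite !cauchyE -mulrDr mulrCA -cintZ// -cintD//; last first.
  exact: nice_cintegrable nice1.
congr (_ * _); apply: ae_cint.
- by apply: cmeasZ; exact: cintegrable_meas oi.
- by apply: cmeasD; [exact: cmeas_cst|exact: cintegrable_meas ti].
(* The identity z / (z - xi) = 1 + xi / (z - xi) fails at xi = z, where the inverse is 0 by
   convention; that single point is null. *)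
apply: filterS (ae_neq_gauss_mu z) => xi xiz _.
have zxi : toC z - toC xi != 0.
  by rewrite subr_eq0; apply/eqP => /toC_inj /esym.
by field.
Qed.

Definition cis (t : R) : R[i] := cos t +i* sin t.

Lemma cisD s t : cis (s + t) = cis s * cis t.
Proof. by apply: complexP; rewrite /cis/= ?cosD ?sinD; ring. Qed.

Lemma cisX t n : cis t ^+ n = cis (t *+ n).
Proof.
elim: n => [|n ih]; last by rewrite exprS mulrS cisD ih.
by rewrite expr0 mulr0n /cis cos0 sin0.
Qed.

Lemma cis_unit t : cis t * (cis t)^*%C = 1.
Proof. by rewrite mulcJ /sqabs/= cos2Dsin2. Qed.

Lemma cis_neq0 t : cis t != 0.
Proof.
by apply/eqP => t0; move: (cis_unit t); rewrite t0 mul0r => /esym/eqP; rewrite oner_eq0.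
Qed.

Lemma cisV t : (cis t)^-1 = (cis t)^*%C.
Proof. by apply: (mulfI (cis_neq0 t)); rewrite mulfV ?cis_neq0 ?cis_unit. Qed.

Lemma niceX (f : plane -> R[i]) n : nice f -> nice (fun z => f z ^+ n).
Proof.
move=> nf; elim: n => [|n ih]; first exact: nice_cst.
by under eq_fun do rewrite exprS; exact: niceM.
Qed.

Lemma toC_rotate t (z : plane) : toC (rotate t z) = cis t * toC z.
Proof. by apply: complexP => /=; ring. Qed.

(** The kernel is homogeneous of degree -1 and the measure is rotation invariant; [sin t != 0] is
    inherited from the factorization into shears. *)
Lemma cauchy_one_rotate t (z : plane) : sin t != 0 ->
  cauchy_mu one (rotate t z) = (cis t)^*%C * cauchy_mu one z.
Proof.
move=> t0; rewrite !cauchyE mulrCA; congr (_ * _).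
rewrite -[LHS](cint_rotate t0); last exact: cintegrable_meas (nice_kernel_cintegrable _ nice1).
rewrite -cintZ; last exact: nice_kernel_cintegrable nice1.
congr cint; apply/funext => xi; rewrite !toC_rotate -mulrBr invfM !mul1r.
by rewrite cisV mulrC.
Qed.

Lemma pairing_one_conj M :
  cint mu (fun z => cauchy_mu one z * (toC z)^*%C ^+ M) = 0.
Proof.
(* The rotation multiplies the integral by [M.+1] factors e^(-it), in total by -i, which is not 1.
   The choice pi / (M+1) would give a vanishing sine for [M = 0]. *)
pose t : R := pi / 2 / M.+1%:R.
have t0 : 0 < t by rewrite !divr_gt0 ?pi_gt0.
have tpi : t < pi.
  rewrite /t ltr_pdivrMr// ltr_pM2l ?pi_gt0//.
  rewrite (@lt_le_trans _ _ 1)//; first by rewrite invf_lt1// ltr1n.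
  by rewrite ler1n.
have st0 : sin t != 0 by rewrite gt_eqF// sin_gt0_pi// t0.
have fi := pairing_cintegrable nice1 (nice_cintegrable (niceX M nice_conj_toC)).
have mf := cintegrable_meas fi.
set S := cint mu _.
have E : (cis t)^*%C ^+ M.+1 * S = S.
  rewrite -[RHS](cint_rotate st0 mf) /S -(cintZ _ fi).
  congr cint; apply/funext => z.
  by rewrite (cauchy_one_rotate _ st0) toC_rotate rmorphM exprMn exprS mulrACA mulrA.
have : ((cis t)^*%C ^+ M.+1 - 1) * S = 0 by rewrite mulrBl E mul1r subrr.
move/eqP; rewrite mulf_eq0 => /orP[|/eqP//].
rewrite -rmorphXn/= cisX -mulr_natr /t mulfVK// subr_eq0 /cis cos_pihalf sin_pihalf.
by rewrite eq_complex/= eq_sym oner_eq0.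
Qed.

End cauchy_one.

(** * Hermite polynomials *)

Section ito_hermite.
Context {R : realType}.
Local Notation plane := (plane R).
Implicit Types (z : plane) (m n : nat).

Lemma conjcM (v w : R[i]) : (v * w)^*%C = v^*%C * w^*%C. Proof. exact: rmorphM. Qed.
Lemma conjcB (v w : R[i]) : (v - w)^*%C = v^*%C - w^*%C. Proof. exact: rmorphB. Qed.
Lemma conjcX (w : R[i]) n : (w ^+ n)^*%C = w^*%C ^+ n. Proof. exact: rmorphXn. Qed.
Lemma conjcV (w : R[i]) : (w^-1)^*%C = (w^*%C)^-1. Proof. exact: fmorphV. Qed.
Lemma conjcN1 : (-1 : R[i])^*%C = -1. Proof. exact: rmorphN1. Qed.

(** The creation operator z - d/dzbar applied [m] times to the [n]-th power of zbar, with the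
    derivative written out. For [n = 0] the truncated [n.-1] is harmless, its coefficient being
    0. *)
Fixpoint hermite m n z : R[i] :=
  if m is m'.+1 then toC z * hermite m' n z - n%:R * hermite m' n.-1 z
  else (toC z)^*%C ^+ n.

Definition hermite_coef m n k : R[i] := (-1) ^+ k * (k`! * 'C(m, k) * 'C(n, k))%:R.

Lemma hermite_sum m n z : hermite m n z = \sum_(k < m.+1)
  hermite_coef m n k * (toC z ^+ (m - k) * (toC z)^*%C ^+ (n - k)).
Proof.
elim: m n => [|m ih] n.
  by rewrite big_ord1 /hermite_coef !bin0 !subn0 !expr0 !mul1r.
rewrite /= !ih.
(* Pascal's rule on the first binomial: [u] collects the terms with 'C(m, k), [v] those with 'C(m,
   k.-1), which start at k = 1. *)
pose u k := hermite_coef m n k * (toC z ^+ (m.+1 - k) * (toC z)^*%C ^+ (n - k)).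
pose v k := (-1) ^+ k * (k`! * 'C(m, k.-1) * 'C(n, k))%:R *
  (toC z ^+ (m.+1 - k) * (toC z)^*%C ^+ (n - k)) : R[i].
have -> : toC z * (\sum_(k < m.+1) hermite_coef m n k *
    (toC z ^+ (m - k) * (toC z)^*%C ^+ (n - k))) = \sum_(k < m.+2) u k.
  rewrite big_distrr/= [RHS]big_ord_recr/= [u m.+1](_ : _ = 0) ?addr0.
    by apply: eq_bigr => k _; rewrite /u subSn -1?ltnS// exprS; ring.
  by rewrite /u /hermite_coef bin_small// muln0 mul0n mulr0 mul0r.
have -> : - (n%:R * \sum_(k < m.+1) hermite_coef m n.-1 k *
    (toC z ^+ (m - k) * (toC z)^*%C ^+ (n.-1 - k))) = \sum_(k < m.+1) v k.+1.
  rewrite big_distrr/= -sumrN; apply: eq_bigr => k _.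
  rewrite /v /hermite_coef/= subSS.
  have -> : (n - k.+1 = n.-1 - k)%N by rewrite -subn1 -subnDA.
  have := mul_bin_diag n k => nk.
  rewrite (_ : (k.+1)`! * 'C(m, k) * 'C(n, k.+1) = n * (k`! * 'C(m, k) * 'C(n.-1, k)))%N.
    by rewrite exprS natrM; ring.
  by rewrite factS mulnCA nk; ring.
rewrite [in LHS]big_ord_recl [in RHS]big_ord_recl -addrA; congr (_ + _).
  by rewrite /u /hermite_coef !bin0.
rewrite -big_split/=; apply: eq_bigr => k _; rewrite /u /v /hermite_coef -mulrDl.
congr (_ * _); rewrite -mulrDr -natrD; congr (_ * _%:R).
by rewrite /bump/= add1n binS; lia.
Qed.

(** The explicit coefficients are symmetric in the two indices. The two sums have different lengths,
    so both are padded to [m + n + 1] terms by vanishing binomials. *)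
Lemma hermite_conj m n z : (hermite m n z)^*%C = hermite n m z.
Proof.
have wide i j : hermite i j z = \sum_(k < (i + j).+1)
    hermite_coef i j k * (toC z ^+ (i - k) * (toC z)^*%C ^+ (j - k)).
  rewrite hermite_sum -!(big_mkord xpredT
    (fun k => hermite_coef i j k * (toC z ^+ (i - k) * (toC z)^*%C ^+ (j - k)))).
  rewrite [RHS](@big_cat_nat _ _ _ i.+1)//=; last by rewrite ltnS leq_addr.
  rewrite [X in _ + X]big_nat_cond [X in _ + X]big1 ?addr0// => k /andP[/andP[ik _] _].
  by rewrite /hermite_coef bin_small// muln0 mul0n mulr0 mul0r.
rewrite !wide rmorph_sum addnC; apply: eq_bigr => k _.
have -> : hermite_coef n m k = (hermite_coef m n k)^*%C.
  by rewrite /hermite_coef conjcM conjcX conjcN1 conjc_nat mulnAC.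
move: (toC z) => w.
transitivity ((hermite_coef m n k)^*%C * (w^*%C ^+ (m - k) * w^*%C^*%C ^+ (n - k))).
  by rewrite -!conjcX -!conjcM.
by rewrite conjcK [_ * w ^+ _]mulrC.
Qed.

Lemma hermiteSr m n z :
  hermite m n.+1 z = (toC z)^*%C * hermite m n z - m%:R * hermite m.-1 n z.
Proof.
rewrite -hermite_conj/= conjcB !conjcM conjc_nat.
by rewrite -!(hermite_conj m) -(hermite_conj m.-1) !conjcK.
Qed.

Lemma hermite00 z : hermite 0 0 z = 1. Proof. by []. Qed.

Lemma nice_hermite m n : nice (hermite m n).
Proof.
elim: m n => [|m ih] n; first exact: niceX nice_conj_toC.
by apply: niceB; [apply: niceM; [exact: nice_toC|exact: ih]|exact: niceZ].
Qed.

(** Derivatives lower one index, so the operators zbar - d/dz and z - d/dzbar of the integration by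
    parts raise one. *)
Lemma wder_hermite m n : wder (hermite m n)
  (fun z => m%:R * hermite m.-1 n z) (fun z => n%:R * hermite m n.-1 z).
Proof.
elim: m n => [|m ih] n.
  elim: n => [|n ih].
    by have := wder_cst (1 : R[i]); congr wder; apply/funext => z /=; rewrite mul0r.
  have := wderM wder_conj_toC ih.
  congr wder; apply/funext => z /=; rewrite ?exprS//; first by ring.
  case: n {ih} => [|n] /=; first by rewrite mul0r mulr0 addr0 !mul1r.
  by rewrite exprS -[n.+2%:R]natr1; ring.
have d1 := wderM wder_toC (ih n).
have d2 := wderZ (- n%:R) (ih n.-1).
have := wderD d1 d2; congr wder; apply/funext => z /=; first by ring.
  case: m {ih d1 d2} => [|m] /=; first by ring.
  by rewrite -[m.+2%:R]natr1; ring.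
by case: n {ih d1 d2} => [|n] /=; ring.
Qed.

Lemma risingN_nat m k : rising (- m%:R : R) k = (-1) ^+ k * (m ^_ k)%:R.
Proof.
rewrite /rising; elim: k => [|k ih]; first by rewrite big_ord0 expr0 ffactn0 mulr1.
rewrite big_ord_recr/= ih ffactnSr natrM exprS.
have [km|mk] := leqP k m; first by rewrite natrB//; ring.
by rewrite ffact_small//; ring.
Qed.

Lemma rising_nat c k : rising ((c + 1)%:R : R) k = (c + k)`!%:R / c`!%:R.
Proof.
have c0 : c`!%:R != 0 :> R by rewrite pnatr_eq0 -lt0n fact_gt0.
rewrite /rising; elim: k => [|k ih]; first by rewrite big_ord0 addn0 divff.
rewrite big_ord_recr/= ih (addnS c k) factS natrM -natrD.
by rewrite (_ : c + 1 + k = (c + k).+1)%N; [ring|lia].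
Qed.

Lemma kummer1F1_nat m c x : kummer1F1 (- m%:R) (c + 1)%:R x =
  \sum_(k < m.+1) (-1) ^+ k * 'C(m, k)%:R * (c`!%:R / (c + k)`!%:R) * x ^+ k :> R.
Proof.
pose t k : R := rising (- m%:R) k / rising ((c + 1)%:R) k * x ^+ k / k`!%:R.
rewrite /kummer1F1 -/t; transitivity (series t m.+1).
  (* The rising factorial of [- m] vanishes beyond [m], so the partial sums are eventually
     constant. *)
  apply/cvg_lim => //; apply: cvg_near_cst; exists m.+1 => // N /= mN.
  rewrite /series/= (@big_cat_nat _ _ _ m.+1)//=.
  rewrite [X in _ + X]big_nat_cond [X in _ + X]big1 ?addr0// => k /andP[/andP[mk _] _].
  by rewrite /t risingN_nat ffact_small// mulr0 !mul0r.
rewrite /series/= big_mkord; apply: eq_bigr => k _.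
have k0 : k`!%:R != 0 :> R by rewrite pnatr_eq0 -lt0n fact_gt0.
rewrite /t risingN_nat rising_nat -bin_ffact natrM invf_div.
by field; rewrite k0 pnatr_eq0 -lt0n fact_gt0.
Qed.

Lemma itoH_le m n z : (m <= n)%N -> itoH m n z = hermite m n z.
Proof.
(* Kummer's sum runs by increasing powers of |z|^2, the explicit formula by decreasing ones; hence
   the reversal of the index. *)
move=> mn; rewrite /itoH mn hermite_sum kummer1F1_nat [RHS](reindex_inj rev_ord_inj)/=.
rewrite (rmorph_sum (real_complex R)) big_distrr/=; apply: eq_bigr => k _.
have km : (k <= m)%N by rewrite -ltnS.
rewrite subSS subKn// (_ : n - (m - k) = n - m + k)%N; last lia.
have binE : ('C(n, m - k) * (m - k)`! * (n - m + k)`! = n`!)%N.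
  by rewrite -(@bin_fact n (m - k)) ?mulnA; [congr (_ * _`!)%N; lia|lia].
have nz j : j`!%:R != 0 :> R[i] by rewrite pnatr_eq0 -lt0n fact_gt0.
rewrite /hermite_coef bin_sub// !natrM -binE !natrM.
rewrite (_ : (-1) ^+ (m - k) = (-1) ^+ m * (-1) ^+ k :> R[i]); last first.
  by move: (k : nat) km => j jm; rewrite -{2}(subnK jm) exprD;
    rewrite -mulrA -exprMn mulrNN mulr1 expr1n mulr1.
have castE (p q r : nat) (x : R) : ((-1) ^+ k * p%:R * (q%:R / r%:R) * x ^+ k)%:C =
    (-1) ^+ k * p%:R * (q%:R / r%:R) * x%:C ^+ k.
  by rewrite !rmorphM !rmorphXn fmorphV rmorphN1 !rmorph_nat.
rewrite castE -mulcJ exprMn exprD.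
by field; rewrite !nz.
Qed.

Lemma itoHE m n : itoH m n = hermite m n :> (plane -> R[i]).
Proof.
apply/funext => z; have [mn|nm] := leqP m n; first exact: itoH_le.
rewrite -hermite_conj -itoH_le; last exact: ltnW.
rewrite /itoH leqNgt nm (ltnW nm)/= !conjcM !conjcX conjcN1 conjcV conjcK.
by rewrite !conjc_nat conjc_real.
Qed.

End ito_hermite.

(** * Scalar products and Cauchy pairings of Hermite polynomials *)

Section hermite_pairings.
Context {R : realType}.
Local Notation leb := (@lebesgue_measure R).
Local Notation plane := (plane R).
Local Notation mu := (@gauss_mu R).
Local Notation H := (@hermite R).

Definition mass : R[i] := cint mu (fun=> 1).

Lemma gauss_mu_gt0 : (0 < mu setT)%E.
Proof.
pose I : set (measurableTypeR R) := `[0, 1]%classic.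
have mI : measurable I by exact: measurable_itv.
have I1 : leb I = 1%E by rewrite /I lebesgue_measure_itv/= lte_fin ltr01 oppr0 adde0.
have mII : measurable (I `*` I) by exact: measurableX.
have mw : measurable_fun setT (fun z : plane => (gauss_weight z)%:E).
  by apply/measurable_EFinP; exact: measurable_gauss_weight.
apply: (@lt_le_trans _ _ (mu (I `*` I))); last first.
  by apply: le_measure; rewrite ?inE.
(* On the unit square |z|^2 is at most 2, and the square has area 1. *)
apply: (@lt_le_trans _ _ (\int[(leb \x leb)%E]_(z in I `*` I) (expR (- 2))%:E)%E).
  rewrite integral_cst// (_ : _ (I `*` I) = 1%E) ?mule1 ?lte_fin ?expR_gt0//.
  rewrite [LHS]product_measure1E//; transitivity (1 * 1 : \bar R)%E.
    by congr (_ * _)%E; exact: I1.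
  exact: mule1.
apply: ge0_le_integral => //.
- exact: (measurable_funTS mw).
move=> [x y] []; rewrite /I/= !in_itv/= => /andP[x0 x1] /andP[y0 y1].
by rewrite lee_fin ler_expR lerN2 /sqabs/=; nra.
Qed.

Lemma mass_neq0 : mass != 0.
Proof.
apply/eqP => /(congr1 (@complex.Re R))/=; rewrite Rintegral_cst// mul1r => /eqP.
apply/negP; rewrite gt_eqF// fine_gt0// gauss_mu_gt0/=.
by rewrite -ge0_fin_numE// fin_num_measure.
Qed.

(** Bilinear, so that integration by parts treats both factors alike; by [hermite_conj] it is the
    scalar product of [H i n] with [H b a]. *)
Definition dotH i n a b := cint mu (fun z => H i n z * H a b z).

Lemma dotH_int i n a b : cintegrable mu (fun z => H i n z * H a b z).
Proof. by apply: nice_cintegrable; apply: niceM; exact: nice_hermite. Qed.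

Lemma dotHSl i n a b : dotH i.+1 n a b = b%:R * dotH i n a b.-1.
Proof.
have nH := @nice_hermite R.
have d1 := wder_hermite (R := R) i n; have d2 := wder_hermite (R := R) a b.
have [|||_] := cint_gauss_wder (wderM d1 d2).
- exact: niceM.
- by apply: niceD; apply: niceM => //; exact: niceZ.
- by apply: niceD; apply: niceM => //; exact: niceZ.
rewrite (_ : (fun _ => _) = (fun z => H i.+1 n z * H a b z -
    b%:R * (H i n z * H a b.-1 z))); last by apply/funext => z /=; ring.
rewrite cintB ?cintZ; [|exact: dotH_int|exact: dotH_int|].
  by move/eqP; rewrite subr_eq0 => /eqP.
by apply: cintegrableZ; exact: dotH_int.
Qed.

Lemma dotHSr i n a b : dotH i n.+1 a b = a%:R * dotH i n a.-1 b.
Proof.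
have nH := @nice_hermite R.
have d1 := wder_hermite (R := R) i n; have d2 := wder_hermite (R := R) a b.
have [|||+ _] := cint_gauss_wder (wderM d1 d2).
- exact: niceM.
- by apply: niceD; apply: niceM => //; exact: niceZ.
- by apply: niceD; apply: niceM => //; exact: niceZ.
rewrite (_ : (fun _ => _) = (fun z => H i n.+1 z * H a b z -
    a%:R * (H i n z * H a.-1 b z))); last by apply/funext => z; rewrite hermiteSr; ring.
rewrite cintB ?cintZ; [|exact: dotH_int|exact: dotH_int|].
  by move/eqP; rewrite subr_eq0 => /eqP.
by apply: cintegrableZ; exact: dotH_int.
Qed.

Lemma dotHC i n a b : dotH i n a b = dotH a b i n.
Proof. by congr cint; apply/funext => z; rewrite mulrC. Qed.

(** Raising [i] lowers [b] and raising [n] lowers [a]; unless the indices run out together, a factor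
    0 appears. *)
Lemma dotHE i n a b :
  dotH i n a b = if (i == b) && (n == a) then (i`! * n`!)%:R * mass else 0.
Proof.
elim: i n a b => [|i ih] n a b; last first.
  rewrite dotHSl; case: b => [|b]; first by rewrite mul0r.
  rewrite ih eqSS /=; case: ifP => [/andP[/eqP -> _]|_]; last by rewrite mulr0.
  by rewrite factS !natrM !mulrA.
elim: n a => [|n ih] a; last first.
  rewrite dotHSr; case: a => [|a]; first by rewrite mul0r andbF.
  rewrite ih eqSS /=; case: ifP => [/andP[_ /eqP ->]|_]; last by rewrite mulr0.
  by rewrite [in RHS]factS !natrM; ring.
rewrite dotHC; case: a => [|a]; last by rewrite dotHSl mul0r andbF.
case: b => [|b]; last by rewrite dotHSr mul0r.
rewrite mul1r /dotH /mass; congr cint; apply/funext => z.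
by rewrite hermite00 mulr1.
Qed.

Definition pairH i n a b := cint mu (fun z => cauchy_mu (H i n) z * H a b z).

Lemma pairH_int i n a b : cintegrable mu (fun z => cauchy_mu (H i n) z * H a b z).
Proof.
by apply: pairing_cintegrable; [|apply: nice_cintegrable]; exact: nice_hermite.
Qed.

Lemma pairHSl i n a b : pairH i.+1 n a b = - pairH i n a.+1 b.
Proof.
have nH := @nice_hermite R.
have d1 := wder_hermite (R := R) i n; have d2 := wder_hermite (R := R) a b.
by have [_] := pairing_leibniz d1 d2 (nH i n) (niceZ _ (nH _ _)) (niceZ _ (nH _ _))
  (nH a b) (niceZ _ (nH _ _)) (niceZ _ (nH _ _)).
Qed.

Lemma pairHSr i n a b : pairH i n.+1 a b = - pairH i n a b.+1.
Proof.
have nH := @nice_hermite R.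
have d1 := wder_hermite (R := R) i n; have d2 := wder_hermite (R := R) a b.
have [+ _] := pairing_leibniz d1 d2 (nH i n) (niceZ _ (nH _ _)) (niceZ _ (nH _ _))
  (nH a b) (niceZ _ (nH _ _)) (niceZ _ (nH _ _)).
have E j k : (fun z => (toC z)^*%C * H j k z - j%:R * H j.-1 k z) = H j k.+1.
  by apply/funext => z; rewrite hermiteSr.
by rewrite E; under [X in _ = - cint _ X]eq_fun do rewrite -hermiteSr.
Qed.

Lemma pairH_shift i n a b : pairH i n a b = (-1) ^+ (i + n) * pairH 0 0 (a + i) (b + n).
Proof.
elim: i a => [|i ih] a; last first.
  by rewrite pairHSl ih (addSnnS a) (addSn i) exprS mulN1r mulNr.
rewrite addn0 add0n; elim: n b => [|n ih] b; first by rewrite expr0 mul1r addn0.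
by rewrite pairHSr ih exprS addSnnS mulN1r mulNr.
Qed.

Lemma pairH00_0 b : pairH 0 0 0 b = 0.
Proof. exact: pairing_one_conj. Qed.

(** In H_{a+1,b} = z H_{a,b} - b H_{a,b-1} the factor z is absorbed by the transform of 1. The
    resulting [pairH 1 0 a b] is [- pairH 0 0 a.+1 b], which doubles the left side. *)
Lemma pairH00_S a b : 2 * pairH 0 0 a.+1 b =
  (pi^-1)%:C * mass * dotH a b 0 0 - b%:R * pairH 0 0 a b.-1.
Proof.
have H10 : H 1 0 = @toC R by apply/funext => z /=; rewrite mul0r subr0 expr0 mulr1.
have E : pairH 0 0 a.+1 b =
    (pi^-1)%:C * mass * dotH a b 0 0 + pairH 1 0 a b - b%:R * pairH 0 0 a b.-1.
  have di := dotH_int a b 0 0.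
  rewrite /pairH -(cintZ _ (pairH_int 0 0 a b.-1)) -(cintZ _ di).
  rewrite -cintD; [|exact: cintegrableZ|exact: pairH_int].
  rewrite -cintB; [|by apply: cintegrableD; [exact: cintegrableZ|exact: pairH_int]|
    by apply: cintegrableZ; exact: pairH_int].
  congr cint; apply/funext => z; rewrite H10 hermite00 mulr1.
  have -> : H a.+1 b z = toC z * H a b z - b%:R * H a b.-1 z by [].
  have := toC_mul_cauchy_one z; rewrite -/mass => zC.
  have -> : cauchy_mu (H 0 0) z = cauchy_mu (fun=> 1) z by [].
  move: (H a b z) (H a b.-1 z) zC => x y zC.
  rewrite (_ : _ * (_ - _) = toC z * cauchy_mu (fun=> 1) z * x -
    b%:R * (cauchy_mu (fun=> 1) z * y)); last by ring.
  by rewrite zC mulrDl.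
by rewrite -[2]/(1 + 1) mulrDl mul1r {1}E pairHSl; ring.
Qed.

(** The recurrence preserves the difference of the indices and its source term lives at (0, 0) only.
    Off the line a = b + 1 the descent ends either at [a = 0] or at [b = 0] with [a >= 2], where the
    value is 0. *)
Lemma pairH00_eq0 a b : a != b.+1 -> pairH 0 0 a b = 0.
Proof.
elim: b a => [|b ih] [|a] ab; try exact: pairH00_0.
  have := pairH00_S a 0; rewrite dotHE mul0r subr0 andbC/=.
  case: a ab => // a _; rewrite mulr0 => /eqP.
  by rewrite mulf_eq0 pnatr_eq0/= => /eqP.
have := pairH00_S a b.+1; rewrite dotHE andbC/= mulr0 sub0r/= ih ?mulr0 ?oppr0//.
by move=> /eqP; rewrite mulf_eq0 pnatr_eq0/= => /eqP.
Qed.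

(** Each descent along the line a = b + 1 contributes the factor -b / 2, down to the value at (1,
    0), which is half of mass^2 / pi. *)
Lemma pairH00_neq0 b : pairH 0 0 b.+1 b != 0.
Proof.
suff : 2 * pairH 0 0 b.+1 b != 0 by rewrite mulf_eq0 negb_or => /andP[].
elim: b => [|b ih].
  rewrite pairH00_S mul0r subr0 dotHE/= !mulf_neq0 ?mass_neq0//.
  by rewrite fmorph_eq0 invr_eq0 gt_eqF// pi_gt0.
rewrite pairH00_S dotHE/= mulr0 sub0r oppr_eq0 mulf_neq0 ?pnatr_eq0//.
by move: ih; rewrite mulf_eq0 negb_or => /andP[].
Qed.

Lemma pairH_eq0 i n a b : (a + i != (b + n).+1)%N -> pairH i n a b = 0.
Proof. by move=> ne; rewrite pairH_shift pairH00_eq0 ?mulr0. Qed.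

Lemma pairH_neq0 i n a b : (a + i = (b + n).+1)%N -> pairH i n a b != 0.
Proof.
by move=> e; rewrite pairH_shift e mulf_neq0 ?pairH00_neq0// expf_neq0// oppr_eq0 oner_eq0.
Qed.

End hermite_pairings.

(** * Square-integrable functions *)

Section l2.
Context {R : realType}.
Local Notation normc := (@ComplexField.Normc.normc R).
Local Notation plane := (plane R).
Local Notation mu := (@gauss_mu R).
Implicit Types (f g h k : plane -> R[i]) (z : plane).

Lemma Lfun2P (r : plane -> R) : r \in Lfun mu 2%:E <->
  measurable_fun setT r /\ mu.-integrable setT (EFin \o (fun z => r z ^+ 2)).
Proof.
split=> [r2|[mr r2]].
  split; last exact: Lfun2_integrable_sqr.
  by move: r2; rewrite inE => /andP[]; rewrite inE.
rewrite inE; apply/andP; split; rewrite inE//= /finite_norm unlock /Lnorm.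
rewrite poweR_lty//; have /integrableP[_] := r2; apply: le_lt_trans.
rewrite le_eqVlt; apply/orP; left; apply/eqP; apply: eq_integral => z _ /=.
by rewrite powR_mulrn// normrX.
Qed.

Lemma L2P f : L2 f <->
  cmeas f /\ mu.-integrable setT (EFin \o (fun z => sqabs (f z))).
Proof.
split=> [[/Lfun2P[mr ir] /Lfun2P[mj ij]]|[mf fi]].
  by split; [split|exact: (integrableD measurableT ir ij)].
have [mr mj] := mf; split; apply/Lfun2P; split => //.
  apply: le_integrable fi => //.
    by apply/measurable_EFinP; exact: measurable_funX.
  move=> z _; rewrite lee_fin !ger0_norm ?sqabs_ge0 ?sqr_ge0//.
  by rewrite /sqabs lerDl sqr_ge0.
apply: le_integrable fi => //.
  by apply/measurable_EFinP; exact: measurable_funX.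
move=> z _; rewrite lee_fin !ger0_norm ?sqabs_ge0 ?sqr_ge0//.
by rewrite /sqabs lerDr sqr_ge0.
Qed.

Lemma L2_cmeas f : L2 f -> cmeas f. Proof. by case/L2P. Qed.

Lemma integrable1 : mu.-integrable setT (EFin \o (fun=> 1 : R)).
Proof. exact: finite_measure_integrable_cst. Qed.

Lemma L2_le f (r : plane -> R) : cmeas f -> mu.-integrable setT (EFin \o r) ->
  (forall z, sqabs (f z) <= r z) -> L2 f.
Proof.
move=> mf ir fr; apply/L2P; split => //; apply: le_integrable ir => //.
  by apply/measurable_EFinP; exact: measurable_sqabs.
move=> z _; rewrite lee_fin ger0_norm ?sqabs_ge0// (le_trans (fr z))//.
exact: ler_norm.
Qed.

Lemma L2_bounded f (K : R) : cmeas f -> (forall z, normc (f z) <= K) -> L2 f.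
Proof.
move=> mf fK; apply: (L2_le (r := fun=> K ^+ 2 * 1) mf).
  exact: (integrableZl measurableT (K ^+ 2) integrable1).
by move=> z; rewrite mulr1 -sqr_normcE ler_pXn2r ?nnegrE ?normc_ge0// (le_trans (normc_ge0 (f z))).
Qed.

Lemma L2_nice f : nice f -> L2 f.
Proof.
move=> nf; have [mf _ _] := nf; apply/L2P; split => //.
have nff : nice (fun z => f z * (f z)^*%C).
  apply: niceM => //; case: nf => _ [cx cy] gf; split.
  - exact: cmeas_conj.
  - have conj_cont (h : R -> R[i]) : ccont h -> ccont (fun x => (h x)^*%C).
      move=> [rh jh]; split.
        by rewrite (_ : _ \o _ = @complex.Re R \o h)//; apply/funext => x /=; rewrite Re_conj.
      rewrite (_ : _ \o _ = \- (@complex.Im R \o h)).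
        by move=> x; apply: cvgN; exact: jh.
      by apply/funext => x /=; rewrite Im_conj.
    by split => ?; apply: conj_cont.
  - move=> e e0; have [K K0 fK] := gf e e0.
    by exists K => // z; rewrite normc_conj.
have [+ _] := nice_cintegrable nff; congr (integrable _ _ _).
by apply/funext => z /=; rewrite mulcJ.
Qed.

Lemma L2_mul f g : L2 f -> L2 g -> cintegrable mu (fun z => f z * g z).
Proof.
move=> /L2P[mf fi] /L2P[mg gi].
apply: (le_cintegrable (g := fun z => sqabs (f z) + sqabs (g z))).
- exact: cmeasM.
- exact: (integrableD measurableT fi gi).
- move=> z; rewrite normcM -!sqr_normcE.
  have := normc_ge0 (f z); have := normc_ge0 (g z); nra.
Qed.

Lemma L2_cintegrable f : L2 f -> cintegrable mu f.
Proof.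
move=> f2; have := L2_mul f2 (L2_nice nice1).
by congr cintegrable; apply/funext => z; rewrite mulr1.
Qed.

Lemma sqabsD_le (v w : R[i]) : sqabs (v + w) <= 2 * sqabs v + 2 * sqabs w.
Proof.
rewrite -!sqr_normcE; apply: (@le_trans _ _ ((normc v + normc w) ^+ 2)).
  by rewrite ler_pXn2r ?nnegrE ?addr_ge0 ?normc_ge0// normcD.
rewrite -subr_ge0 (_ : _ - _ = (normc v - normc w) ^+ 2) ?sqr_ge0//.
by ring.
Qed.

Lemma L2_lin a f g : L2 f -> L2 g -> L2 (fun z => a * f z + g z).
Proof.
move=> /L2P[mf fi] /L2P[mg gi].
apply: (L2_le (r := fun z => 2 * sqabs a * sqabs (f z) + 2 * sqabs (g z))).
- by apply: cmeasD => //; exact: cmeasZ.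
- exact: (integrableD measurableT (integrableZl measurableT (2 * sqabs a) fi)
    (integrableZl measurableT 2 gi)).
- by move=> z; rewrite (le_trans (sqabsD_le _ _))// sqabsM mulrA.
Qed.

Lemma L2_0 : L2 (fun=> 0 : R[i]). Proof. exact: L2_nice (nice_cst _). Qed.

Lemma L2_Z a f : L2 f -> L2 (fun z => a * f z).
Proof.
by move=> f2; have := L2_lin a f2 L2_0; congr L2; apply/funext => z; rewrite addr0.
Qed.

Lemma L2_B f g : L2 f -> L2 g -> L2 (fun z => f z - g z).
Proof.
move=> f2 g2; have := L2_lin (-1) g2 f2.
by congr L2; apply/funext => z; rewrite mulN1r addrC.
Qed.

Lemma L2_conj f : L2 f -> L2 (fun z => (f z)^*%C).
Proof.
move=> /L2P[mf fi]; apply/L2P; split; first exact: cmeas_conj.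
move: fi; congr (integrable _ _ _); apply/funext => z /=.
by rewrite -!sqr_normcE normc_conj.
Qed.

Lemma L2_lincomb N (c : 'I_N -> R[i]) (e : 'I_N -> plane -> R[i]) :
  (forall i, L2 (e i)) -> L2 (lincomb c e).
Proof.
elim: N c e => [|N ih] c e e2.
  by rewrite (_ : lincomb c e = fun=> 0);
    [exact: L2_0|apply/funext => z; rewrite /lincomb big_ord0].
rewrite (_ : lincomb c e = fun z => c ord0 * e ord0 z +
    lincomb (c \o lift ord0) (e \o lift ord0) z).
  by apply: L2_lin => //; apply: ih => i; exact: e2.
by apply/funext => z; rewrite /lincomb big_ord_recl.
Qed.

Lemma L2_ae f g : L2 f -> cmeas g -> f = g %[ae mu] -> L2 g.
Proof.
move=> /L2P[mf fi] mg fg; apply/L2P; split => //.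
apply/integrableP; split; first by apply/measurable_EFinP; exact: measurable_sqabs.
have /integrableP[_] := fi; apply: le_lt_trans; rewrite le_eqVlt; apply/orP; left.
apply/eqP/ae_eq_integral => //.
- by do 2 apply: measurableT_comp => //; exact: measurable_sqabs.
- by do 2 apply: measurableT_comp => //; exact: measurable_sqabs.
- by apply: filterS fg => z /[apply] /= ->.
Qed.

Definition sqn f : R := \int[mu]_z sqabs (f z).

Lemma sqn_ge0 f : 0 <= sqn f.
Proof. by apply: Rintegral_ge0 => z _; exact: sqabs_ge0. Qed.

Lemma normL2E f : normL2 f = Num.sqrt (sqn f).
Proof.
rewrite /normL2 /dotL2 /Cintegral/=; congr Num.sqrt; apply: eq_Rintegral => z _.
by rewrite [X in complex.Re X]mulcJ.
Qed.

Lemma sqr_normL2 f : normL2 f ^+ 2 = sqn f.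
Proof. by rewrite normL2E sqr_sqrtr ?sqn_ge0. Qed.

Lemma normL2_ge0 f : 0 <= normL2 f. Proof. by rewrite normL2E sqrtr_ge0. Qed.

Lemma dotL2E f g : dotL2 f g = cint mu (fun z => f z * (g z)^*%C).
Proof. by []. Qed.

Lemma ae_distL2 f f' g g' : cmeas f -> cmeas f' -> cmeas g -> cmeas g' ->
  f = f' %[ae mu] -> g = g' %[ae mu] -> distL2 f g = distL2 f' g'.
Proof.
move=> mf mf' mg mg' ff' gg'; rewrite /distL2 !normL2E; congr (Num.sqrt (fine _)).
apply: ae_eq_integral => //.
- by apply/measurable_EFinP; apply: measurable_sqabs; exact: cmeasB.
- by apply/measurable_EFinP; apply: measurable_sqabs; exact: cmeasB.
- by apply: filterS2 ff' gg' => z ff' gg' _; rewrite ff'// gg'.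
Qed.

Lemma sqn_lin a f g : L2 f -> L2 g ->
  sqn (fun z => a * f z + g z) <= 2 * sqabs a * sqn f + 2 * sqn g.
Proof.
move=> f2 g2; have /L2P[mf fi] := f2; have /L2P[mg gi] := g2.
have /L2P[_ hi] := L2_lin a f2 g2.
rewrite /sqn -!RintegralZl// -RintegralD//; first last.
- exact: (integrableZl measurableT 2 gi).
- exact: (integrableZl measurableT (2 * sqabs a) fi).
apply: le_Rintegral => //.
  exact: (integrableD measurableT (integrableZl measurableT (2 * sqabs a) fi)
    (integrableZl measurableT 2 gi)).
by move=> z _; rewrite (le_trans (sqabsD_le _ _))// sqabsM mulrA.
Qed.

Lemma distL2_0_ae f g : L2 f -> L2 g -> distL2 f g = 0 -> f = g %[ae mu].
Proof.
move=> f2 g2 fg0; have /L2P[mh hi] := L2_B f2 g2.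
have : sqn (fun z => f z - g z) = 0.
  by rewrite -sqr_normL2 -[normL2 _]/(distL2 f g) fg0 expr0n.
rewrite /sqn /Rintegral => /eqP.
rewrite fine_eq0 ?(integrable_fin_num _ hi)// => /eqP I0.
have : ae_eq mu setT (EFin \o (fun z => sqabs (f z - g z))) (cst 0%E).
  apply/(ae_eq_integral_abs _ measurableT).
    by apply/measurable_EFinP; exact: measurable_sqabs.
  by rewrite -[RHS]I0; apply: eq_integral => z _ /=; rewrite ger0_norm// sqabs_ge0.
apply: filterS => z /(_ I) /= [] /sqabs_eq0/eqP; rewrite subr_eq0 => /eqP fg _.
exact: fg.
Qed.

(** A weighted form of 2ab <= a^2 + b^2: the 2 comes from [normc_cint_le], and the free parameter
    [e] takes the place of the Cauchy-Schwarz inequality. *)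
Lemma normc_cint_mul_le f k (e : R) : 0 < e -> L2 f -> L2 k ->
  normc (cint mu (fun z => f z * k z)) <= e^-1 * sqn f + e * sqn k.
Proof.
move=> e0 f2 k2; have fki := L2_mul f2 k2.
have /L2P[mf fi] := f2; have /L2P[mk ki] := k2.
apply: (le_trans (normc_cint_le fki)).
rewrite -RintegralZl//; last exact: integrable_normc.
rewrite /sqn -!RintegralZl// -RintegralD//; first last.
- exact: (integrableZl measurableT e ki).
- exact: (integrableZl measurableT e^-1 fi).
apply: le_Rintegral => //.
- exact: (integrableZl measurableT 2 (integrable_normc fki)).
- exact: (integrableD measurableT (integrableZl measurableT e^-1 fi)
    (integrableZl measurableT e ki)).
move=> z _; rewrite normcM -!sqr_normcE.
set a := normc (f z); set b := normc (k z).
rewrite -subr_ge0 (_ : _ - _ = e^-1 * (a - e * b) ^+ 2).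
  by rewrite mulr_ge0 ?sqr_ge0// invr_ge0 ltW.
by field; rewrite gt_eqF.
Qed.

(** Integration against a fixed L^2 function is continuous, so its kernel is closed. *)
Lemma cint_mul_eq0_closure f k : L2 f -> L2 k ->
  (forall d : R, 0 < d -> exists g, [/\ L2 g, cint mu (fun z => g z * k z) = 0 &
    distL2 f g < d]) ->
  cint mu (fun z => f z * k z) = 0.
Proof.
move=> f2 k2 approx.
apply: ComplexField.Normc.eq0_normc; apply/eqP; rewrite eq_le normc_ge0 andbT.
apply/ler_addgt0Pl => e e0; rewrite addr0.
(* Chosen so that [c * sqn k] is at most [e / 2]; the 1 keeps the denominator positive.
   Approximation within the root of [c * (e / 2)] bounds the other term by [e / 2] too. *)
pose c := e / (2 * (1 + sqn k)).
have k0 := sqn_ge0 k.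
have c0 : 0 < c by rewrite divr_gt0// mulr_gt0// ltr_wpDr.
have [|g [g2 gk fg]] := approx (Num.sqrt (c * (e / 2))).
  by rewrite sqrtr_gt0 mulr_gt0// divr_gt0.
have fg2 := L2_B f2 g2.
have -> : cint mu (fun z => f z * k z) = cint mu (fun z => (f z - g z) * k z).
  rewrite -[LHS]subr0 -gk -cintB; [|exact: L2_mul|exact: L2_mul].
  by congr cint; apply/funext => z; rewrite mulrBl.
rewrite (le_trans (normc_cint_mul_le c0 fg2 k2))//.
have h1 : c^-1 * sqn (fun z => f z - g z) <= e / 2.
  rewrite mulrC ler_pdivrMr// mulrC -sqr_normL2.
  have ce : 0 <= c * (e / 2) by rewrite ltW// mulr_gt0// divr_gt0.
  rewrite -[leRHS](sqr_sqrtr ce) ler_pXn2r ?nnegrE ?normL2_ge0 ?sqrtr_ge0//.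
  exact: ltW.
have h2 : c * sqn k <= e / 2.
  rewrite /c mulrAC ler_pdivrMr ?mulr_gt0 ?ltr_wpDr//.
  by nra.
lra.
Qed.

End l2.

(** * The ranges *)

Section bargmann_spaces.
Context {R : realType}.
Local Notation plane := (plane R).
Local Notation mu := (@gauss_mu R).
Local Notation H := (@hermite R).
Implicit Types (f g h u : plane -> R[i]) (V : set (plane -> R[i])).

Lemma L2_hermite m n : L2 (H m n). Proof. exact: L2_nice (nice_hermite _ _). Qed.

Lemma L2_cauchy_hermite m n : L2 (cauchy_mu (H m n)).
Proof.
have [K K0 HK] := nice_cauchy_bounded (nice_hermite (R := R) m n).
apply: (L2_bounded _ HK); apply: cmeas_cauchy.
by case: (nice_hermite (R := R) m n).
Qed.

Lemma dotL2_hermite f m n : dotL2 f (H m n) = cint mu (fun z => f z * H n m z).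
Proof. by rewrite dotL2E; congr cint; apply/funext => z; rewrite hermite_conj. Qed.

Lemma cint_lincomb N (c : 'I_N -> R[i]) (e : 'I_N -> plane -> R[i]) g :
  (forall i, L2 (e i)) -> L2 g ->
  cint mu (fun z => lincomb c e z * g z) =
  \sum_(i < N) c i * cint mu (fun z => e i z * g z).
Proof.
move=> e2 g2; have eg i := L2_mul (e2 i) g2.
transitivity (cint mu (fun z => \sum_(i < N) c i * (e i z * g z))).
  congr cint; apply/funext => z; rewrite /lincomb mulr_suml.
  by apply: eq_bigr => i _; rewrite mulrA.
rewrite cint_sum => [|i]; last exact: cintegrableZ.
by apply: eq_bigr => i _; rewrite cintZ.
Qed.

Lemma ae_cint_mul f g h : cmeas f -> cmeas g -> cmeas h -> f = g %[ae mu] ->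
  cint mu (fun z => f z * h z) = cint mu (fun z => g z * h z).
Proof.
move=> mf mg mh fg; apply: ae_cint; [exact: cmeasM|exact: cmeasM|].
by apply: filterS fg => z /[apply] ->.
Qed.

Section true_poly.
Variable n : nat.
Local Notation A := (@true_poly_bargmann R n).

Definition hermite_psum (alpha : nat -> R[i]) N : plane -> R[i] :=
  fun z => \sum_(j < N) alpha j * itoH j n z.

Lemma hermite_psumE alpha N :
  hermite_psum alpha N = lincomb (fun j : 'I_N => alpha j) (fun j : 'I_N => H j n).
Proof.
apply/funext => z; rewrite /hermite_psum /lincomb.
by apply: eq_bigr => j _; rewrite itoHE.
Qed.

Lemma L2_hermite_psum alpha N : L2 (hermite_psum alpha N).
Proof. by rewrite hermite_psumE; apply: L2_lincomb => i; exact: L2_hermite. Qed.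

Lemma cint_hermite_psum alpha N g : L2 g ->
  cint mu (fun z => hermite_psum alpha N z * g z) =
  \sum_(j < N) alpha j * cint mu (fun z => H j n z * g z).
Proof.
by move=> g2; rewrite hermite_psumE cint_lincomb// => i; exact: L2_hermite.
Qed.

Lemma hermite_psum_approx f alpha (d : R) : 0 < d ->
  distL2 f (hermite_psum alpha N) @[N --> \oo] --> (0 : R) ->
  exists M, forall N, (M <= N)%N -> distL2 f (hermite_psum alpha N) < d.
Proof.
move=> d0 /cvgr_lt /(_ _ d0) [M _ fM]; exists M => // N MN; exact: fM.
Qed.

Lemma true_poly_bargmann_cint_eq0 f k : A f -> L2 k ->
  (forall j, cint mu (fun z => H j n z * k z) = 0) ->
  cint mu (fun z => f z * k z) = 0.
Proof.
move=> [f2 [alpha [_ fa]]] k2 k0; apply: cint_mul_eq0_closure => // d d0.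
have [M fM] := hermite_psum_approx d0 fa.
exists (hermite_psum alpha M); split; [exact: L2_hermite_psum| |exact: fM].
by rewrite cint_hermite_psum// big1// => j _; rewrite k0 mulr0.
Qed.

(** Conjugation brings [h] into the first slot, where vanishing on Hermite polynomials extends to
    limits of their sums. *)
Lemma true_poly_bargmann_dot_eq0 u h : L2 u -> A h -> (forall j, dotL2 u (H j n) = 0) ->
  dotL2 u h = 0.
Proof.
move=> u2 Ah uH; have h2 : L2 h by case: Ah.
have u2' := L2_conj u2.
have conjE f g : L2 f -> L2 g ->
    cint mu (fun z => f z * (g z)^*%C) = (cint mu (fun z => g z * (f z)^*%C))^*%C.
  move=> f2 g2; rewrite -cint_conj; last exact: L2_mul (L2_conj f2).
  by congr cint; apply/funext => z; rewrite conjcM conjcK mulrC.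
rewrite dotL2E conjE// (true_poly_bargmann_cint_eq0 Ah u2') ?conjc0// => j.
rewrite (conjE _ _ (L2_hermite j n) u2).
by have -> : cint mu (fun z => u z * (H j n z)^*%C) = 0 := uH j; rewrite conjc0.
Qed.

(** Once term [i] is present, a partial sum minus [alpha i * H i n] pairs to 0 with [H n i].
    Subtracting the same function from [g] leaves the distances unchanged, so the closure argument
    applies. *)
Lemma hermite_series_coef_eq0 g alpha i : L2 g ->
  distL2 g (hermite_psum alpha N) @[N --> \oo] --> (0 : R) ->
  dotL2 g (H i n) = 0 -> alpha i = 0.
Proof.
move=> g2 ga; rewrite dotL2_hermite => gH.
have Hni : L2 (H n i) by exact: L2_hermite.
have Hin : L2 (H i n) by exact: L2_hermite.
have aH2 := L2_Z (alpha i) Hin.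
have : cint mu (fun z => (g z - alpha i * H i n z) * H n i z) = 0.
  apply: cint_mul_eq0_closure => //; first exact: L2_B.
  move=> d d0; have [M gM] := hermite_psum_approx d0 ga.
  (* Large enough for the approximation and for the partial sum to contain term [i]. *)
  pose N := maxn M i.+1.
  exists (fun z => hermite_psum alpha N z - alpha i * H i n z); split.
  - by apply: L2_B => //; exact: L2_hermite_psum.
  - under eq_fun do rewrite mulrBl.
    rewrite cintB; [|exact: L2_mul (L2_hermite_psum _ _) Hni|exact: L2_mul].
    rewrite cint_hermite_psum//.
    under [X in _ - cint _ X]eq_fun do rewrite -mulrA.
    rewrite cintZ; last exact: L2_mul.
    have iN : (i < N)%N by rewrite leq_max leqnn orbT.
    rewrite (bigD1 (Ordinal iN))//= big1 ?addr0 ?subrr// => j ji.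
    rewrite -/(dotH j n n i) dotHE (_ : (j == i :> nat) = false) ?mulr0//.
    by apply/negbTE; apply: contra ji => /eqP ji; apply/eqP/val_inj.
  - rewrite (_ : distL2 _ _ = distL2 g (hermite_psum alpha N)).
      by apply: gM; rewrite leq_max leqnn.
    by congr normL2; apply/funext => z; ring.
under eq_fun do rewrite mulrBl -mulrA.
rewrite cintB; [|exact: L2_mul|by apply: cintegrableZ; exact: L2_mul].
rewrite cintZ; last exact: L2_mul.
rewrite gH sub0r => /eqP; rewrite oppr_eq0 mulf_eq0 => /orP[/eqP//|].
rewrite -/(dotH i n n i) dotHE !eqxx/= mulf_eq0 (negbTE mass_neq0) orbF pnatr_eq0.
by rewrite eqn0Ngt muln_gt0 !fact_gt0.
Qed.

Lemma partial_lin a alpha beta N z :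
  hermite_psum (fun j => a * alpha j + beta j) N z =
  a * hermite_psum alpha N z + hermite_psum beta N z.
Proof.
rewrite /hermite_psum big_distrr/= -big_split/=; apply: eq_bigr => j _.
by rewrite mulrDl mulrA.
Qed.

Lemma cvg_distL2_sqn f (g : nat -> plane -> R[i]) :
  distL2 f (g N) @[N --> \oo] --> (0 : R) <->
  sqn (fun z => f z - g N z) @[N --> \oo] --> (0 : R).
Proof.
split=> fg.
  rewrite (_ : (fun N => sqn _) = (fun N => distL2 f (g N) * distL2 f (g N))).
    by rewrite -[X in _ --> X](mulr0 0); exact: cvgM.
  by apply/funext => N; rewrite -expr2 sqr_normL2.
rewrite (_ : (fun N => distL2 f (g N)) =
    (fun N => Num.sqrt (sqn (fun z => f z - g N z)))); last first.
  by apply/funext => N; rewrite -normL2E.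
rewrite -[X in _ --> X]sqrtr0.
by apply: continuous_cvg => //; exact: sqrt_continuous.
Qed.

Lemma true_poly_bargmann_subspace : subspaceL2 A.
Proof.
split=> [f [] //|f g [f2 [alpha [sa fa]]] g2 fg||a f g].
- split => //; exists alpha; split => //; move: fa.
  under eq_fun => N do rewrite (@ae_distL2 _ _ g _ (hermite_psum alpha N) (L2_cmeas f2)
    (L2_cmeas g2) (L2_cmeas (L2_hermite_psum _ _)) (L2_cmeas (L2_hermite_psum _ _)) fg
    (ae_eq_refl _ _ _)).
  by [].
- split; first exact: L2_0.
  exists (fun=> 0); split.
    rewrite (_ : series _ = fun=> 0); first exact: is_cvg_cst.
    apply/funext => N; rewrite /series/= big1// => j _.
    by rewrite /sqabs/= expr0n/= addr0 mulr0.
  rewrite (_ : (fun N => _) = fun=> 0); first exact: cvg_cst.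
  apply/funext => N; rewrite /distL2 normL2E /sqn.
  rewrite (_ : (fun z => _) = fun=> 0) ?Rintegral_cst// ?mul0r ?sqrtr0//.
  apply/funext => z; rewrite big1 => [|j _]; last by rewrite mul0r.
  by rewrite subrr /sqabs/= expr0n/= addr0.
move=> [f2 [alpha [sa fa]]] [g2 [beta [sb gb]]]; split; first exact: L2_lin.
exists (fun j => a * alpha j + beta j); split.
  (* The comparison series comes from |av + w|^2 <= 2 |a|^2 |v|^2 + 2 |w|^2. *)
  have sab : cvgn (series (fun j => 2 * sqabs a * (j`!%:R * sqabs (alpha j)) +
      2 * (j`!%:R * sqabs (beta j)))).
    apply: is_cvg_seriesD; exact: is_cvg_seriesZ.
  apply: series_le_cvg sab => j.
  - by rewrite mulr_ge0// sqabs_ge0.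
  - by rewrite addr_ge0// !mulr_ge0// sqabs_ge0.
  - rewrite (_ : _ + _ = j`!%:R * (2 * (sqabs a * sqabs (alpha j)) + 2 * sqabs (beta j))).
      by rewrite ler_wpM2l// -sqabsM sqabsD_le.
    by ring.
apply/cvg_distL2_sqn; move/cvg_distL2_sqn : fa => fa; move/cvg_distL2_sqn : gb => gb.
have ub : (2 * sqabs a * sqn (fun z => f z - hermite_psum alpha N z) +
    2 * sqn (fun z => g z - hermite_psum beta N z)) @[N --> \oo] --> (0 : R).
  rewrite -[X in _ --> X]addr0; apply: cvgD.
    by rewrite -[X in _ --> X](mulr0 (2 * sqabs a)); apply: cvgMr.
  by rewrite -[X in _ --> X](mulr0 2); apply: cvgMr.
apply: (squeeze_cvgr _ (cvg_cst 0) ub); near=> N; rewrite sqn_ge0/=.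
have := sqn_lin a (L2_B f2 (L2_hermite_psum alpha N)) (L2_B g2 (L2_hermite_psum beta N)).
apply: le_trans; rewrite le_eqVlt; apply/orP; left; apply/eqP; congr sqn.
apply/funext => z; have := partial_lin a alpha beta N z.
by rewrite {1}/hermite_psum => ->; ring.
Unshelve. all: end_near. Qed.

Lemma true_poly_bargmann_hermite i : A (H i n).
Proof.
split; first exact: L2_hermite.
exists (fun j => (j == i)%:R).
have near0 : \forall N \near \oo, forall z, hermite_psum (fun j => (j == i)%:R) N z = H i n z.
  exists i.+1 => // N /= iN z; rewrite /hermite_psum (bigD1 (Ordinal iN))//= eqxx mul1r.
  rewrite itoHE big1 ?addr0// => j ji; rewrite (_ : (j == i :> nat) = false) ?mul0r//.
  by apply/negbTE; apply: contra ji => /eqP ji; apply/eqP/val_inj.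
split.
  apply: (@cvgP _ _ (series (fun j => j`!%:R * sqabs ((j == i)%:R : R[i])) i.+1 : R)).
  apply: cvg_near_cst; exists i.+1 => // N /= iN.
  rewrite /series/= (@big_cat_nat _ _ _ i.+1)//=.
  rewrite [X in _ + X]big_nat_cond [X in _ + X]big1 ?addr0// => j /andP[/andP[ij _] _].
  by rewrite gtn_eqF// /sqabs/= expr0n/= addr0 mulr0.
apply: cvg_near_cst; move: near0; apply: filterS => N NE.
rewrite /distL2 normL2E /sqn (_ : (fun z => _) = fun=> 0) ?Rintegral_cst// ?mul0r ?sqrtr0//.
apply/funext => z; have := NE z; rewrite /hermite_psum => ->.
by rewrite subrr /sqabs/= expr0n/= addr0.
Qed.

End true_poly.

End bargmann_spaces.

(** * Spans, closures and images under the projected transform *)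

Section ranges.
Context {R : realType}.
Local Notation plane := (plane R).
Local Notation mu := (@gauss_mu R).
Local Notation H := (@hermite R).
Implicit Types (f g h u : plane -> R[i]) (V S : set (plane -> R[i])).

Lemma lincomb_cat (a : R[i]) N1 (c1 : 'I_N1 -> R[i]) (e1 : 'I_N1 -> plane -> R[i])
    N2 (c2 : 'I_N2 -> R[i]) (e2 : 'I_N2 -> plane -> R[i]) (z : plane) :
  lincomb (fun i : 'I_(N1 + N2)%N =>
      match fintype.split i with inl j => a * c1 j | inr j => c2 j end)
    (fun i : 'I_(N1 + N2)%N => match fintype.split i with inl j => e1 j | inr j => e2 j end) z =
  a * lincomb c1 e1 z + lincomb c2 e2 z.
Proof.
rewrite /lincomb big_split_ord big_distrr/=; congr (_ + _); apply: eq_bigr => j _.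
  by case: split_ordP => k /eqP; rewrite ?eq_lshift ?eq_lrshift// => /eqP ->; rewrite mulrA.
by case: split_ordP => k /eqP; rewrite ?eq_rshift ?eq_rlshift// => /eqP ->.
Qed.

Lemma spanL2_lin S a f g : spanL2 S f -> spanL2 S g ->
  spanL2 S (fun z => a * f z + g z).
Proof.
move=> [f2 [N1 [c1 [e1 [S1 fE]]]]] [g2 [N2 [c2 [e2 [S2 gE]]]]].
split; first exact: L2_lin.
exists (N1 + N2)%N, (fun i : 'I_(N1 + N2)%N =>
    match fintype.split i with inl j => a * c1 j | inr j => c2 j end),
  (fun i : 'I_(N1 + N2)%N => match fintype.split i with inl j => e1 j | inr j => e2 j end); split.
  by move=> k; case: (fintype.split k).
by apply: filterS2 fE gE => z fE gE _; rewrite lincomb_cat fE// gE.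
Qed.

Lemma spanL2_0 S : spanL2 S (fun=> 0).
Proof.
split; first exact: L2_0.
exists 0%N, (fun=> 0), (fun=> fun=> 0); split; first by case.
by apply: aeW => z _; rewrite /lincomb big_ord0.
Qed.

Lemma spanL2_mem S f : L2 f -> S f -> spanL2 S f.
Proof.
move=> f2 Sf; split => //; exists 1%N, (fun=> 1), (fun=> f); split => //.
by apply: aeW => z _; rewrite /lincomb big_ord1 mul1r.
Qed.

Lemma distL2_self f : distL2 f f = 0.
Proof.
rewrite /distL2 normL2E /sqn (_ : (fun z => _) = fun=> 0) ?Rintegral_cst// ?mul0r ?sqrtr0//.
by apply/funext => z; rewrite subrr /sqabs/= expr0n/= addr0.
Qed.

Lemma closureL2_mem S f : L2 f -> S f -> closureL2 S f.
Proof. by move=> f2 Sf; split => // eps e0; exists f => //; rewrite distL2_self. Qed.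

Lemma closureL2_subspace S : S `<=` @L2 R -> S (fun=> 0) ->
  (forall a f g, S f -> S g -> S (fun z => a * f z + g z)) ->
  subspaceL2 (closureL2 S).
Proof.
move=> S2 S0 Slin; split=> [f [] //|f g [f2 fS] g2 fg||a f g [f2 fS] [g2 gS]].
- split => // eps e0; have [h Sh fh] := fS _ e0; exists h => //.
  rewrite -(ae_distL2 (L2_cmeas f2) (L2_cmeas g2) (L2_cmeas (S2 _ Sh))
    (L2_cmeas (S2 _ Sh)) fg)//.
  exact: ae_eq_refl.
- by apply: closureL2_mem => //; exact: L2_0.
split; first exact: L2_lin.
(* The sum of the constants in [sqn_lin]; [d] is then taken so that c d^2 = eps^2. *)
move=> eps e0; pose c := 2 * sqabs a + 2.
have c0 : 0 < c by rewrite /c ltr_wpDl// mulr_ge0// sqabs_ge0.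
pose d := Num.sqrt (eps ^+ 2 / c).
have d0 : 0 < d by rewrite sqrtr_gt0 divr_gt0// exprn_gt0.
have d2 : d ^+ 2 = eps ^+ 2 / c by rewrite sqr_sqrtr// ltW// divr_gt0// exprn_gt0.
have [f' Sf' ff'] := fS _ d0; have [g' Sg' gg'] := gS _ d0.
exists (fun z => a * f' z + g' z); first exact: Slin.
have sq (u v : plane -> R[i]) : distL2 u v < d -> sqn (fun z => u z - v z) < d ^+ 2.
  by move=> uv; rewrite -sqr_normL2 ltr_pXn2r ?nnegrE ?normL2_ge0// ltW.
rewrite -(@ltr_pXn2r _ 2)// ?nnegrE ?normL2_ge0 ?ltW// sqr_normL2.
have := sqn_lin a (L2_B f2 (S2 _ Sf')) (L2_B g2 (S2 _ Sg')).
rewrite (_ : (fun z => a * (f z - f' z) + _) =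
  (fun z => a * f z + g z - (a * f' z + g' z))); last by apply/funext => z; ring.
move=> /le_lt_trans; apply.
have := sq _ _ ff'; have := sq _ _ gg'; rewrite d2 => gd fd.
have -> : eps ^+ 2 = 2 * sqabs a * (eps ^+ 2 / c) + 2 * (eps ^+ 2 / c).
  by rewrite -mulrDl -/c mulrC mulfVK// gt_eqF.
(* The factor [sqabs a] may be 0, so strictness is drawn from the second term. *)
apply: ler_ltD; last by rewrite ltr_pM2l.
by rewrite ler_wpM2l ?mulr_ge0 ?sqabs_ge0// ltW.
Qed.

Section tilde.
Variable l : nat.
Local Notation B := (@bargmann_tilde R l).

Lemma bargmann_tilde_subspace : subspaceL2 B.
Proof.
apply: closureL2_subspace; [by move=> f []|exact: spanL2_0|].
by move=> a f g; exact: spanL2_lin.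
Qed.

Lemma bargmann_tilde_hermite k : B (H l k).
Proof.
apply: closureL2_mem; first exact: L2_hermite.
by apply: spanL2_mem; [exact: L2_hermite|exists k => //; exact: itoHE].
Qed.

Lemma bargmann_tilde_cint_eq0 f k : B f -> L2 k ->
  (forall j, cint mu (fun z => H l j z * k z) = 0) ->
  cint mu (fun z => f z * k z) = 0.
Proof.
move=> [f2 fB] k2 k0; apply: cint_mul_eq0_closure => // d d0.
have [g [g2 [N [c [e [eS gE]]]]] fg] := fB _ d0.
exists g; split => //.
have eH i : exists j, e i = H l j by have [j _ <-] := eS i; exists j; rewrite itoHE.
have e2 i : L2 (e i) by have [j ->] := eH i; exact: L2_hermite.
rewrite (ae_cint_mul (L2_cmeas g2) (L2_cmeas (L2_lincomb c e2)) (L2_cmeas k2) gE).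
rewrite cint_lincomb// big1// => i _; have [j ->] := eH i.
by rewrite k0 mulr0.
Qed.

End tilde.

Section projection.
Variables (n : nat) (V : set (plane -> R[i])).
Hypothesis VS : subspaceL2 V.

Lemma proj_cauchy_subspace : subspaceL2 (proj_cauchy n V).
Proof.
have [V2 Vae V0 Vlin] := VS; have [A2 Aae A0 Alin] := @true_poly_bargmann_subspace R n.
split=> [g [f _ [_ /A2]] //|g g' [f Vf [C2 Ag gH]] g'2 gg'||a g1 g2].
- have g2 := A2 _ Ag.
  exists f => //; split; [by []|exact: Aae gg'|move=> h Ah; rewrite -(gH h Ah)].
  rewrite !dotL2E; apply: ae_cint_mul.
  + exact: L2_cmeas (L2_B C2 g'2).
  + exact: L2_cmeas (L2_B C2 g2).
  + exact: L2_cmeas (L2_conj (A2 _ Ah)).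
  + by apply: filterS gg' => z /[apply] ->.
- exists (fun=> 0) => //.
  have C0 : cauchy_mu (fun=> 0 : R[i]) = fun=> 0.
    apply/funext => z; rewrite cauchyE (_ : (fun xi => _) = fun=> 0) ?cint0 ?mulr0//.
    by apply/funext => xi; rewrite mul0r.
  split; [by rewrite C0; exact: L2_0|by []|move=> h Ah].
  rewrite C0 dotL2E (_ : (fun z => _) = fun=> 0) ?cint0//.
  by apply/funext => z; rewrite subrr mul0r.
move=> [f1 Vf1 [C1 Ag1 g1H]] [f2 Vf2 [C2 Ag2 g2H]].
exists (fun z => a * f1 z + f2 z); first exact: Vlin.
(* Linearity holds only where both integrals converge. It also puts the transform of the combination
   in L^2, from the two transforms known to lie there. *)
have CE : cauchy_mu (fun z => a * f1 z + f2 z) =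
    (fun z => a * cauchy_mu f1 z + cauchy_mu f2 z) %[ae mu].
  have i1 := ae_kernel_cintegrable (L2_cintegrable (V2 _ Vf1)).
  have i2 := ae_kernel_cintegrable (L2_cintegrable (V2 _ Vf2)).
  by apply: filterS2 i1 i2 => z i1 i2 _; exact: cauchy_lin.
have L := L2_lin a C1 C2.
have Cm : cmeas (cauchy_mu (fun z => a * f1 z + f2 z)).
  by apply: cmeas_cauchy; apply: L2_cmeas; exact: L2_lin (V2 _ Vf1) (V2 _ Vf2).
have CL : L2 (cauchy_mu (fun z => a * f1 z + f2 z)).
  apply: (L2_ae L Cm); move: CE; apply: filterS => z E Tz.
  by rewrite E.
split => //; first exact: Alin.
move=> h Ah; have h2 := A2 _ Ah; have h2' := L2_conj h2.
have D1 := L2_B C1 (A2 _ Ag1); have D2 := L2_B C2 (A2 _ Ag2).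
rewrite dotL2E (@ae_cint_mul _ _ (fun z => a * (cauchy_mu f1 z - g1 z) +
  (cauchy_mu f2 z - g2 z))).
- under eq_fun do rewrite mulrDl -mulrA.
  rewrite cintD; [|by apply: cintegrableZ; exact: L2_mul|exact: L2_mul].
  rewrite cintZ; last exact: L2_mul.
  by rewrite -!dotL2E g1H// g2H// mulr0 addr0.
- by apply: L2_cmeas; apply: L2_B => //; exact: A2 _ (Alin _ _ _ Ag1 Ag2).
- by apply: L2_cmeas; exact: L2_lin.
- exact: L2_cmeas.
- by move: CE; apply: filterS => z E Tz; rewrite E//; ring.
Qed.

Lemma proj_cauchy_hermite i p q : (n + p = (i + q).+1)%N -> V (H p q) ->
  proj_cauchy n V (H i n).
Proof.
have [V2 Vae V0 Vlin] := VS.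
move=> npq VH; pose b := pairH (R := R) p q n i; pose D := dotH (R := R) i n n i.
have b0 : b != 0 by exact: pairH_neq0.
have D0 : D != 0.
  by rewrite /D dotHE !eqxx/= mulf_neq0 ?mass_neq0// pnatr_eq0 -lt0n muln_gt0 !fact_gt0.
(* The transform of [H p q] has against the [H j n] the single nonzero coefficient [b], at j = i;
   [D] is the coefficient of [H i n] itself, so after this scaling the projection is exactly
   [H i n]. *)
pose c := D / b.
exists (fun z => c * H p q z).
  by have := Vlin c _ _ VH V0; congr V; apply/funext => z; rewrite addr0.
have CE : cauchy_mu (fun z => c * H p q z) = (fun z => c * cauchy_mu (H p q) z).
  by apply/funext => z; apply: cauchyZ; apply: nice_kernel_cintegrable; exact: nice_hermite.
have C2 := L2_Z c (L2_cauchy_hermite (R := R) p q).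
rewrite /is_orthoproj CE; split => //; first exact: true_poly_bargmann_hermite.
move=> h Ah; apply: (@true_poly_bargmann_dot_eq0 _ n) => // [|j].
  by apply: L2_B => //; exact: L2_hermite.
rewrite dotL2_hermite; under eq_fun do rewrite mulrBl -mulrA.
rewrite cintB; [|by apply: cintegrableZ; exact: pairH_int|exact: dotH_int].
rewrite cintZ; last exact: pairH_int.
rewrite -/(pairH p q n j) -/(dotH i n n j).
have [->|ji] := eqVneq j i; first by rewrite -/b -/D /c mulfVK// subrr.
rewrite pairH_eq0 ?mulr0 ?dotHE; last first.
  by rewrite npq eqSS eqn_add2r eq_sym.
by rewrite eq_sym (negbTE ji) subrr.
Qed.

(** The projection keeps the coefficients of the transform, and antisymmetry moves the transform
    from [f] to the Hermite polynomial, which leaves a linear condition on [f] alone. *)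
Lemma proj_cauchy_dot_eq0 g i : proj_cauchy n V g ->
  (forall f, V f -> cint mu (fun z => f z * cauchy_mu (H n i) z) = 0) ->
  dotL2 g (H i n) = 0.
Proof.
have [V2 _ _ _] := VS; have [A2 _ _ _] := @true_poly_bargmann_subspace R n.
move=> [f Vf [C2 Ag gH]] fC.
have := gH _ (true_poly_bargmann_hermite n i); rewrite !dotL2_hermite.
under eq_fun do rewrite mulrBl.
have Hni := L2_hermite (R := R) n i; have g2 := A2 _ Ag.
rewrite cintB; [|exact: L2_mul|exact: L2_mul].
rewrite cauchy_adjoint; [|exact: L2_cintegrable (V2 _ Vf)|exact: nice_hermite].
by rewrite fC// oppr0 sub0r => /eqP; rewrite oppr_eq0 => /eqP.
Qed.

End projection.

End ranges.

(** * The two families of ranges in terms of Hermite polynomials *)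

Section range_bases.
Context {R : realType}.
Local Notation plane := (plane R).
Local Notation mu := (@gauss_mu R).
Local Notation H := (@hermite R).
Variables n l : nat.

Lemma lincomb_hermite_free N (s : 'I_N -> nat) (c : 'I_N -> R[i]) :
  injective s -> lincomb c (fun k => H (s k) n) = (fun=> 0) %[ae mu] ->
  forall k, c k = 0.
Proof.
move=> sI c0 k.
have H2 j : L2 (H (s j) n) by exact: L2_hermite.
have Hk : L2 (H n (s k)) by exact: L2_hermite.
have := ae_cint_mul (L2_cmeas (L2_lincomb c H2)) (L2_cmeas L2_0) (L2_cmeas Hk) c0.
under [X in _ = cint _ X]eq_fun do rewrite mul0r.
rewrite cint0 cint_lincomb// (bigD1 k)//= big1 ?addr0; last first.
  move=> j jk; rewrite -/(dotH (s j) n n (s k)) dotHE (_ : (s j == s k) = false) ?mulr0//.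
  by apply/negbTE; apply: contra jk => /eqP/sI ->.
move/eqP; rewrite mulf_eq0 => /orP[/eqP//|].
rewrite -/(dotH (s k) n n (s k)) dotHE !eqxx/= mulf_eq0 (negbTE mass_neq0) orbF.
by rewrite pnatr_eq0 eqn0Ngt muln_gt0 !fact_gt0.
Qed.

(** The preimage is a multiple of [H j l]; the bound on [j] is the condition n + j >= l + 1 for the
    target index to exist. *)
Lemma Rspace_hermite j : (l + 1 - n <= j)%N -> Rspace R n l (H (n + j - l - 1) n).
Proof.
move=> lj; apply: (@proj_cauchy_hermite _ _ _ _ _ j l).
- exact: true_poly_bargmann_subspace.
- lia.
- exact: true_poly_bargmann_hermite.
Qed.

Lemma Rspace_tilde_hermite k : (k < n + l)%N -> Rspace_tilde R n l (H k n).
Proof.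
move=> kl; apply: (@proj_cauchy_hermite _ _ _ _ _ l (n + l - k.+1)%N).
- exact: bargmann_tilde_subspace.
- lia.
- exact: bargmann_tilde_hermite.
Qed.

(** A nonzero coefficient would come from [H j l] with j + n = l + i + 1, impossible for a natural
    number [j]. *)
Lemma Rspace_dot_eq0 (g : plane -> R[i]) i : (i + l + 1 < n)%N ->
  Rspace R n l g -> dotL2 g (H i n) = 0.
Proof.
move=> iln Rg; apply: (proj_cauchy_dot_eq0 (true_poly_bargmann_subspace l) Rg) => f Af.
apply: (true_poly_bargmann_cint_eq0 Af); first exact: L2_cauchy_hermite.
move=> j; under eq_fun do rewrite mulrC.
by rewrite -/(pairH n i j l) pairH_eq0//; apply/eqP; lia.
Qed.

(** A nonzero coefficient would come from [H l j] with l + n = j + i + 1, impossible for i >= n + l.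
    Here the first index of the source is fixed, so only finitely many [i] remain. *)
Lemma Rspace_tilde_dot_eq0 (g : plane -> R[i]) i : (n + l <= i)%N -> Rspace_tilde R n l g ->
  dotL2 g (H i n) = 0.
Proof.
move=> nli Rg; apply: (proj_cauchy_dot_eq0 (bargmann_tilde_subspace l) Rg) => f Bf.
apply: (bargmann_tilde_cint_eq0 Bf); first exact: L2_cauchy_hermite.
move=> j; under eq_fun do rewrite mulrC.
by rewrite -/(pairH n i l j) pairH_eq0//; apply/eqP; lia.
Qed.

Lemma proj_cauchy_bargmann V (g : plane -> R[i]) : proj_cauchy n V g -> true_poly_bargmann n g.
Proof. by move=> [f _ []]. Qed.

Lemma Rspace_closure : Rspace R n l `<=`
  closureL2 (spanL2 [set itoH (n + j - l - 1) n | j in [set j : nat | (l + 1 - n <= j)%N]]).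
Proof.
move=> g Rg; have [g2 [alpha [_ ga]]] := proj_cauchy_bargmann Rg.
have alpha0 i : (i + l + 1 < n)%N -> alpha i = 0.
  by move=> iln; apply: (hermite_series_coef_eq0 g2 ga); exact: Rspace_dot_eq0.
split => // eps e0; have [M gM] := hermite_psum_approx e0 ga.
exists (hermite_psum n alpha M); last exact: gM.
split; first exact: L2_hermite_psum.
(* Indices outside the spanning family carry coefficient 0; [itoH n n], the member with parameter
   [l + 1], fills their places. *)
exists M, (fun j : 'I_M => alpha j),
  (fun j : 'I_M => if (j + l + 1 < n)%N then itoH n n else itoH j n); split.
  move=> k; case: ifPn => kn.
    by exists (l + 1)%N => /=; [lia|congr itoH; lia].
  by exists (k + l + 1 - n)%N => /=; [lia|congr itoH; lia].
apply: aeW => z _; rewrite /hermite_psum /lincomb; apply: eq_bigr => j _.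
by case: ifPn => // jn; rewrite alpha0// !mul0r.
Qed.

(** Given a basis of size [d], the [d.+1] functions [H (n + k) n] would have a coordinate matrix
    with a nonzero left kernel, against their linear independence. *)
Lemma Rspace_infinite_dim : infinite_dim (Rspace R n l).
Proof.
move=> d [e [eR efree espan]].
have RH (k : 'I_d.+1) : Rspace R n l (H (n + k) n).
  rewrite (_ : n + k = n + (l + 1 + k) - l - 1)%N; last lia.
  by apply: Rspace_hermite; lia.
have /boolp.choice [c cE] : forall k : 'I_d.+1, exists c : 'I_d -> R[i],
    H (n + k) n = lincomb c e %[ae mu] by move=> k; exact: espan.
pose M : 'M[R[i]]_(d.+1, d) := \matrix_(k, s) c k s.
have K0 : kermx M != 0.
  by rewrite kermx_eq0 /row_free neq_ltn ltnS rank_leq_col.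
pose v := nz_row (kermx M).
have vM : v *m M = 0 by apply/eqP; rewrite -sub_kermx nz_row_sub.
have v0 : v != 0 by rewrite nz_row_eq0.
have sI : injective (fun k : 'I_d.+1 => (n + k)%N).
  by move=> j k /addnI /ord_inj.
have vH : lincomb (fun k => v ord0 k) (fun k : 'I_d.+1 => H (n + k) n) =
    (fun=> 0) %[ae mu].
  have : \forall z \ae mu, forall k : 'I_d.+1,
      setT z -> H (n + k) n z = lincomb (c k) e z.
    by apply: filter_forall => k; exact: cE.
  apply: filterS => z zE _; rewrite /lincomb.
  under eq_bigr => k _ do rewrite (zE k I) /lincomb mulr_sumr.
  rewrite exchange_big/= big1// => s _.
  under eq_bigr => k _ do rewrite mulrA.
  have vMs : \sum_k v ord0 k * c k s = 0.
    transitivity ((v *m M) ord0 s); last by rewrite vM mxE.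
    by rewrite [RHS]mxE; apply: eq_bigr => k _; rewrite [M _ _]mxE.
  by rewrite -mulr_suml vMs mul0r.
move/eqP: v0; apply; apply/matrixP => i k; rewrite ord1 [RHS]mxE.
exact: (lincomb_hermite_free sI vH).
Qed.

Lemma Rspace_tilde_span (g : plane -> R[i]) : Rspace_tilde R n l g -> exists c : 'I_(n + l) -> R[i],
  g = lincomb c (fun k : 'I_(n + l) => itoH k n) %[ae mu].
Proof.
move=> Rg; have [g2 [alpha [_ ga]]] := proj_cauchy_bargmann Rg.
have alpha0 i : (n + l <= i)%N -> alpha i = 0.
  by move=> iln; apply: (hermite_series_coef_eq0 g2 ga); exact: Rspace_tilde_dot_eq0.
exists (fun k => alpha k).
(* The partial sums are stationary from [n + l] on, so their distance to [g] is eventually constant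
   and, tending to 0, is 0. *)
have pE N : (n + l <= N)%N -> hermite_psum n alpha N = hermite_psum n alpha (n + l).
  move=> nlN; apply/funext => z; rewrite /hermite_psum.
  rewrite -!(big_mkord xpredT (fun j => alpha j * itoH j n z)).
  rewrite (@big_cat_nat _ _ _ (n + l))//=.
  rewrite [X in _ + X]big_nat_cond [X in _ + X]big1 ?addr0// => j /andP[/andP[ij _] _].
  by rewrite alpha0// mul0r.
apply: distL2_0_ae => //; first exact: (L2_hermite_psum n alpha (n + l)).
have cst : distL2 g (hermite_psum n alpha N) @[N --> \oo] -->
    distL2 g (hermite_psum n alpha (n + l)).
  by apply: cvg_near_cst; exists (n + l)%N => // N /= /pE ->.
exact: (cvg_unique _ cst ga).
Qed.

End range_bases.

(* In (i), truncated subtraction makes (l + 1 - n)%N equal to                 *)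
(* max(0, l + 1 - n), and no truncation occurs in (n + j - l - 1)%N.          *)
Theorem theorem3p2 (R : realType) (n l : nat) :
  [/\ [/\ subspaceL2 (Rspace R n l),
          infinite_dim (Rspace R n l),
          (forall j : nat, (l + 1 - n <= j)%N ->
             Rspace R n l (itoH (n + j - l - 1) n)) &
          Rspace R n l `<=`
            closureL2 (spanL2 [set itoH (n + j - l - 1) n
                               | j in [set j : nat | (l + 1 - n <= j)%N]])],
      Rspace_tilde R 0 0 = zeroL2 R &
      (0 < l + n)%N ->
      [/\ subspaceL2 (Rspace_tilde R n l),
          has_dim (Rspace_tilde R n l) (n + l),
          basisL2 (Rspace_tilde R n l)
            (fun k : 'I_(n + l) => itoH k n) &
          orthogonal_family (fun k : 'I_(n + l) => itoH (R := R) k n)]].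
Proof.
have tilde_sub m k : subspaceL2 (Rspace_tilde R m k).
  exact: proj_cauchy_subspace (bargmann_tilde_subspace k).
have basis : basisL2 (Rspace_tilde R n l) (fun k : 'I_(n + l) => itoH k n).
  split; last exact: Rspace_tilde_span.
    by move=> k; rewrite itoHE; exact: Rspace_tilde_hermite.
  have -> : (fun k : 'I_(n + l) => itoH k n) = (fun k => @hermite R k n).
    by apply/funext => k; rewrite itoHE.
  by move=> c; apply: (lincomb_hermite_free (s := @nat_of_ord (n + l))); exact: ord_inj.
split.
- split; [exact: proj_cauchy_subspace (true_poly_bargmann_subspace l)|exact: Rspace_infinite_dim| |
    exact: Rspace_closure].
  by move=> j lj; rewrite itoHE; exact: Rspace_hermite.
(* For n = l = 0 the spanning family is indexed by the empty ['I_(0 + 0)], so every element is an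
   empty sum. *)
- have [T2 Tae T0 _] := tilde_sub 0%N 0%N; apply/seteqP; split=> [g Rg|g [g2 g0]].
    split; first exact: T2.
    have [c gE] := Rspace_tilde_span Rg.
    by apply: filterS gE => z /[apply] ->; rewrite /lincomb big_ord0.
  by apply: (Tae _ _ T0 g2); exact: ae_eq_sym.
move=> _; split => //; first by exists (fun k : 'I_(n + l) => itoH k n).
move=> j k jk; rewrite !itoHE dotL2_hermite -/(dotH j n n k) dotHE.
by rewrite (_ : (j == k :> nat) = false)//; apply/negbTE.
Qed.
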